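(* Let $g:\mathbb{R}\to\mathbb{R}$ be a differentiable function such that: (i) $g$ is nondecreasing and $g(0)=0$; (ii) $yg(y)>0$ for all $y\neq 0$; (iii) there is a constant $c_2>0$ with $|g(x+y)|\le c_2(|g(x)|+|g(y)|+1)$ for all $x,y\in\mathbb{R}$; (iv) there is a constant $c_3\ge 1$ with $|g'(y)|\le c_3\frac{1+|g(y)|}{1+|y|}$ for all $y\in\mathbb{R}$. Let $(W,W',T)$ be a $g$-Stein's coupling, i.e. real random variables with $$\mathrm{E}\bigl(Tf(W')-Tf(W)\bigr)=\mathrm{E}\bigl(f(W)g(W)\bigr)$$ for all absolutely continuous $f$ such that the expectations on both sides exist. Assume $|W'-W|\le\delta$ for a constant $\delta>0$, so that $$\mathrm{E}\bigl(f(W)g(W)\bigr)=\mathrm{E}\Bigl(\int_{|t|\le\delta}f'(W+t)\hat K(t)\,dt\Bigr),\qquad \hat K(t)=T\bigl(I(0\le t\le W'-W)-I(W'-W\le t<0)\bigr),$$ and assume $\hat K(t)\ge 0$ for $|t|\le\delta$. Put $\hat K_1=T(W'-W)$. Assume there exist $\tau_1>0$, $\delta_1>0$, $d_0\ge 1$, $d_1>0$ such that $$|\mathrm{E}(\hat K_1\mid W)-1|\le\delta_1(|g(W)|^{\tau_1}+1),\qquad \mathrm{E}(\hat K_1\mid W)\le d_0,\qquad \delta|g(W)|\le d_1.$$ Let $Y$ be a random variable with density $p(y)=c_1e^{-G(y)}$, $y\in\mathbb{R}$. Then $$\frac{\mathrm{P}(W>z)}{\mathrm{P}(Y>z)}=1+O(1)\Bigl(\delta\bigl(1+zg^2(z)\bigr)+\delta_1\bigl(1+zg^{\tau_1+1}(z)\bigr)\Bigr)$$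 for all $z\ge 0$ satisfying $\delta zg^2(z)+\delta_1zg^{\tau_1+1}(z)\le 1$, where $O(1)$ denotes a quantity bounded in absolute value by a finite constant depending only on $d_0,d_1,c_1,c_2,c_3,\tau_1$ and $\max(g(1),|g(-1)|)$.
   Context: $I(\cdot)$ is the indicator function. $G(y)=\int_0^yg(t)\,dt$, and $c_1$ is the normalizing constant making $p(y)=c_1e^{-G(y)}$ a probability density on $\mathbb{R}$. $g^{\tau}(z)$ means $(g(z))^{\tau}$. Inequalities between random variables are understood almost surely. *)

(* Defs.v *)
From HB Require Import structures.
From mathcomp Require Import all_boot all_order all_algebra.
From mathcomp Require Import all_classical all_reals all_analysis.

Set Implicit Arguments.
Unset Strict Implicit.
Unset Printing Implicit Defensive.

Import Order.TTheory GRing.Theory Num.Theory.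
Import numFieldNormedType.Exports.

Local Open Scope classical_set_scope.
Local Open Scope ring_scope.

(* Absolute continuity on the whole real line. Intervals with a i = b i are
   allowed; they are empty and contribute nothing to either sum. *)
Definition absolutely_continuous (R : realType) (f : R -> R) : Prop :=
  forall e : R, 0 < e -> exists2 r : R, 0 < r &
    forall (n : nat) (a b : 'I_n -> R),
      (forall i, a i <= b i) ->
      trivIset [set: 'I_n] (fun i => `]a i, b i[%classic) ->
      \sum_(i < n) (b i - a i) < r ->
      \sum_(i < n) `|f (b i) - f (a i)| < e.

(* The oriented integral of g from 0 to y. *)
Definition integral_from0 (R : realType) (g : R -> R) (y : R) : R :=
  if 0 <= y then \int[lebesgue_measure]_(t in `[0, y]) g t
  else - \int[lebesgue_measure]_(t in `[y, 0]) g t.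

Definition has_density (R : realType) (d : measure_display)
    (T : measurableType d) (P : probability T R) (X : {RV P >-> R})
    (p : R -> R) : Prop :=
  forall A : set R, measurable A ->
    distribution P X A = (\int[lebesgue_measure]_(y in A) (p y)%:E)%E.

(* E is a version of the conditional expectation of Z given the sigma-algebra
   generated by X. *)
Definition is_cond_expectation (R : realType) (d : measure_display)
    (T : measurableType d) (P : probability T R) (Z : T -> R)
    (X : {RV P >-> R}) (E : T -> R) : Prop :=
  [/\ P.-integrable [set: T] (EFin \o Z),
      P.-integrable [set: T] (EFin \o E),
      measurable_fun [set: g_sigma_algebra_preimageType X] E &
      forall A : set T, g_sigma_algebra_preimage X A ->
        (\int[P]_(x in A) (E x)%:E = \int[P]_(x in A) (Z x)%:E)%E].

(* Test functions are those for which both expectations are finite. *)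
Definition Stein_coupling (R : realType) (d : measure_display)
    (Omega : measurableType d) (P : probability Omega R) (g : R -> R)
    (W W' T : {RV P >-> R}) : Prop :=
  forall f : R -> R, absolutely_continuous f ->
    P.-integrable [set: Omega]
      (EFin \o (fun w => T w * f (W' w) - T w * f (W w))) ->
    P.-integrable [set: Omega] (EFin \o (fun w => f (W w) * g (W w))) ->
    ('E_P[(fun w => T w * f (W' w) - T w * f (W w))%R]
       = 'E_P[(fun w => f (W w) * g (W w))%R])%E.

Definition K_hat (R : realType) (d : measure_display)
    (Omega : measurableType d) (P : probability Omega R)
    (W W' T : {RV P >-> R}) (t : R) (w : Omega) : R :=
  T w * ((0 <= t <= W' w - W w)%R%:R - (W' w - W w <= t < 0)%R%:R).

Definition K_hat1 (R : realType) (d : measure_display)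
    (Omega : measurableType d) (P : probability Omega R)
    (W W' T : {RV P >-> R}) (w : Omega) : R :=
  T w * (W' w - W w).

(* Main.v *)
Require Import Defs.
From HB Require Import structures.
From mathcomp Require Import all_boot all_order all_algebra.
From mathcomp Require Import all_classical all_reals all_analysis.
From mathcomp Require Import measurable_realfun ring lra.

Set Implicit Arguments.
Unset Strict Implicit.
Unset Printing Implicit Defensive.

Import Order.TTheory GRing.Theory Num.Theory.
Import numFieldNormedType.Exports.

Local Open Scope classical_set_scope.
Local Open Scope ring_scope.

(** Write [S x] for the probability that [Y] exceeds [x] and [p = c1 exp (- G)] for
    its density. The equation [f' = g f + S v - 1_(v < x)] has a bounded solution
    [f], built from the Mills ratios [S / p] and [(1 - S) / p]
    ([stein_solution]). On the other hand the coupling gives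
    [E f(W) g(W) = E T (f(W') - f(W))], and with [K1 = T (W' - W)] the right-hand side
    is [E K1 * slope], for the slope of [f] between [W] and [W']. If the slope were
    [f'(W)] and [E (K1 | W)] were one, taking expectations in the equation would give
    exactly [P (W > v) = S v].

    The two replacements produce the two error terms of the theorem. Let [omega] be
    the common majorant [S v (1 + |g x|) exp (G (clamp 0 v x))] of [g f] and of
    [S v - 1_(v < x)] ([stein_weight]). Over a step of length [delta]
    the continuous part of [f'] moves by [O (delta (1 + |g|) omega)], and its jump at
    [v] is avoided by comparing [S v] with the tail of [W] at [v + delta] or
    [v - delta]. The second replacement costs [|E (K1 | W) - 1| omega]. Hence the
    relative error is bounded by moments of the form
    [E (1 + |g(W)|) ^ (s + 1) exp (G (clamp 0 v W))] ([stein_inequalities]), and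
    [expect_weight] shows that these are [O ((1 + v) (1 + g v) ^ (s + 1))], as they
    would be for [Y] in place of [W].

    This last estimate needs to know beforehand that the tail of [W] is at most of
    the order of that of [Y]. It comes from the coupling again, with the test function
    [exp H - 1] for an exponent [H] slightly below [G] ([tail_test],
    [tail_exponential]): both sides of Stein's identity are then dominated by
    [E g exp H], with a coefficient on the right that is at most one up to the level
    and at most one half beyond it. The assumption on [z] ensures that the loss in
    the exponent is bounded, since [G z <= z g z].

    The positivity of the kernel enters through the sign of [K1]: it makes
    [T (f(W') - f(W))] monotone in the slopes of [f], so that the coupling identity
    becomes an inequality for slope bounds, which can be conditioned on [W]
    ([core_coupling]). The constants are uniform in [g] because three properties are:
    [g] is subadditive up to constants, the logarithmic derivative of [1 + |g|] tends
    to zero at infinity at a given rate, and the normalization of [p] bounds [g] from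
    below away from the origin. *)

(** * Mean values and derivatives *)

Section MeanValue.
Variable R : realType.
Implicit Types f df : R -> R.

Lemma mvt f df (a b : R) : (forall x : R, is_derive x 1 f (df x)) -> a <= b ->
  exists2 c, a <= c <= b & f b - f a = df c * (b - a).
Proof.
move=> fdf ab.
have cf : {within `[a, b], continuous f}.
  by apply: derivable_within_continuous => x _; exact: ex_derive.
have [c cab ->] := MVT_segment ab (fun x _ => fdf x) cf.
by exists c => //; move: cab; rewrite in_itv.
Qed.

Lemma mvt_oo f df (a b : R) : (forall x : R, is_derive x 1 f (df x)) -> a < b ->
  exists2 c, a < c < b & f b - f a = df c * (b - a).
Proof.
move=> fdf ab.
have cf : {within `[a, b], continuous f}.
  by apply: derivable_within_continuous => x _; exact: ex_derive.
have [c cab ->] := MVT ab (fun x _ => fdf x) cf.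
by exists c => //; move: cab; rewrite in_itv.
Qed.

Lemma is_derive_continuous f df : (forall x : R, is_derive x 1 f (df x)) ->
  continuous f.
Proof.
move=> fdf x; apply/differentiable_continuous/derivable1_diffP.
exact: ex_derive.
Qed.

Lemma is_derive_mul f g (x df dg : R) :
  is_derive x (1 : R) f df -> is_derive x (1 : R) g dg ->
  is_derive x (1 : R) (fun y => f y * g y) (df * g x + f x * dg).
Proof.
move=> hf hg; apply: (is_derive_eq (is_deriveM hf hg)).
by rewrite /GRing.scale /= addrC (mulrC (g x)).
Qed.

Lemma is_derive_compR f g (x df dg : R) :
  is_derive (g x) (1 : R) f df -> is_derive x (1 : R) g dg ->
  is_derive x (1 : R) (fun y => f (g y)) (df * dg).
Proof.
by move=> hf hg; have := is_derive1_comp hf hg.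
Qed.

Lemma is_derive_linear (a x : R) : is_derive x (1 : R) (fun y : R => a * y) a.
Proof.
have := is_derive_mul (is_derive_cst a x 1) (is_derive_id x 1).
by rewrite mul0r add0r mulr1.
Qed.

Lemma is_derive_addc a f (x df : R) : is_derive x (1 : R) f df ->
  is_derive x (1 : R) (fun y => a + f y) df.
Proof.
move=> hf; apply: (is_derive_eq (is_deriveD (is_derive_cst a x 1) hf)).
by rewrite add0r.
Qed.

Lemma is_derive_opp f (x df : R) : is_derive x (1 : R) f df ->
  is_derive x (1 : R) (fun y => - f y) (- df).
Proof. by move=> hf; exact: is_deriveN. Qed.

Lemma is_derive_scale a f (x df : R) : is_derive x (1 : R) f df ->
  is_derive x (1 : R) (fun y => a * f y) (a * df).
Proof.
move=> hf; have := is_derive_mul (is_derive_cst a x 1) hf.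
by rewrite mul0r add0r.
Qed.

Lemma is_derive_add f g (x df dg : R) : is_derive x (1 : R) f df ->
  is_derive x (1 : R) g dg -> is_derive x (1 : R) (fun y => f y + g y) (df + dg).
Proof. by move=> hf hg; exact: is_deriveD. Qed.

Lemma is_derive_exp f (x df : R) : is_derive x (1 : R) f df ->
  is_derive x (1 : R) (fun y => expR (f y)) (expR (f x) * df).
Proof. by move=> hf; apply: is_derive_compR. Qed.

End MeanValue.

(** * Drifts and their primitives *)

Section Drift.
Variables (R : realType) (c1 c2 c3 m : R).
Hypotheses (c1_gt0 : 0 < c1) (c2_gt0 : 0 < c2) (c3_ge1 : 1 <= c3)
  (m_ge0 : 0 <= m).

(** All bounds below are uniform over this class, which is closed under
    [y |-> - g (- y)]: estimates at one end of the line give those at the other.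
    The normalization of the density [c1 * expR (- G y)] enters only through
    [drift_mass]; it is what prevents [g] from being arbitrarily flat. *)
Record drift (g G : R -> R) : Prop := Drift {
  drift_primitive : forall x : R, is_derive x 1 G (g x);
  drift_derivable : forall x : R, derivable g x 1;
  drift_primitive0 : G 0 = 0;
  drift0 : g 0 = 0;
  drift_homo : forall x y : R, x <= y -> g x <= g y;
  drift_add : forall x y : R, `|g (x + y)| <= c2 * (`|g x| + `|g y| + 1);
  drift_derive : forall y : R, `|g^`()%classic y| <= c3 * ((1 + `|g y|) / (1 + `|y|));
  drift_le1 : g 1 <= m;
  drift_geN1 : - g (-1) <= m;
  drift_mass : forall y : R, c1 * `|y| * expR (- G y) <= 1 }.

Lemma drift_reflect g G : drift g G ->
  drift (fun x => - g (- x)) (fun x => G (- x)).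
Proof.
case=> dG dg G0 g0 gh ga gd g1 gN1 mass.
have dN (x : R) : is_derive x (1 : R) (fun y : R => - y) (- 1 : R).
  exact: is_deriveN.
have dr (x : R) : is_derive x (1 : R) (fun y => g (- y)) (- g^`()%classic (- x)).
  rewrite -mulrN1; apply: is_derive_compR => //.
  by rewrite derive1E; exact: derivableP.
have dr' (x : R) : is_derive x (1 : R) (fun y => - g (- y)) (g^`()%classic (- x)).
  by rewrite -[g^`()%classic _]opprK; exact: is_deriveN.
split => //=.
- by move=> x; rewrite -mulrN1; apply: is_derive_compR.
- by rewrite oppr0.
- by rewrite oppr0 g0 oppr0.
- by move=> x y xy; rewrite lerN2; apply: gh; rewrite lerN2.
- by move=> x y; rewrite !normrN opprD.
- move=> y; rewrite derive1E (@derive_val _ _ _ _ _ _ _ (dr' y)).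
  by have := gd (- y); rewrite !normrN.
- by rewrite !opprK.
- by move=> y; have := mass (- y); rewrite normrN.
Qed.

Section OneDrift.
Variables g G : R -> R.
Hypothesis gG : drift g G.

Lemma drift_ge0 (y : R) : 0 <= y -> 0 <= g y.
Proof. by move=> /(drift_homo gG); rewrite (drift0 gG). Qed.

Lemma drift_le0 (y : R) : y <= 0 -> g y <= 0.
Proof. by move=> /(drift_homo gG); rewrite (drift0 gG). Qed.

Lemma drift_is_derive (x : R) : is_derive x 1 g (g^`()%classic x).
Proof. by rewrite derive1E; apply: derivableP; exact: drift_derivable gG x. Qed.

Lemma drift_continuous : continuous g.
Proof. exact: is_derive_continuous drift_is_derive. Qed.

Lemma primitive_continuous : continuous G.
Proof. exact: is_derive_continuous (drift_primitive gG). Qed.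

Lemma primitive_convex (x y : R) : x <= y ->
  g x * (y - x) <= G y - G x <= g y * (y - x).
Proof.
move=> xy; have [c /andP[xc cy] ->] := mvt (drift_primitive gG) xy.
by rewrite !ler_wpM2r ?subr_ge0//; exact: drift_homo gG _ _ _.
Qed.

Lemma primitive_ge0 (y : R) : 0 <= G y.
Proof.
have [y0|/ltW y0] := leP 0 y; have := primitive_convex y0;
  rewrite (drift0 gG) (drift_primitive0 gG) mul0r => /andP[]; lra.
Qed.

Lemma primitive_homo (x y : R) : 0 <= x -> x <= y -> G x <= G y.
Proof.
move=> x0 xy; have /andP[+ _] := primitive_convex xy.
have : 0 <= g x * (y - x) by rewrite mulr_ge0 ?drift_ge0 ?subr_ge0.
lra.
Qed.

Lemma primitive_le (y : R) : 0 <= y -> G y <= g y * y.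
Proof.
by move=> /primitive_convex /andP[_]; rewrite (drift_primitive0 gG) !subr0.
Qed.

Lemma drift_norm_le1 (t : R) : `|t| <= 1 -> `|g t| <= m.
Proof.
rewrite !ler_norml => /andP[t1 t2]; apply/andP; split.
  rewrite lerNl; apply: le_trans (drift_geN1 gG).
  by rewrite lerN2; exact: drift_homo gG _ _ _.
by apply: le_trans (drift_le1 gG); exact: drift_homo gG _ _ _.
Qed.

(** Subadditivity up to constants, with one of the two arguments in the unit
    ball: over unit steps [1 + |g|] changes by a bounded factor. *)
Lemma drift_shift (x y : R) : `|y - x| <= 1 ->
  1 + `|g y| <= (1 + c2 * (m + 1)) * (1 + `|g x|).
Proof.
move=> yx; have := drift_add gG x (y - x); rewrite addrC subrK.
have := drift_norm_le1 yx; move: (normr_ge0 (g x)) c2_gt0 m_ge0.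
set u := `|g x|; set v := `|g y|; set w := `|g (y - x)| => u0 c20 m0 wm vle.
have : c2 * (u + w + 1) <= c2 * (u + m + 1) by rewrite ler_pM2l; lra.
have : 0 <= c2 * m * u by rewrite !mulr_ge0 // ltW.
by nra.
Qed.

Lemma drift_derive_le (y : R) : `|g^`()%classic y| <= c3 * (1 + `|g y|).
Proof.
apply: le_trans (drift_derive gG y) _; rewrite ler_wpM2l ?(le_trans ler01)//.
rewrite ler_pdivrMr ?ltr_wpDr//.
by rewrite ler_peMr ?addr_ge0// lerDl.
Qed.

Lemma drift_lipschitz (x y : R) : `|y - x| <= 1 ->
  `|g y - g x| <= c3 * (1 + c2 * (m + 1)) * (1 + `|g x|) * `|y - x|.
Proof.
move=> yx.
have aux (c : R) : `|c - x| <= 1 ->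
    `|g^`()%classic c| <= c3 * (1 + c2 * (m + 1)) * (1 + `|g x|).
  move=> cx; apply: le_trans (drift_derive_le c) _.
  by rewrite -mulrA ler_wpM2l ?(le_trans ler01)// drift_shift.
have [xy|/ltW xy] := leP x y.
  have [c /andP[xc cy] ->] := mvt drift_is_derive xy.
  rewrite normrM ler_wpM2r//; apply: aux; apply: le_trans yx.
  by rewrite !ger0_norm ?subr_ge0// lerB.
have [c /andP[xc cy] e] := mvt drift_is_derive xy.
rewrite distrC e normrM (distrC x y) ler_wpM2r//; apply: aux; apply: le_trans yx.
by rewrite distrC (distrC y) !ger0_norm ?subr_ge0// lerB.
Qed.

End OneDrift.

(** Go from [0] to [y] in boundedly many steps of length at most one. *)
Lemma drift_bounded (r : R) : exists2 B : R, 0 < B &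
  forall g G, drift g G -> forall y : R, `|y| <= r -> 1 + `|g y| <= B.
Proof.
set Cg := 1 + c2 * (m + 1).
have Cg0 : 0 < Cg by rewrite ltr_wpDr// mulr_ge0 ?addr_ge0// ltW.
have [n rn] : exists n : nat, r <= n%:R.
  by exists (Num.bound `|r|); apply/(le_trans (ler_norm r))/ltW/archi_boundP.
exists (Cg ^+ n); first exact: exprn_gt0.
move=> g G gG y /le_trans /(_ rn); elim: n y {r rn} => [|n IH] y yn.
  by move: yn; rewrite normr_le0 => /eqP ->; rewrite (drift0 gG) normr0 addr0.
have n1 : 0 < n.+1%:R :> R by [].
rewrite exprS; apply: le_trans (_ : Cg * (1 + `|g (y * (n%:R / n.+1%:R))|) <= _).
  apply: (drift_shift gG).
  rewrite -[X in `|X - _|]mulr1 -mulrBr normrM.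
  have -> : 1 - n%:R / n.+1%:R = n.+1%:R^-1 :> R.
    by rewrite -natr1; field; rewrite natr1 lt0r_neq0.
  by rewrite [X in _ * X]ger0_norm ?invr_ge0// ler_pdivrMr// mul1r.
rewrite ler_pM2l//; apply: IH; rewrite normrM [X in _ * X]ger0_norm ?divr_ge0// mulrCA.
by rewrite ler_piMr// ler_pdivrMr// mul1r.
Qed.

(** At [y0 = e / c1] the mass bound reads [expR (1 - G y0) <= 1], so that
    [1 <= G y0 <= g y0 * y0]. *)
Lemma drift_lower : exists A a : R, [/\ 1 <= A, 0 < a &
  forall g G, drift g G -> forall y : R, A <= y -> a <= g y].
Proof.
pose y0 := expR 1 / c1.
have y00 : 0 < y0 by rewrite divr_gt0 ?expR_gt0.
exists (Num.max 1 y0), y0^-1; split; first by rewrite le_max lexx.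
  by rewrite invr_gt0.
move=> g G gG y; rewrite ge_max => /andP[_ y0y].
apply: le_trans (drift_homo gG y0y).
rewrite -[_^-1]mul1r ler_pdivrMr//.
apply: le_trans (primitive_le gG (ltW y00)).
have := drift_mass gG y0; rewrite (ger0_norm (ltW y00)).
have -> : c1 * y0 = expR 1 by rewrite /y0 mulrC divfK// gt_eqF.
by rewrite -expRD -[leRHS]expR0 ler_expR subr_le0.
Qed.

(** Beyond [c3 / kappa] the bound on the derivative of [g] says that
    [ln (1 + g)] has slope at most [kappa], hence [(1 + g y) expR (- kappa y)]
    is nonincreasing there. Thus [g] is negligible before any exponential,
    uniformly over the class. *)
Lemma drift_growth (kappa : R) : 0 < kappa -> exists2 C : R, 0 < C &
  forall g G, drift g G -> forall z x : R, 0 <= z -> z <= x ->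
    1 + g x <= C * ((1 + g z) * expR (kappa * (x - z))).
Proof.
move=> k0; set X := c3 / kappa.
have X0 : 0 <= X by rewrite divr_ge0 ?(ltW k0)// (le_trans ler01).
have [B B0 hB] := drift_bounded X.
exists (1 + B); first by rewrite addr_gt0.
move=> g G gG z x z0 zx.
have gz0 := drift_ge0 gG z0; have x0 := le_trans z0 zx; have gx0 := drift_ge0 gG x0.
have hX (y : R) : 0 <= y <= X -> 1 + g y <= B.
  move=> /andP[y0 yX]; have := hB _ _ gG y.
  by rewrite !ger0_norm ?(drift_ge0 gG)//; exact.
have main (u v : R) : X <= u -> u <= v -> 1 + g v <= (1 + g u) * expR (kappa * (v - u)).
  move=> Xu uv.
  pose f (y : R) := (1 + g y) * expR (- (kappa * y)).
  have df (y : R) : is_derive y 1 f (g^`()%classic y * expR (- (kappa * y)) +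
      (1 + g y) * (- kappa * expR (- (kappa * y)))).
    apply: is_derive_mul.
      exact/is_derive_addc/(drift_is_derive gG y).
    rewrite [X in is_derive _ _ _ X]mulrC; apply: is_derive_exp.
    under eq_fun do rewrite -mulNr; exact: is_derive_linear.
  have : f v <= f u.
    have [c /andP[uc _] e] := mvt df uv.
    rewrite -subr_le0 e mulr_le0_ge0 ?subr_ge0//.
    have c0 : 0 <= c by rewrite (le_trans X0)// (le_trans Xu).
    have gc0 := drift_ge0 gG c0.
    suff : g^`()%classic c <= kappa * (1 + g c) by have := expR_gt0 (- (kappa * c)); nra.
    apply: le_trans (ler_norm _) _; apply: le_trans (drift_derive gG c) _.
    rewrite !ger0_norm// mulrCA mulrC ler_wpM2r ?addr_ge0//.
    rewrite ler_pdivrMr ?ltr_wpDr//; have := le_trans Xu uc.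
    by rewrite ler_pdivrMr// => h; nra.
  rewrite /f -(ler_pM2r (expR_gt0 (kappa * v))) -mulrA -expRD addNr expR0 mulr1.
  by rewrite -mulrA -expRD mulrBr (addrC (kappa * v)).
have E1 : 1 <= expR (kappa * (x - z)).
  by rewrite -expR0 ler_expR mulr_ge0 ?subr_ge0// ltW.
have step : 1 + g x <= B * expR (kappa * (x - z)) ->
   1 + g x <= (1 + B) * ((1 + g z) * expR (kappa * (x - z))).
  move=> /le_trans; apply; rewrite mulrA ler_wpM2r ?expR_ge0//; nra.
have [xX|/ltW Xx] := leP x X.
  apply: step; apply: (@le_trans _ _ B); first by apply: hX; rewrite x0.
  by rewrite ler_peMr// ltW.
have [zX|/ltW Xz] := leP z X.
  apply: step; apply: le_trans (main _ _ (lexx _) Xx) _.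
  apply: ler_pM; rewrite ?expR_ge0 ?addr_ge0 ?drift_ge0//.
  - exact: drift_ge0 gG X X0.
  - by apply: hX; rewrite X0 lexx.
  - by rewrite ler_expR ler_pM2l// lerD2l lerN2.
apply: le_trans (main _ _ Xz zx) _; rewrite ler_peMl ?mulr_ge0 ?expR_ge0 ?addr_ge0//.
by rewrite lerDl ltW.
Qed.

End Drift.

(** * Bounded random variables *)

Ltac nn := repeat first [ assumption
  | match goal with H : forall _ : _, is_true (0 <= _) |- _ => exact: H end
  | exact: ltW | exact: normr_ge0
  | exact: expR_ge0 | exact: powR_ge0 | exact: sqr_ge0 | exact: ler0n
  | exact: ler01 | by rewrite subr_ge0 | by rewrite le_max lexx orbT
  | by apply: (le_trans ler01) | by apply/ltW/(lt_le_trans ltr01)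
  | apply: addr_ge0 | apply: mulr_ge0 | rewrite invr_ge0 ].

Section Measurability.
Context d (T : measurableType d) (R : realType).
Implicit Types f g : T -> R.

Lemma mfun_cst (a : R) : measurable_fun setT (fun _ : T => a).
Proof. exact: measurable_cst. Qed.

Lemma mfunD' f g : measurable_fun setT f -> measurable_fun setT g ->
  measurable_fun setT (fun w => f w + g w).
Proof. by move=> mf mg; exact: measurable_funD. Qed.

Lemma mfunN' f : measurable_fun setT f -> measurable_fun setT (fun w => - f w).
Proof. by move=> mf; exact: measurable_funN. Qed.

Lemma mfunM' f g : measurable_fun setT f -> measurable_fun setT g ->
  measurable_fun setT (fun w => f w * g w).
Proof. by move=> mf mg; exact: measurable_funM. Qed.

Lemma mfun_exp f : measurable_fun setT f ->
  measurable_fun setT (fun w => expR (f w)).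
Proof. by move=> mf; exact: measurableT_comp (@measurable_expR R) mf. Qed.

Lemma mfun_powR f (p : R) : measurable_fun setT f ->
  measurable_fun setT (fun w => f w `^ p).
Proof. by move=> mf; exact: measurableT_comp (@measurable_powR R p) mf. Qed.

Lemma mfun_norm f : measurable_fun setT f ->
  measurable_fun setT (fun w => `|f w|).
Proof. by move=> mf; exact: measurableT_comp mf. Qed.

Lemma mfun_max f g : measurable_fun setT f -> measurable_fun setT g ->
  measurable_fun setT (fun w => Num.max (f w) (g w)).
Proof. by move=> mf mg; exact: measurable_maxr. Qed.

Lemma mfun_bool (b : T -> bool) : measurable_fun setT b ->
  measurable_fun setT (fun w => (b w)%:R : R).
Proof.
move=> mb.
have -> : (fun w => (b w)%:R : R) = (fun w => if b w then 1 else 0).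
  by apply/funext => w; case: (b w).
by apply: measurable_fun_ifT.
Qed.

Lemma mfun_lt f g : measurable_fun setT f -> measurable_fun setT g ->
  measurable_fun setT (fun w => (f w < g w)%R%:R : R).
Proof. by move=> mf mg; apply/mfun_bool/measurable_fun_ltr. Qed.

Lemma mfun_le f g : measurable_fun setT f -> measurable_fun setT g ->
  measurable_fun setT (fun w => (f w <= g w)%R%:R : R).
Proof. by move=> mf mg; apply/mfun_bool/measurable_fun_ler. Qed.

Lemma mfun_comp (h : R -> R) f : measurable_fun setT h ->
  measurable_fun setT f -> measurable_fun setT (fun w => h (f w)).
Proof. by move=> mh mf; exact: measurableT_comp mh mf. Qed.

End Measurability.

Ltac mfun := repeat first [ assumption | exact: mfun_cst | apply: measurable_id
  | apply: mfunD' | apply: mfunN' | apply: mfunM' | apply: mfun_exp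
  | apply: mfun_powR | apply: mfun_norm | apply: mfun_max
  | apply: mfun_lt | apply: mfun_le ].

Section BoundedExpectation.
Context d (Omega : measurableType d) (R : realType) (P : probability Omega R).
Implicit Types X Y : Omega -> R.

(** Bounded everywhere and not only almost surely, so that expectations are
    linear and monotone without integrability side conditions. *)
Definition bounded_rv X : Prop :=
  measurable_fun setT X /\ exists M, forall w, `|X w| <= M.

Notation E X := (\int[P]_w X w).

Lemma bounded_rv_integrable X : bounded_rv X ->
  P.-integrable setT (EFin \o X).
Proof.
move=> [mX [M XM]]; apply: measurable_bounded_integrable => //.
  by apply: (le_lt_trans (probability_le1 P measurableT)); rewrite ltry.
exists M; split; first exact: num_real.
by move=> x Mx w _ /=; apply: le_trans (XM w) _; exact: ltW.
Qed.

Lemma bounded_rvD X Y : bounded_rv X -> bounded_rv Y ->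
  bounded_rv (fun w => X w + Y w).
Proof.
move=> [mX [M XM]] [mY [N YN]]; split; first exact: mfunD'.
exists (M + N) => w; apply: le_trans (ler_normD _ _) _.
by rewrite lerD.
Qed.

Lemma bounded_rvN X : bounded_rv X -> bounded_rv (fun w => - X w).
Proof.
move=> [mX [M XM]]; split; first exact: mfunN'.
by exists M => w; rewrite normrN.
Qed.

Lemma bounded_rvM X Y : bounded_rv X -> bounded_rv Y ->
  bounded_rv (fun w => X w * Y w).
Proof.
move=> [mX [M XM]] [mY [N YN]]; split; first exact: mfunM'.
exists (M * N) => w; rewrite normrM.
by apply: ler_pM.
Qed.

Lemma bounded_rv_cst (a : R) : bounded_rv (fun=> a).
Proof. by split; [exact: mfun_cst|exists `|a|]. Qed.

Lemma bounded_rv_norm X : bounded_rv X -> bounded_rv (fun w => `|X w|).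
Proof.
move=> [mX [M XM]]; split; first exact: mfun_norm.
by exists M => w; rewrite normr_id.
Qed.

Lemma bounded_rv_bool (b : Omega -> bool) : measurable_fun setT b ->
  bounded_rv (fun w => (b w)%:R).
Proof.
move=> mb; split; first exact: mfun_bool.
by exists 1 => w; case: (b w); rewrite ?normr0 ?normr1.
Qed.

Lemma bounded_rv_lt X Y : measurable_fun setT X -> measurable_fun setT Y ->
  bounded_rv (fun w => (X w < Y w)%R%:R).
Proof. by move=> mX mY; apply/bounded_rv_bool/measurable_fun_ltr. Qed.

Lemma bounded_rv_le X Y : measurable_fun setT X -> measurable_fun setT Y ->
  bounded_rv (fun w => (X w <= Y w)%R%:R).
Proof. by move=> mX mY; apply/bounded_rv_bool/measurable_fun_ler. Qed.

Lemma expect_le X Y : bounded_rv X -> bounded_rv Y ->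
  (forall w, X w <= Y w) -> E X <= E Y.
Proof.
by move=> /bounded_rv_integrable iX /bounded_rv_integrable iY XY; exact: le_Rintegral.
Qed.

Lemma expectD X Y : bounded_rv X -> bounded_rv Y ->
  E (fun w => X w + Y w) = E X + E Y.
Proof.
by move=> /bounded_rv_integrable iX /bounded_rv_integrable iY; exact: RintegralD.
Qed.

Lemma expectZ (a : R) X : bounded_rv X -> E (fun w => a * X w) = a * E X.
Proof. by move=> /bounded_rv_integrable iX; exact: RintegralZl. Qed.

Lemma expect_cst (a : R) : E (fun=> a) = a.
Proof.
have := Rintegral_cst P (@measurableT _ Omega) a => /= ->.
by rewrite [X in fine X](_ : _ = 1%E) ?mulr1//; exact: probability_setT.
Qed.

Lemma expect_bool (b : Omega -> bool) : measurable_fun setT b ->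
  E (fun w => (b w)%:R) = fine (P [set w | b w]).
Proof.
move=> mb; have mB : measurable [set w | b w].
  have -> : [set w | b w] = setT `&` b @^-1` [set true] by rewrite setTI.
  exact: mb.
rewrite /Rintegral -[in RHS](setIT [set w | b w]) -integral_indic//.
congr fine; apply: eq_integral => w _; rewrite indicE; congr (_%:R%:E).
by case: (boolP (b w)) => bw; [rewrite mem_set|rewrite memNset//=; exact/negP].
Qed.

Lemma expect_lt (c : R) X : measurable_fun setT X ->
  E (fun w => (c < X w)%R%:R) = fine (P [set w | c < X w]).
Proof. by move=> mX; apply/expect_bool/measurable_fun_ltr. Qed.

End BoundedExpectation.

Ltac brv := repeat first [ assumption | exact: bounded_rv_cst
  | apply: bounded_rvD | apply: bounded_rvN | apply: bounded_rvM
  | apply: bounded_rv_norm | apply: bounded_rv_lt; [mfun|mfun]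
  | apply: bounded_rv_le; [mfun|mfun] ].

(** * Truncation to an interval *)

Section Clamp.
Variable R : realType.
Implicit Types a b c x y : R.

Definition clamp a b x : R := if x <= a then a else if b <= x then b else x.

Lemma clamp_itv a b x : a <= b -> a <= clamp a b x <= b.
Proof.
move=> ab; rewrite /clamp; case: (leP x a) => xa; first by rewrite lexx.
by case: (leP b x) => bx; rewrite ?ab ?lexx// !ltW.
Qed.

Lemma clamp_id a b x : a <= x <= b -> clamp a b x = x.
Proof.
move=> /andP[ax xb]; rewrite /clamp; case: (leP x a) => xa; first by apply: le_anti; rewrite ax.
by case: (leP b x) => bx //; apply: le_anti; rewrite xb bx.
Qed.

Lemma clamp_l a b x : x <= a -> clamp a b x = a.
Proof. by move=> xa; rewrite /clamp xa. Qed.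

Lemma clamp_r a b x : a <= b -> b <= x -> clamp a b x = b.
Proof.
move=> ab bx; rewrite /clamp bx; case: (leP x a) => xa //.
by apply: le_anti; rewrite ab (le_trans bx).
Qed.

Lemma clamp_homo a b x y : a <= b -> x <= y -> clamp a b x <= clamp a b y.
Proof.
move=> ab xy; rewrite /clamp; case: (leP x a) => ?; case: (leP b x) => ?;
  case: (leP y a) => ?; case: (leP b y) => ?; lra.
Qed.

Lemma clamp_sub a b x y : a <= b -> x <= y ->
  clamp a b y - clamp a b x <= y - x.
Proof.
move=> ab xy; rewrite /clamp; case: (leP x a) => ?; case: (leP b x) => ?;
  case: (leP y a) => ?; case: (leP b y) => ?; lra.
Qed.

(** Truncations to adjacent intervals share the increment between them. *)
Lemma clamp_add a b c x : a <= b -> b <= c ->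
  clamp a b x + clamp b c x = clamp a c x + b.
Proof.
move=> ab bc; have [xb|bx] := leP x b.
  rewrite (clamp_l _ xb); congr (_ + b); rewrite /clamp.
  case: (leP x a) => // _; case: (leP b x) => bx; case: (leP c x) => cx; lra.
rewrite (clamp_r ab (ltW bx)) addrC; congr (_ + b).
by rewrite /clamp !leNgt bx (le_lt_trans ab bx).
Qed.

Lemma clamp_sub2 a b c x y : a <= b -> b <= c -> x <= y ->
  (clamp a b y - clamp a b x) + (clamp b c y - clamp b c x) <= y - x.
Proof.
move=> ab bc xy; rewrite addrACA -opprD !clamp_add//.
rewrite opprD addrACA subrr addr0.
by apply: clamp_sub => //; exact: le_trans bc.
Qed.

Lemma lipschitz_measurable (f : R -> R) (M : R) :
  (forall x y, `|f x - f y| <= M * `|x - y|) -> measurable_fun setT f.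
Proof.
move=> fM; apply: continuous_measurable_fun => x.
apply/cvgrPdist_le => /= e e0; near=> y.
apply: le_trans (fM x y) _.
have M1 : 0 < `|M| + 1 by rewrite ltr_wpDl.
apply: (@le_trans _ _ ((`|M| + 1) * `|x - y|)).
  by rewrite ler_wpM2r// (le_trans (ler_norm M))// lerDl.
rewrite mulrC -ler_pdivlMr//; near: y.
by apply: cvgr_dist_le; [exact: cvg_id|rewrite divr_gt0].
Unshelve. all: end_near. Qed.

Lemma clamp_dist a b x y : a <= b -> `|clamp a b x - clamp a b y| <= `|x - y|.
Proof.
move=> ab; wlog xy : x y / x <= y.
  by have [xy|/ltW yx] := leP x y; [exact|rewrite distrC (distrC x); exact].
rewrite distrC (distrC x) !ger0_norm ?subr_ge0 ?clamp_homo//.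
exact: clamp_sub.
Qed.

Lemma mfun_clamp d (T : measurableType d) a b (f : T -> R) :
  a <= b ->
  measurable_fun setT f -> measurable_fun setT (fun w => clamp a b (f w)).
Proof.
move=> ab mf; apply: mfun_comp => //; apply: (@lipschitz_measurable _ 1) => x y.
by rewrite mul1r clamp_dist.
Qed.

End Clamp.

(** * Couplings conditioned on their first member *)

Section CoreCoupling.
Variables (R : realType) (d0 d1 tau : R).

(** What remains of a Stein coupling after conditioning on its first member:
    [X] plays the part of [W] and [k] that of [E (T (W' - W) | W)], both modified
    on a null set so that the assumptions hold everywhere.
    As [T (W' - W) >= 0], the difference [T (f W' - f W)] is [T (W' - W)] times a
    slope of [f], and is monotone in that slope; [core_stein] is therefore an
    inequality in which [u x] bounds the slopes of [f] over steps of size at most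
    [delta] from [x]. Applied to [f] and to [- f], it gives bounds in both
    directions. *)
Record core_coupling d (Omega : measurableType d) (P : probability Omega R)
    (g : R -> R) (delta delta1 : R) (X k : Omega -> R) : Prop := CoreCoupling {
  core_measurable : measurable_fun setT X;
  core_measurable_k : measurable_fun setT k;
  core_k : forall w, 0 <= k w <= d0;
  core_k1 : forall w, `|k w - 1| <= delta1 * (`|g (X w)| `^ tau + 1);
  core_drift : forall w, delta * `|g (X w)| <= d1;
  core_stein : forall (f u : R -> R) (M : R),
    (forall x y : R, `|f x - f y| <= M * `|x - y|) ->
    measurable_fun setT u ->
    (forall x : R, delta * `|g x| <= d1 -> `|f x * g x| <= M /\ `|u x| <= M) ->
    (forall x y : R, delta * `|g x| <= d1 -> `|y - x| <= delta ->
       (f y - f x) * (y - x) <= u x * (y - x) ^+ 2) ->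
    \int[P]_w (f (X w) * g (X w)) <= \int[P]_w (k w * u (X w)) }.

Lemma core_coupling_reflect d (Omega : measurableType d)
    (P : probability Omega R) g delta delta1 (X k : Omega -> R) :
  core_coupling P g delta delta1 X k ->
  core_coupling P (fun x => - g (- x)) delta delta1 (fun w => - X w) k.
Proof.
case=> mX mk k0 k1 gX key; split => //.
- exact: mfunN'.
- by move=> w; rewrite opprK normrN.
- by move=> w; rewrite opprK normrN.
- move=> f u M fM mu fu slope.
  have := key (fun x => - f (- x)) (fun x => u (- x)) M.
  set a := \int[P]_w _; set b := \int[P]_w _.
  have -> : \int[P]_w (f (- X w) * - g (- - X w)) = a.
    by apply: eq_Rintegral => w _; rewrite opprK mulrN mulNr.
  apply.
  + move=> x y; rewrite -opprD normrN; apply: le_trans (fM _ _) _.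
    by rewrite -opprD normrN.
  + by apply: mfun_comp => //; mfun.
  + move=> x gx; have := fu (- x); rewrite opprK normrN => /(_ gx).
    by rewrite !mulrN mulNr normrN.
  + move=> x y gx xy; have := slope (- x) (- y); rewrite opprK normrN => /(_ gx).
    have -> : - y + x = - (y - x) by ring.
    rewrite normrN => /(_ xy); rewrite sqrrN; apply: le_trans.
    by rewrite mulrN -mulNr opprB opprK addrC.
Qed.

Section OneCoupling.
Context d (Omega : measurableType d) (P : probability Omega R).
Variables (g : R -> R) (delta delta1 : R) (X k : Omega -> R).
Hypothesis (delta_gt0 : 0 < delta).
Hypothesis cc : core_coupling P g delta delta1 X k.

Lemma core_bounded (phi : R -> R) (M : R) : measurable_fun setT phi ->
  (forall x, delta * `|g x| <= d1 -> `|phi x| <= M) ->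
  bounded_rv (fun w => phi (X w)).
Proof.
move=> mphi phiM; split; first exact: mfun_comp (core_measurable cc).
by exists M => w; apply: phiM; exact: core_drift cc w.
Qed.

Lemma core_bounded_k : bounded_rv k.
Proof.
split; first exact: core_measurable_k cc.
exists d0 => w; have /andP[k0 kd] := core_k cc w.
by rewrite ger0_norm.
Qed.

Lemma core_drift_le (x : R) : delta * `|g x| <= d1 -> `|g x| <= d1 / delta.
Proof. by rewrite ler_pdivlMr// mulrC. Qed.

End OneCoupling.
End CoreCoupling.

(** * A test function for the upper tail *)

Section Tail.
Variables (R : realType) (c1 c2 c3 m d0 d1 tau : R).
Hypotheses (c1_gt0 : 0 < c1) (c2_gt0 : 0 < c2) (c3_ge1 : 1 <= c3)
  (m_ge0 : 0 <= m) (d0_ge1 : 1 <= d0) (d1_gt0 : 0 < d1) (tau_gt0 : 0 < tau).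

Notation drift := (drift c1 c2 c3 m).
Notation core_coupling := (core_coupling d0 d1 tau).

Lemma drift_measurable g G : drift g G -> measurable_fun setT g.
Proof. by move=> gG; apply: continuous_measurable_fun; exact: drift_continuous gG. Qed.

Lemma primitive_measurable g G : drift g G -> measurable_fun setT G.
Proof. by move=> gG; apply: continuous_measurable_fun; exact: primitive_continuous gG. Qed.

(** The test function [clamp (- 1) 1] has slopes at most one, and its product
    with [g] is [|g|] outside the unit interval. *)
Lemma expect_norm_drift d (Omega : measurableType d) (P : probability Omega R)
    g G delta delta1 X k : drift g G -> 0 < delta ->
  core_coupling P g delta delta1 X k -> \int[P]_w `|g (X w)| <= d0 + m.
Proof.
move=> gG del0 cc; pose f : R -> R := clamp (- 1) 1.
have N11 : - 1 <= 1 :> R by lra.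
have f1 x : `|f x| <= 1 by rewrite ler_norml; exact: clamp_itv.
have mf : measurable_fun setT f by apply: mfun_clamp => //; exact: measurable_id.
have mg := drift_measurable gG.
have bfg : bounded_rv (fun w => f (X w) * g (X w)).
  apply: (core_bounded cc (phi := fun x => f x * g x) (M := d1 / delta)).
    by mfun.
  move=> x /(core_drift_le del0) gx.
  by rewrite normrM (le_trans _ gx)// ler_piMl.
have bg : bounded_rv (fun w => `|g (X w)|).
  apply: (core_bounded cc (phi := fun x => `|g x|) (M := d1 / delta)); first by mfun.
  by move=> x /(core_drift_le del0); rewrite normr_id.
have bk := core_bounded_k cc.
have h : \int[P]_w (f (X w) * g (X w)) <= d0.
  apply: le_trans (core_stein cc (f := f) (u := fun=> 1) (M := 1 + d1 / delta) _ _ _ _) _.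
  - move=> x y; apply: le_trans (clamp_dist _ _ N11) _.
    by rewrite ler_peMl// lerDl divr_ge0 ?ltW.
  - exact: mfun_cst.
  - move=> x /(core_drift_le del0) gx; split; last first.
      by rewrite normr1 lerDl divr_ge0 ?ltW.
    rewrite normrM (@le_trans _ _ `|g x|) ?ler_piMl// (le_trans gx)//.
    by rewrite lerDr.
  - move=> x y _ _; rewrite mul1r expr2.
    have [xy|/ltW yx] := leP x y.
      by rewrite ler_wpM2r ?subr_ge0// clamp_sub.
    rewrite -[leLHS]mulrNN -[leRHS]mulrNN !opprB ler_wpM2r ?subr_ge0//.
    exact: clamp_sub.
  - under eq_Rintegral do rewrite mulr1.
    rewrite -[leRHS](expect_cst P); apply: expect_le => //; first exact: bounded_rv_cst.
    by move=> w; case/andP: (core_k cc w).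
rewrite -(expect_cst P m); apply: le_trans (lerD h (lexx _)).
rewrite -expectD//; last exact: bounded_rv_cst.
apply: expect_le => //; first by brv.
move=> w; set x := X w; have [x1|] := leP `|x| 1.
  have := drift_norm_le1 gG x1; suff : 0 <= f x * g x by lra.
  rewrite /f clamp_id -?ler_norml//.
  have [x0|/ltW x0] := leP 0 x; first by rewrite mulr_ge0// (drift_ge0 gG).
  by rewrite mulr_le0// (drift_le0 gG).
rewrite lter_normr => /orP[x1|x1].
  have gx : 0 <= g x by rewrite (drift_ge0 gG)// ltW// (lt_trans ltr01).
  by rewrite /f (clamp_r N11 (ltW x1)) mul1r (ger0_norm gx) lerDl.
have gx : g x <= 0 by rewrite (drift_le0 gG)//; lra.
have xN1 : x <= - 1 by lra.
by rewrite /f (clamp_l _ xN1) mulN1r (ler0_norm gx) lerDl.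
Qed.

(** The test function of the tail bound is [expR H - 1]. Up to the level [z]
    the exponent is [rho * G] with [rho] close to one; beyond [z] it only has the
    small slope [lam * g], and it stops at [L] to keep the test function
    Lipschitz. *)
Definition tail_exponent (G : R -> R) (rho lam z L x : R) : R :=
  rho * G (clamp 0 z x) + lam * (G (clamp z L x) - G z).

Section Exponent.
Variables (g G : R -> R) (rho lam z L : R).
Hypotheses (gG : drift g G) (lam_ge0 : 0 <= lam) (lam_rho : lam <= rho)
  (z_ge0 : 0 <= z) (zL : z <= L).
Let H := tail_exponent G rho lam z L.

Lemma tail_exponent0 (x : R) : x <= 0 -> H x = 0.
Proof.
move=> x0; rewrite /H /tail_exponent !clamp_l// ?(le_trans x0)//.
by rewrite (drift_primitive0 gG) subrr !mulr0 addr0.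
Qed.

Let GB (a b x y : R) : 0 <= a -> a <= b -> x <= y ->
  0 <= G (clamp a b y) - G (clamp a b x) <=
    g (clamp a b y) * (clamp a b y - clamp a b x).
Proof.
move=> a0 ab xy; have h := clamp_homo ab xy.
have /andP[_ ->] := primitive_convex gG h; rewrite andbT subr_ge0.
apply: (primitive_homo gG) => //; apply: le_trans a0 _.
by case/andP: (clamp_itv x ab).
Qed.

Lemma tail_exponent_homo x y : x <= y -> 0 <= H y - H x.
Proof.
move=> xy; have /andP[h1 _] := GB (lexx 0) z_ge0 xy.
have /andP[h2 _] := GB z_ge0 zL xy.
rewrite /H /tail_exponent; have rho0 : 0 <= rho by exact: le_trans lam_rho.
have := mulr_ge0 rho0 h1; have := mulr_ge0 lam_ge0 h2; lra.
Qed.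

Lemma tail_exponent_le x y : x <= y -> H y - H x <= rho * Num.max (g y) 0 * (y - x).
Proof.
move=> xy; have /andP[_ h1] := GB (lexx 0) z_ge0 xy.
have /andP[_ h2] := GB z_ge0 zL xy.
have rho0 : 0 <= rho by exact: le_trans lam_rho.
have c1' := clamp_homo z_ge0 xy; have c2' := clamp_homo zL xy.
have cs := clamp_sub2 z_ge0 zL xy.
have aux a b : 0 <= a -> a <= b -> g (clamp a b y) * (clamp a b y - clamp a b x) <=
    Num.max (g y) 0 * (clamp a b y - clamp a b x).
  move=> a0 ab; have [ya|/ltW ay] := leP y a.
    by rewrite !clamp_l ?subrr ?mulr0// (le_trans xy).
  rewrite ler_wpM2r ?subr_ge0 ?clamp_homo// le_max; apply/orP; left.
  apply: (drift_homo gG); have [yb|/ltW yb] := leP y b.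
    by rewrite clamp_id ?ay.
  by rewrite clamp_r.
have := le_trans h1 (aux _ _ (lexx 0) z_ge0).
have := le_trans h2 (aux _ _ z_ge0 zL).
have : 0 <= Num.max (g y) 0 by rewrite le_max lexx orbT.
rewrite /H /tail_exponent.
move: (Num.max _ _) c1' c2' cs; set u1 := clamp 0 z y; set u0 := clamp 0 z x.
set v1 := clamp z L y; set v0 := clamp z L x => M c1' c2' cs M0 e2 e1.
have f1 : rho * (G u1 - G u0) <= rho * (M * (u1 - u0)) by rewrite ler_wpM2l.
have f2 : lam * (G v1 - G v0) <= rho * (M * (v1 - v0)).
  by apply: ler_pM => //; have := tail_exponent_homo xy; case/andP: (GB z_ge0 zL xy).
have f3 : rho * M * ((u1 - u0) + (v1 - v0)) <= rho * M * (y - x).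
  by rewrite ler_wpM2l ?mulr_ge0.
lra.
Qed.

Lemma tail_exponent_le_far x y : z <= x -> x <= y ->
  H y - H x <= lam * g y * (y - x).
Proof.
move=> zx xy; have /andP[_ h2] := GB z_ge0 zL xy.
have zy := le_trans zx xy; have x0 := le_trans z_ge0 zx.
have y0 := le_trans x0 xy.
rewrite /H /tail_exponent !(clamp_r z_ge0)//.
have : g (clamp z L y) * (clamp z L y - clamp z L x) <= g y * (y - x).
  apply: ler_pM.
  - by apply: (drift_ge0 gG); apply: le_trans z_ge0 _; case/andP: (clamp_itv y zL).
  - by rewrite subr_ge0 clamp_homo.
  - apply: (drift_homo gG); have [yL|/ltW yL] := leP y L.
      by rewrite clamp_id ?zy.
    by rewrite clamp_r.
  - exact: clamp_sub.
move=> /(le_trans h2) => h3; have := ler_wpM2l lam_ge0 h3; lra.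
Qed.

Lemma tail_exponent_lip x y : x <= y -> H y - H x <= rho * g L * (y - x).
Proof.
move=> xy; have L0 := le_trans z_ge0 zL.
have HL t : L <= t -> H t = H L.
  by move=> Lt; rewrite /H /tail_exponent !clamp_r// ?(le_trans zL).
have rho0 : 0 <= rho by exact: le_trans lam_rho.
have gL0 := drift_ge0 gG L0.
have [Lx|/ltW xL] := leP L x.
  by rewrite !HL// ?(le_trans Lx)// subrr !mulr_ge0 ?subr_ge0.
have main t : x <= t -> t <= L -> H t - H x <= rho * g L * (t - x).
  move=> xt tL; apply: le_trans (tail_exponent_le xt) _.
  rewrite ler_wpM2r ?subr_ge0// ler_wpM2l// ge_max gL0 andbT.
  exact: drift_homo gG _ _ tL.
have [Ly|/ltW yL] := leP L y; last exact: main.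
rewrite (HL y)//; apply: le_trans (main _ xL (lexx _)) _.
by rewrite ler_wpM2l ?mulr_ge0// lerD2r.
Qed.

Lemma tail_exponent_max (x : R) : H x <= H L.
Proof.
have [xL|/ltW Lx] := leP x L; first by rewrite -subr_ge0 tail_exponent_homo.
have L0 := le_trans z_ge0 zL.
by rewrite /H /tail_exponent !clamp_r// ?(le_trans zL).
Qed.

End Exponent.

Lemma expR_sub_le (a b : R) : expR b - expR a <= expR b * (b - a).
Proof.
have := expR_ge1Dx (a - b); rewrite expRB ler_pdivlMr ?expR_gt0//; nra.
Qed.

Let Cg := 1 + c2 * (m + 1).
Let Cg_ge1 : 1 <= Cg.
Proof. by rewrite lerDl mulr_ge0 ?addr_ge0// ltW. Qed.

Section TestFunction.
Variables (A a B : R).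
Hypotheses (A_ge1 : 1 <= A) (a_gt0 : 0 < a).
Variables (g G : R -> R) (gG : drift g G).
Hypotheses (g_lower : forall y : R, A <= y -> a <= g y)
  (g_upper : forall y : R, `|y| <= A + 1 -> 1 + `|g y| <= B).

Definition tail_K : R := c3 * Cg / a + expR (Cg * (1 + d1)) * Cg.

Let K_ge0 : 0 <= tail_K.
Proof.
rewrite addr_ge0// mulr_ge0 ?expR_ge0 ?invr_ge0 ?(ltW a_gt0)//.
  by rewrite mulr_ge0// (le_trans ler01).
by rewrite (le_trans ler01).
Qed.

(** The left-hand side comes from a slope of [expR H] between [x] and [y]. Both
    [g] and [expR H] change by a factor [1 + O(delta * (1 + g x))] over a step of
    length [delta], because [delta * g x <= d1]. *)
Lemma near_ratio (delta x y : R) : 0 < delta -> delta <= 1 -> A <= x ->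
  delta * g x <= d1 -> x <= y -> y - x <= delta ->
  g y * expR (delta * g y) <= (1 + tail_K * (delta * (1 + g x))) ^+ 2 * g x.
Proof.
move=> del0 del1 Ax dx xy yx.
have gxa := g_lower Ax; have gx0 : 0 < g x by exact: lt_le_trans gxa.
have gy0 : 0 <= g y by rewrite (le_trans (ltW gx0))// (drift_homo gG).
have yx1 : `|y - x| <= 1 by rewrite ger0_norm ?subr_ge0// (le_trans yx).
set w := delta * (1 + g x).
have w0 : 0 <= w by rewrite mulr_ge0 ?(ltW del0)// addr_ge0// ltW.
have wd : w <= 1 + d1 by rewrite /w mulrDr mulr1 lerD.
have s1 : g y <= g x * (1 + c3 * Cg / a * w).
  have := drift_lipschitz c2_gt0 c3_ge1 m_ge0 gG yx1.
  rewrite (ger0_norm (ltW gx0)) -/Cg => /(le_trans (ler_norm _)).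
  rewrite ger0_norm ?subr_ge0// => h.
  have c30 : 0 <= c3 * Cg by rewrite mulr_ge0// ?(le_trans ler01).
  have h1 : c3 * Cg * (1 + g x) * (y - x) <= c3 * Cg * (1 + g x) * delta.
    by rewrite ler_wpM2l// mulr_ge0// addr_ge0// ltW.
  have h2 : c3 * Cg * w <= g x * (c3 * Cg / a * w).
    rewrite mulrA ler_wpM2r// mulrCA ler_peMr// ler_pdivlMr// mul1r.
    exact: gxa.
  rewrite /w in h2 *; lra.
have s2 : delta * g y <= Cg * w.
  have := drift_shift c2_gt0 m_ge0 gG yx1.
  rewrite (ger0_norm (ltW gx0)) (ger0_norm gy0) -/Cg => h.
  rewrite /w mulrCA ler_pM2l//; lra.
have s3 : expR (delta * g y) <= 1 + expR (Cg * (1 + d1)) * Cg * w.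
  have := expR_sub_le 0 (delta * g y); rewrite expR0 subr0 lerBlDl => /le_trans; apply.
  rewrite lerD2l -mulrA; apply: ler_pM; [by nn|by nn| |exact: s2].
  rewrite ler_expR; apply: le_trans s2 _; rewrite ler_wpM2l//.
  exact: le_trans Cg_ge1.
have k1 : 0 <= c3 * Cg / a.
  rewrite divr_ge0 ?(ltW a_gt0)// mulr_ge0// ?(le_trans ler01)//.
have k2 : 0 <= expR (Cg * (1 + d1)) * Cg.
  by rewrite mulr_ge0 ?expR_ge0// (le_trans ler01).
apply: le_trans (ler_pM gy0 (expR_ge0 _) s1 s3) _.
rewrite [leRHS]mulrC -[leLHS]mulrA ler_wpM2l ?(ltW gx0)// expr2.
have := mulr_ge0 k1 w0; have := mulr_ge0 k2 w0; rewrite /tail_K mulrDl => p2 p1.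
by apply: ler_pM; lra.
Qed.

Variables (delta rho lam z L : R).
Hypotheses (delta_gt0 : 0 < delta) (delta_le1 : delta <= 1)
  (lam_ge0 : 0 <= lam) (lam_rho : lam <= rho) (rho_le1 : rho <= 1)
  (z_ge0 : 0 <= z) (zL : z <= L).
Let H := tail_exponent G rho lam z L.
Let C1 := B * expR (B * (A + 1)).
Let C2 := (1 + tail_K * (1 + d1)) ^+ 2.
Let a1 := tail_K * (Cg * (delta * (1 + g z))).
Let theta (x : R) := rho * (1 + a1) ^+ 2 * (x <= z + delta)%R%:R
  + lam * C2 * (z + delta < x)%R%:R.
Let u (x : R) := C1 + theta x * (Num.max (g x) 0 * expR (H x)).

Let rho_ge0 : 0 <= rho. Proof. exact: le_trans lam_rho. Qed.
Let A1_ge0 : 0 <= A + 1. Proof. by rewrite addr_ge0// (le_trans ler01). Qed.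
Let B_ge1 : 1 <= B.
Proof.
have := g_upper (y := 0); rewrite normr0 => /(_ A1_ge0); apply: le_trans.
by rewrite lerDl.
Qed.
Let B_ge0 : 0 <= B. Proof. exact: le_trans B_ge1. Qed.

Let gz_ge0 : 0 <= g z. Proof. exact: drift_ge0 gG _ z_ge0. Qed.

Let gzd : 1 + g (z + delta) <= Cg * (1 + g z).
Proof.
have zd : `|z + delta - z| <= 1 by rewrite (addrC z) addrK ger0_norm ?(ltW delta_gt0).
have := drift_shift c2_gt0 m_ge0 gG zd.
by rewrite !ger0_norm// (drift_ge0 gG)// addr_ge0// ltW.
Qed.

Let theta_ge0 x : 0 <= theta x.
Proof. by rewrite /theta; nn. Qed.

(** For [x <= A] everything is of constant size. Further on, the slope of
    [expR H] is at most [theta x * g x * expR (H x)], and [theta x] is about [rho]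
    up to [z + delta] and about [lam] afterwards. *)
Lemma tail_slope (x lo hi : R) : lo <= x <= hi -> hi - lo <= delta ->
  delta * `|g x| <= d1 ->
  (expR (H hi) - 1) - (expR (H lo) - 1) <= u x * (hi - lo).
Proof.
move=> /andP[lox xhi] hilo dx.
have lohi := le_trans lox xhi.
have -> : (expR (H hi) - 1) - (expR (H lo) - 1) = expR (H hi) - expR (H lo) by ring.
apply: le_trans (expR_sub_le _ _) _.
have t0 : 0 <= hi - lo by rewrite subr_ge0.
have rest0 : 0 <= theta x * (Num.max (g x) 0 * expR (H x)).
  by nn.
have Hle := tail_exponent_le gG lam_ge0 lam_rho z_ge0 zL.
have Hge := tail_exponent_homo gG lam_ge0 lam_rho z_ge0 zL.
have H0 := tail_exponent0 rho lam L gG z_ge0.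
have [xA|Ax] := leP x A.
  have hiA : hi <= A + 1 by have := delta_le1; lra.
  have gB : Num.max (g hi) 0 <= B.
    rewrite ge_max B_ge0 andbT.
    have [hi0|/ltW hi0] := leP hi 0; first by rewrite (le_trans (drift_le0 gG hi0)).
    have := g_upper (y := hi); rewrite (ger0_norm hi0) => /(_ hiA).
    by rewrite ger0_norm ?(drift_ge0 gG)//; lra.
  have HB : H hi <= B * (A + 1).
    have [hi0|/ltW hi0] := leP hi 0; first by rewrite /H H0// mulr_ge0.
    have := Hle _ _ hi0; rewrite (H0 0 (lexx 0)) !subr0 => /le_trans; apply.
    apply: ler_pM => //; first by rewrite mulr_ge0// le_max lexx orbT.
    by rewrite (le_trans _ gB)// ler_piMl// le_max lexx orbT.
  apply: (@le_trans _ _ (C1 * (hi - lo))); last by rewrite ler_wpM2r// lerDl.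
  rewrite /C1 mulrAC mulrC; apply: ler_pM; rewrite ?expR_ge0 ?Hge ?ler_expR//.
  apply: le_trans (Hle _ _ lohi) _; rewrite ler_wpM2r//.
  by rewrite (le_trans _ gB)// ler_piMl// le_max lexx orbT.
have x0 : 0 <= x by rewrite (le_trans (le_trans ler01 A_ge1))// ltW.
have gx0 := drift_ge0 gG x0.
have hi0 := le_trans x0 xhi; have ghi0 := drift_ge0 gG hi0.
rewrite (ger0_norm gx0) in dx.
have hix : hi - x <= delta by lra.
have hiM : Num.max (g hi) 0 = g hi by apply/max_idPl.
have xM : Num.max (g x) 0 = g x by apply/max_idPl.
(* the exponent moves by at most delta * g hi from x to hi *)
have Hx : expR (H hi) <= expR (delta * g hi) * expR (H x).
  rewrite -expRD ler_expR -lerBlDr; apply: le_trans (Hle _ _ xhi) _.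
  by rewrite hiM mulrC ler_pM ?mulr_ge0 ?subr_ge0// ler_piMl.
have nr := near_ratio delta_gt0 delta_le1 (ltW Ax) dx xhi hix.
suff [th [thle th0 Hth]] : exists th, [/\ th * (1 + tail_K * (delta * (1 + g x))) ^+ 2 <= theta x,
    0 <= th & H hi - H lo <= th * g hi * (hi - lo)].
  apply: (@le_trans _ _ (theta x * (g x * expR (H x)) * (hi - lo))); last first.
    by rewrite /u xM ler_wpM2r// lerDr /C1; nn.
  apply: (@le_trans _ _ (expR (delta * g hi) * expR (H x) * (th * g hi * (hi - lo)))).
    by apply: ler_pM; rewrite ?expR_ge0 ?Hge.
  have -> : expR (delta * g hi) * expR (H x) * (th * g hi * (hi - lo)) =
    th * (g hi * expR (delta * g hi)) * (expR (H x) * (hi - lo)) by ring.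
  rewrite -[leRHS]mulrA -[X in _ <= _ * X]mulrA [X in _ <= X]mulrA.
  rewrite ler_wpM2r ?mulr_ge0 ?expR_ge0//.
  apply: le_trans (ler_wpM2l th0 nr) _; rewrite [leLHS]mulrA.
  by rewrite ler_wpM2r.
have w0 : 0 <= tail_K * (delta * (1 + g x)) by nn.
rewrite /theta; have [xz|zx] := leP x (z + delta).
  exists rho; rewrite mulr1 mulr0 addr0; split=> //; last first.
    by have := Hle _ _ lohi; rewrite hiM.
  rewrite ler_wpM2l// ler_sqr ?nnegrE ?addr_ge0// ?lerD2l /a1; last first.
    by nn.
  rewrite ler_wpM2l// mulrCA ler_wpM2l ?(ltW delta_gt0)//.
  apply: (@le_trans _ _ (1 + g (z + delta))).
    by rewrite lerD2l (drift_homo gG).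
  exact: gzd.
exists lam; rewrite mulr1 mulr0 add0r; split=> //; last first.
  by apply: tail_exponent_le_far => //; lra.
rewrite ler_wpM2l// ler_sqr ?nnegrE ?addr_ge0// ?lerD2l; last first.
  by rewrite mulr_ge0// addr_ge0// ltW.
by rewrite ler_wpM2l// mulrDr mulr1 lerD.
Qed.

Context d (Omega : measurableType d) (P : probability Omega R).
Variables (delta1 : R) (X k : Omega -> R).
Hypothesis cc : core_coupling P g delta delta1 X k.
Let b := delta1 * (1 + (Cg * (1 + g z)) `^ tau).
Hypotheses (delta1_gt0 : 0 < delta1)
  (rho_small : (1 + b) * (rho * (1 + a1) ^+ 2) <= 1)
  (lam_small : d0 * (lam * C2) <= 1 / 2).

(** Stein's identity bounds the expectation of [g * (expR H - 1)] by that of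
    [k * u]. The factor [k * theta] is at most one below [z + delta] and at most
    one half beyond, so the term [theta * g * expR H] of [u] is absorbed by the
    left-hand side, of which half of the part beyond [z + delta] survives. *)
Lemma tail_test :
  \int[P]_w (g (X w) * expR (H (X w)) * (z + delta < X w)%R%:R)
  <= 2 * (d0 * C1 + (d0 + m)).
Proof.
pose f x := expR (H x) - 1.
have mg := drift_measurable gG; have mG := primitive_measurable gG.
have mH : measurable_fun setT H.
  rewrite /H /tail_exponent; mfun; apply: mfun_comp => //; apply: mfun_clamp => //;
  exact: measurable_id.
have mu : measurable_fun setT u by rewrite /u /theta; mfun; exact: measurable_id.
have mf : measurable_fun setT f by rewrite /f; mfun.
have H0 x : 0 <= H x.
  have [x0|/ltW x0] := leP x 0; first by rewrite /H (tail_exponent0 _ _ _ gG z_ge0).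
  have := tail_exponent_homo gG lam_ge0 lam_rho z_ge0 zL x0.
  by rewrite (tail_exponent0 rho lam L gG z_ge0 (lexx 0)) subr0.
have HL (x : R) : H x <= H L by apply: (tail_exponent_max gG) => //.
pose e := expR (H L).
have e0 : 0 <= e by exact: expR_ge0.
have eH x : expR (H x) <= e by rewrite ler_expR.
have dd0 : 0 <= d1 / delta by rewrite divr_ge0 ?ltW.
pose th := rho * (1 + a1) ^+ 2 + lam * C2.
have th0 : 0 <= th by rewrite /th; nn.
have C10 : 0 <= C1 by rewrite /C1; nn.
have gL0 : 0 <= g L by rewrite (drift_ge0 gG)// (le_trans z_ge0).
have fb x : `|f x| <= e.
  rewrite ger0_norm; last by rewrite subr_ge0 -expR0 ler_expR.
  by rewrite lerBlDr (le_trans (eH x))// lerDl.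
have ub x : delta * `|g x| <= d1 -> `|u x| <= C1 + th * (d1 / delta * e).
  move=> /(core_drift_le delta_gt0) gx.
  have M0 : 0 <= Num.max (g x) 0 by rewrite le_max lexx orbT.
  rewrite ger0_norm; last by rewrite /u; nn.
  rewrite lerD2l.
  apply: ler_pM; rewrite ?mulr_ge0 ?expR_ge0//.
    by rewrite /theta /th; apply: lerD; (apply: ler_piMr; [by nn|by rewrite lern1 leq_b1]).
  apply: ler_pM => //; rewrite ?expR_ge0// ge_max dd0 andbT.
  by rewrite (le_trans _ gx)// ler_norm.
pose M := e * (rho * g L) + e * (d1 / delta) + (C1 + th * (d1 / delta * e)).
have flip x y : x <= y -> `|f x - f y| <= e * (rho * g L) * `|x - y|.
  move=> xy; have hh := tail_exponent_homo gG lam_ge0 lam_rho z_ge0 zL xy.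
  rewrite distrC (distrC x) !ger0_norm ?subr_ge0//; last first.
    by rewrite lerD2r ler_expR -subr_ge0.
  have -> : f y - f x = expR (H y) - expR (H x) by rewrite /f; ring.
  apply: le_trans (expR_sub_le _ _) _; rewrite -mulrA.
  apply: ler_pM; rewrite ?expR_ge0//.
  exact: tail_exponent_lip.
have n1 : 0 <= e * (rho * g L) by rewrite !mulr_ge0.
have n2 : 0 <= e * (d1 / delta) by apply: mulr_ge0.
have n3 : 0 <= C1 + th * (d1 / delta * e) by apply: addr_ge0 => //; apply: mulr_ge0 => //; apply: mulr_ge0.
have stein : \int[P]_w (f (X w) * g (X w)) <= \int[P]_w (k w * u (X w)).
  apply: (core_stein cc (M := M)) => //.
  - move=> x y; apply: (@le_trans _ _ (e * (rho * g L) * `|x - y|)).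
      have [xy|/ltW yx] := leP x y; first exact: flip.
      by rewrite distrC (distrC x) flip.
    by rewrite ler_wpM2r// /M; lra.
  - move=> x dx; split; last by apply: le_trans (ub x dx) _; rewrite /M; lra.
    apply: (@le_trans _ _ (e * (d1 / delta))); last by rewrite /M; lra.
    by rewrite normrM; apply: ler_pM => //; exact: core_drift_le dx.
  - move=> x y dx xy; rewrite expr2 mulrA.
    have [le|/ltW le] := leP x y.
      rewrite ler_wpM2r ?subr_ge0//; apply: tail_slope => //; first by rewrite lexx.
      by rewrite -(ger0_norm (_ : 0 <= y - x)) ?subr_ge0.
    have -> : (f y - f x) * (y - x) = (f x - f y) * (x - y) by ring.
    have -> : u x * (y - x) * (y - x) = u x * (x - y) * (x - y) by ring.
    rewrite ler_wpM2r ?subr_ge0//; apply: tail_slope => //; first by rewrite lexx le.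
    by rewrite -(ger0_norm (_ : 0 <= x - y)) ?subr_ge0// distrC.
have bk := core_bounded_k cc.
have bdd (phi : R -> R) (N : R) : measurable_fun setT phi ->
  (forall x, delta * `|g x| <= d1 -> `|phi x| <= N) ->
  bounded_rv (fun w => phi (X w)) by exact: core_bounded cc _ _.
have bg : bounded_rv (fun w => g (X w)) by apply: bdd => // x; exact: core_drift_le.
have bf : bounded_rv (fun w => f (X w)) by apply: bdd => // x _; exact: fb.
have bu : bounded_rv (fun w => u (X w)) by apply: bdd mu ub.
have be : bounded_rv (fun w => expR (H (X w))).
  apply: (bdd (fun x => expR (H x)) e); first by mfun.
  by move=> x _; rewrite ger0_norm ?expR_ge0.
have mX := core_measurable cc.
have main : \int[P]_w (1 / 2 * (g (X w) * expR (H (X w)) * (z + delta < X w)%R%:R))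
   <= \int[P]_w (f (X w) * g (X w) + (- 1) * (k w * u (X w)) + (d0 * C1 + `|g (X w)|)).
  apply: expect_le; [by brv..|] => w; set x := X w.
  have /andP[k0 kd] := core_k cc w; set kw := k w in k0 kd *.
  have kC : kw * C1 <= d0 * C1 by rewrite ler_wpM2r.
  have ng := ler_norm (g x); have ng0 := normr_ge0 (g x).
  have E0 := expR_gt0 (H x).
  rewrite /u mulrDr.
  have [x0|x0] := leP x 0.
    have gx0 := drift_le0 gG x0.
    have -> : (z + delta < x) = false.
      by apply/negbTE; rewrite -leNgt (le_trans x0)// addr_ge0// ltW.
    have -> : Num.max (g x) 0 = 0 by apply/max_idPr.
    have -> : f x = 0 by rewrite /f /H (tail_exponent0 _ _ _ gG z_ge0)// expR0 subrr.
    by rewrite mul0r !mulr0; lra.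
  have gx0 := drift_ge0 gG (ltW x0).
  have -> : Num.max (g x) 0 = g x by apply/max_idPl.
  have gE : 0 <= g x * expR (H x) by rewrite mulr_ge0// ltW.
  rewrite (ger0_norm gx0) in ng *.
  have -> : f x * g x = g x * expR (H x) - g x by rewrite /f; ring.
  suff : kw * theta x * (g x * expR (H x)) <=
     g x * expR (H x) - 1 / 2 * (g x * expR (H x) * (z + delta < x)%R%:R).
    rewrite -mulrA => h; lra.
  rewrite /theta; have [xz|zx] := leP x (z + delta).
    rewrite !mulr0 !mulr1 addr0 subr0 ler_piMl//.
    apply: le_trans rho_small; apply: ler_wpM2r; first by nn.
    have := core_k1 cc w; rewrite -/kw -/x => /(le_trans (ler_norm _)) kk.
    have : delta1 * (`|g x| `^ tau + 1) <= b.
      rewrite /b ler_wpM2l ?(ltW delta1_gt0)// addrC lerD2l.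
      apply: ge0_ler_powR => //; rewrite ?nnegrE// ?(ltW tau_gt0)//.
        by nn.
      rewrite (ger0_norm gx0); apply: (@le_trans _ _ (1 + g (z + delta))).
        by rewrite -[leLHS]add0r lerD// (drift_homo gG).
      exact: gzd.
    lra.
  rewrite mulr0 !mulr1 add0r.
  have kl : kw * (lam * C2) <= 1 / 2.
    by apply: le_trans lam_small; apply: ler_wpM2r => //; rewrite /C2; nn.
  have := ler_wpM2r gE kl; lra.
move: main; rewrite expectZ; last by brv.
rewrite expectD; [|by brv..]; rewrite expectD; [|by brv..].
rewrite expectZ; last by brv.
rewrite expectD; [|by brv..]; rewrite expect_cst.
have := expect_norm_drift gG delta_gt0 cc; lra.
Qed.

End TestFunction.

End Tail.

(** * Auxiliary integrals and powers *)

Section Integrals.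
Variable R : realType.
Notation mu := (@lebesgue_measure R).

Lemma continuous_mul (f g : R -> R) : continuous f -> continuous g ->
  continuous (fun x => f x * g x).
Proof. by move=> cf cg x; exact: (continuousM (cf x) (cg x)). Qed.

Lemma ftc2 (f F : R -> R) (a b : R) : a <= b -> continuous f ->
  (forall x : R, is_derive x 1 F (f x)) ->
  (\int[mu]_(x in `[a, b]) (f x)%:E = (F b - F a)%:E)%E.
Proof.
move=> ab cf dF; have cF := is_derive_continuous dF.
move: ab; rewrite le_eqVlt => /predU1P[<-|ab].
  by rewrite set_itv1 integral_set1 subrr.
rewrite EFinB; apply: continuous_FTC2 => //.
- exact: continuous_subspaceT.
- split; first by move=> x _; exact: ex_derive.
  + by apply: cvg_at_right_filter; exact: cF.
  + by apply: cvg_at_left_filter; exact: cF.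
- by move=> x _; rewrite derive1E; exact: derive_val.
Qed.

Lemma prob_tail_small d (Omega : measurableType d) (P : probability Omega R)
    (X : Omega -> R) (L0 e : R) : measurable_fun setT X -> 0 < e ->
  exists2 L, L0 <= L & fine (P [set w | L < X w]) <= e.
Proof.
move=> mX e0.
pose X' : {RV P >-> R} := HB.pack X (isMeasurableFun.Build _ _ _ _ X mX).
have /fine_cvgP[_ cv] := cvg_ccdfy0 X'.
have /cvgrPdist_le /(_ e e0) h := cv.
near (pinfty_nbhs R) => L; exists L; first by near: L; apply: nbhs_pinfty_ge; exact: num_real.
have : `|0 - fine (ccdf X' L)| <= e by near: L.
rewrite sub0r normrN => /(le_trans (ler_norm _)).
rewrite /ccdf /distribution /pushforward /=.
suff -> : [set w | L < X w] = X @^-1` `]L, +oo[ by [].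
by apply/seteqP; split => w /=; rewrite in_itv/= andbT.
Unshelve. all: end_near. Qed.

Lemma powR_le (r x y : R) : 0 <= r -> 0 <= x -> x <= y -> x `^ r <= y `^ r.
Proof.
move=> r0 x0 xy; apply: (ge0_ler_powR r0) => //; rewrite nnegrE//.
exact: le_trans xy.
Qed.

Lemma powR_add1 (x s : R) : 0 <= x -> 0 <= s -> x `^ (s + 1) = x * x `^ s.
Proof.
move=> x0 s0; rewrite powRD ?powRr1// 1?mulrC//.
by apply/implyP => /eqP h; exfalso; lra.
Qed.

Lemma powR_ge1 (x s : R) : 1 <= x -> 0 <= s -> 1 <= x `^ s.
Proof. by move=> x1 s0; rewrite -[leLHS](powRr0 x) ler_powR. Qed.

End Integrals.

(** * Exponential moments below a level *)

Section ExponentialMoment.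
Variables (R : realType) (c1 c2 c3 m : R) (g G : R -> R).
Hypothesis gG : drift c1 c2 c3 m g G.
Context d (Omega : measurableType d) (P : probability Omega R).
Variable X : Omega -> R.
Hypothesis mX : measurable_fun setT X.
Notation mu := (@lebesgue_measure R).

(** Write [expR (G x)] as [1] plus the integral of [g * expR G] over [0, x] and
    exchange the integrals. *)
Lemma expect_exp_primitive (z C : R) : 0 <= z -> 0 <= C ->
  (forall u, 0 <= u -> u <= z ->
     g u * expR (G u) * fine (P [set w | u < X w]) <= C) ->
  \int[P]_w (expR (G (X w)) * (0 < X w)%R%:R * (X w <= z)%R%:R) <= 1 + C * z.
Proof.
move=> z0 C0 hC.
have mg := drift_measurable gG; have mG := primitive_measurable gG.
pose psi u := Num.max (g u) 0 * expR (G u) * (0 <= u)%R%:R * (u <= z)%R%:R.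
have psi0 u : 0 <= psi u by rewrite /psi; nn.
have mpsi : measurable_fun setT psi by rewrite /psi; mfun; exact: measurable_id.
pose F (p : Omega * R) := (psi p.2 * (p.2 < X p.1)%R%:R)%:E.
have F0 p : (0 <= F p)%E by rewrite lee_fin; nn.
have mX1 : measurable_fun setT (fun p : Omega * R => X p.1).
  exact: measurableT_comp mX measurable_fst.
have mF : measurable_fun setT F.
  apply/measurable_EFinP; apply: mfunM'.
    exact: measurableT_comp mpsi measurable_snd.
  by apply: mfun_lt => //; exact: measurable_snd.
have mFw w : measurable_fun setT (fun u => F (w, u)).
  by apply: measurableT_comp mF _; exact: measurable_pair1.
pose Z w := expR (G (X w)) * (0 < X w)%R%:R * (X w <= z)%R%:R.
have Z0 w : 0 <= Z w by rewrite /Z; nn.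
have mZ : measurable_fun setT Z.
  by rewrite /Z; mfun; apply: mfun_comp.
have step1 w : ((Z w)%:E <= 1 + \int[mu]_u F (w, u))%E.
  have i0 : (0 <= \int[mu]_u F (w, u))%E by apply: integral_ge0.
  rewrite /Z; set x := X w.
  have [x0|x0] := ltP 0 x; last first.
    by rewrite mulr0 mul0r adde_ge0.
  have [xz|xz] := leP x z; last by rewrite mulr0 adde_ge0.
  rewrite !mulr1.
  have -> : (\int[mu]_u F (w, u) = (expR (G x) - expR (G 0))%:E)%E.
    have dE (y : R) : is_derive y 1 (fun y => expR (G y)) (expR (G y) * g y).
      exact/is_derive_exp/(drift_primitive gG).
    have cE : continuous (fun y => expR (G y) * g y).
      apply: continuous_mul; last exact: drift_continuous gG.
      exact: is_derive_continuous dE.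
    rewrite -(ftc2 (ltW x0) cE dE) -integral_itv_bndo_bndc; last first.
      apply/measurable_EFinP; apply: measurable_funTS.
      exact: continuous_measurable_fun.
    rewrite [RHS]integral_mkcond; apply: eq_integral => u _.
    rewrite patchE /F /psi /= -/x; case: ifPn.
      rewrite inE /= in_itv/= => /andP[u0 ux].
      rewrite u0 ux (le_trans (ltW ux) xz) !mulr1; congr EFin.
      by rewrite (max_idPl (drift_ge0 gG u0)) mulrC.
    rewrite notin_setE /= in_itv/= => /negP.
    by rewrite negb_and => /orP[/negbTE ->|/negbTE ->]; rewrite ?(mulr0, mul0r).
  by rewrite (drift_primitive0 gG) expR0 -EFinD lee_fin; lra.
have step3 u : (\int[P]_w F (w, u) <= (C * \1_(`[0, z]%classic : set R) u)%:E)%E.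
  have -> : (\int[P]_w F (w, u) =
      (psi u)%:E * \int[P]_w ((u < X w)%R%:R)%:E)%E.
    rewrite -ge0_integralZl_EFin//.
    by apply/measurable_EFinP; mfun.
  have -> : (\int[P]_w ((u < X w)%R%:R)%:E = (fine (P [set w | u < X w]))%:E)%E.
    rewrite -expect_lt// fineK//; apply: integrable_fin_num => //.
    by apply: bounded_rv_integrable; brv.
  rewrite -EFinM lee_fin indicE; case: (boolP (u \in _)).
    rewrite inE /= in_itv/= => /andP[u0 uz].
    rewrite /psi u0 uz !mulr1 (max_idPl (drift_ge0 gG u0)).
    exact: hC.
  rewrite notin_setE /= in_itv/= => /negP; rewrite negb_and mulr0.
  by move=> /orP[/negbTE|/negbTE] uz; rewrite /psi uz ?(mulr0, mul0r).
have bound : (\int[P]_w (Z w)%:E <= (1 + C * z)%:E)%E.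
  apply: (@le_trans _ _ (\int[P]_w (1 + \int[mu]_u F (w, u)))%E).
    apply: ge0_le_integral => //.
    + by move=> w _; rewrite lee_fin.
    + exact/measurable_EFinP.
    + apply: emeasurable_funD; first exact: measurable_cst.
      exact: measurable_fun_fubini_tonelli_F.
  rewrite ge0_integralD//; last 2 first.
  - by move=> w _; apply: integral_ge0.
  - exact: measurable_fun_fubini_tonelli_F.
  rewrite integral_cst// mul1e EFinD; apply: leeD.
    by rewrite (probability_le1 P measurableT).
  rewrite fubini_tonelli//.
  apply: (@le_trans _ _ (\int[mu]_u (C * \1_(`[0, z]%classic : set R) u)%:E)%E).
    apply: ge0_le_integral => //.
    + by move=> u _; apply: integral_ge0.
    + exact: measurable_fun_fubini_tonelli_G.
    + apply/measurable_EFinP; apply: mfunM'; first exact: mfun_cst.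
      exact: measurable_indic.
  under eq_integral do rewrite EFinM.
  rewrite ge0_integralZl_EFin//; last first.
    by apply/measurable_EFinP; exact: measurable_indic.
  rewrite integral_indic//= setIT lebesgue_measure_itv/= lte_fin.
  case: ifPn => _; rewrite ?mule0 -?EFinD -?EFinM ?lee_fin ?subr0//.
  by rewrite mulr_ge0.
have bZ : bounded_rv Z.
  split=> //; exists (expR (G z)) => w; rewrite ger0_norm// /Z.
  have [x0|x0] := ltP 0 (X w); last by rewrite mulr0 mul0r expR_ge0.
  have [xz|xz] := leP (X w) z; last by rewrite mulr0 expR_ge0.
  by rewrite !mulr1 ler_expR (primitive_homo gG)// ltW.
rewrite -lee_fin /Rintegral fineK//.
by apply: integrable_fin_num => //; exact: bounded_rv_integrable.
Qed.

End ExponentialMoment.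

(** * Exponential moments beyond a level *)

Section TailMoments.
Variables (R : realType) (c1 c2 c3 m d0 d1 tau : R).
Hypotheses (c1_gt0 : 0 < c1) (c2_gt0 : 0 < c2) (c3_ge1 : 1 <= c3)
  (m_ge0 : 0 <= m) (d0_ge1 : 1 <= d0) (d1_gt0 : 0 < d1) (tau_gt0 : 0 < tau).

Notation drift := (drift c1 c2 c3 m).
Notation core_coupling := (core_coupling d0 d1 tau).

Let Cg := 1 + c2 * (m + 1).
Let Cg_ge1 : 1 <= Cg.
Proof. by rewrite lerDl mulr_ge0 ?addr_ge0// ltW. Qed.

(** Smallness of the two steps at level [z] in the form in which it is used: the
    exponent [G z] is at most [z * g z], so relative errors of order
    [delta * (1 + g z)] or [delta1 * (1 + g z) `^ tau] in its coefficient change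
    [expR (G z)] by a bounded factor only. *)
Definition tame (q : R) (g : R -> R) (delta delta1 z : R) : Prop :=
  delta * (1 + g z) * (1 + z * g z) <= q /\
  delta1 * (1 + (Cg * (1 + g z)) `^ tau) * (1 + z * g z) <= q.

Lemma tame_le q g G (delta delta1 y z : R) : drift g G -> 0 < delta -> 0 < delta1 ->
  0 <= y -> y <= z -> tame q g delta delta1 z -> tame q g delta delta1 y.
Proof.
move=> gG del0 del10 y0 yz [h1 h2].
have gy0 := drift_ge0 gG y0; have gyz := drift_homo gG yz.
have z0 := le_trans y0 yz.
have yg : y * g y <= z * g z by apply: ler_pM.
split.
  apply: le_trans h1; apply: ler_pM; [by nn|by nn| |by rewrite lerD2l].
  by rewrite ler_wpM2l ?(ltW del0)// lerD2l.
apply: le_trans h2; apply: ler_pM; [by nn|by nn| |by rewrite lerD2l].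
rewrite ler_wpM2l ?(ltW del10)// lerD2l; apply: powR_le; [exact: ltW|by nn|].
by rewrite ler_wpM2l ?lerD2l// (le_trans ler01).
Qed.

(** The conclusion is at [z + 1] to leave room for the levels [z + delta] and
    [z - delta]. Below [A] all quantities are bounded; above, [1 + g (z + 1)] and
    [1 + (z + 1) * g (z + 1)] are at most multiples of [g z] and [z * g z]. *)
Lemma tame_small : exists2 q : R, 0 < q & forall g G (delta delta1 z : R), drift g G ->
  0 < delta -> delta <= 1 -> 0 < delta1 -> delta1 <= 1 -> 0 <= z ->
  delta * (z * g z ^+ 2) + delta1 * (z * g z `^ (tau + 1)) <= 1 ->
  tame q g delta delta1 (z + 1).
Proof.
have [A [a [A1 a0 low]]] := drift_lower c2 c3 m c1_gt0.
have [B B0 up] := drift_bounded c1 c3 c2_gt0 m_ge0 (A + 1).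
have A0 : 0 <= A + 1 by rewrite addr_ge0// (le_trans ler01).
have Cg0 : 0 <= Cg by rewrite (le_trans ler01).
pose E := Cg * (1 / a + 1).
have E0 : 0 <= E by rewrite /E; nn.
have D0 : 0 <= 1 / a + 2 * E by nn.
pose q1 := B * (1 + (A + 1) * B).
pose q2 := (1 + (Cg * B) `^ tau) * (1 + (A + 1) * B).
pose q3 := E * (1 / a + 2 * E).
pose q4 := ((1 / a) `^ tau + (Cg * E) `^ tau) * (1 / a + 2 * E).
have q10 : 0 <= q1 by rewrite /q1; nn.
have q20 : 0 <= q2 by rewrite /q2; nn.
have q30 : 0 <= q3 by rewrite /q3; nn.
have q40 : 0 <= q4 by rewrite /q4; nn.
exists (1 + q1 + q2 + q3 + q4); first by lra.
move=> g G delta delta1 z gG del0 del1 del10 del11 z0 sm.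
have gz0 := drift_ge0 gG z0.
have z10 : 0 <= z + 1 by rewrite addr_ge0.
have gy0 := drift_ge0 gG z10; set y := z + 1; set gy := g y.
have [zA|/ltW Az] := leP z A.
  have yA : y <= A + 1 by rewrite lerD2r.
  have := up _ _ gG y; rewrite !ger0_norm// => /(_ yA) gB.
  have gB' : gy <= B by rewrite (le_trans _ gB)// lerDr.
  have yB : 1 + y * gy <= 1 + (A + 1) * B by rewrite lerD2l; apply: ler_pM.
  split.
    apply: (@le_trans _ _ q1); last by lra.
    apply: ler_pM; [by rewrite /gy; nn|by rewrite /gy; nn| |exact: yB].
    by rewrite -[leRHS]mul1r; apply: ler_pM => //; rewrite /gy; nn.
  apply: (@le_trans _ _ q2); last by lra.
  apply: ler_pM; [by rewrite /gy; nn|by rewrite /gy; nn| |exact: yB].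
  rewrite -[leRHS]mul1r; apply: ler_pM; [exact: ltW|by nn|by []|].
  rewrite lerD2l; apply: powR_le; [exact: ltW|by rewrite /gy; nn|].
  by rewrite ler_wpM2l.
have gza := low _ _ gG _ Az; have gzp : 0 < g z by exact: lt_le_trans gza.
have one : 1 <= 1 / a * g z by rewrite mul1r mulrC ler_pdivlMr// mul1r.
have gE : 1 + gy <= E * g z.
  have yz1 : `|y - z| <= 1 by rewrite /y (addrC z) addrK normr1.
  have := drift_shift c2_gt0 m_ge0 gG yz1.
  rewrite (ger0_norm gz0) (ger0_norm gy0) -/Cg => /le_trans; apply.
  rewrite /E -/Cg -mulrA ler_wpM2l// mulrDl mul1r; lra.
have z1 : 1 <= z by exact: le_trans Az.
have yg : 1 + y * gy <= (1 / a + 2 * E) * (z * g z).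
  have h1 : 1 <= 1 / a * (z * g z).
    by rewrite (le_trans one)// ler_wpM2l ?ler_peMl//; nn.
  have h2 : y * gy <= 2 * z * (E * g z).
    by apply: ler_pM => //; [rewrite /y; lra|lra].
  lra.
have zg0 : 0 <= z * g z by nn.
have s10 : 0 <= delta * (z * g z ^+ 2) by nn.
have s20 : 0 <= delta1 * (z * g z `^ (tau + 1)) by nn.
split.
  apply: (@le_trans _ _ (delta * (E * g z) * ((1 / a + 2 * E) * (z * g z)))).
    apply: ler_pM; [by rewrite /gy; nn|by rewrite /gy; nn| |exact: yg].
    by rewrite ler_wpM2l// ltW.
  have -> : delta * (E * g z) * ((1 / a + 2 * E) * (z * g z)) =
     q3 * (delta * (z * g z ^+ 2)) by rewrite /q3; ring.
  apply: (@le_trans _ _ q3); last by lra.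
  by rewrite ler_piMr//; lra.
have pw : 1 + (Cg * (1 + gy)) `^ tau <=
    ((1 / a) `^ tau + (Cg * E) `^ tau) * g z `^ tau.
  have ia0 : 0 <= 1 / a by nn.
  have CE0 : 0 <= Cg * E by nn.
  rewrite [leRHS]mulrDl -(powRM _ ia0 gz0) -(powRM _ CE0 gz0); apply: lerD.
    by apply: powR_ge1 => //; exact: ltW.
  apply: powR_le; [exact: ltW|by rewrite /gy; nn|].
  by rewrite -mulrA ler_wpM2l.
apply: (@le_trans _ _ (delta1 * (((1 / a) `^ tau + (Cg * E) `^ tau) * g z `^ tau) * ((1 / a + 2 * E) * (z * g z)))).
  apply: ler_pM; [by nn|by rewrite /gy; nn| |exact: yg].
  by rewrite ler_wpM2l// ltW.
have -> : delta1 * (((1 / a) `^ tau + (Cg * E) `^ tau) * g z `^ tau) * ((1 / a + 2 * E) * (z * g z)) =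
   q4 * (delta1 * (z * (g z * g z `^ tau))) by rewrite /q4; ring.
rewrite -powR_add1//; last exact: ltW.
apply: (@le_trans _ _ q4); last by lra.
by rewrite ler_piMr//; lra.
Qed.

(** This is [tail_test] with [rho = 1 / r] and [r = (1 + b) * (1 + a1) ^+ 2], the
    largest [rho] that [rho_small] allows. By tameness [(1 - 1 / r) * G z] is
    bounded, so replacing [rho] by one costs a constant. *)
Lemma tail_exponential (q : R) : 0 < q -> exists lam C : R, [/\ 0 < lam, 0 < C &
  forall g G d (Omega : measurableType d) (P : probability Omega R)
    (delta delta1 : R) (X k : Omega -> R) (z L : R), drift g G ->
  0 < delta -> delta <= 1 -> 0 < delta1 -> 0 <= z -> z <= L ->
  tame q g delta delta1 z -> core_coupling P g delta delta1 X k ->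
  \int[P]_w (g (X w) * expR (lam * (G (clamp z L (X w)) - G z)) *
     (z + delta < X w)%R%:R) <= C * expR (- G z)].
Proof.
move=> q0.
have [A [a [A1 a0 low]]] := drift_lower c2 c3 m c1_gt0.
have [B B0 up] := drift_bounded c1 c3 c2_gt0 m_ge0 (A + 1).
pose K := tail_K c2 c3 m d1 a.
have Cg0 : 0 <= Cg by rewrite (le_trans ler01).
have K0 : 0 <= K.
  by rewrite /K /tail_K -/Cg; nn.
pose C2 := (1 + K * (1 + d1)) ^+ 2.
have C20 : 0 < C2 by rewrite exprn_gt0// ltr_pwDl// mulr_ge0// addr_ge0// ltW.
pose D := (1 + q) * (1 + K * (Cg * q)) ^+ 2.
have D0 : 0 < D.
  by rewrite /D mulr_gt0 ?addr_gt0// exprn_gt0// ltr_wpDr//; nn.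
have d00 : 0 < d0 by exact: lt_le_trans d0_ge1.
(* the first bound gives lam <= rho, the second one half of the left-hand side *)
pose lam := Num.min D^-1 (1 / 2 / (d0 * C2)).
have lam0 : 0 < lam by rewrite /lam lt_min invr_gt0 D0 !divr_gt0// mulr_gt0.
pose C1 := 2 * (d0 * (B * expR (B * (A + 1))) + (d0 + m)).
pose S := q * (1 + K * (Cg * q)) ^+ 2 + K * Cg * q * (2 + K * (Cg * q)).
exists lam, (C1 * expR S); split => //.
  apply: mulr_gt0; rewrite ?expR_gt0// /C1 mulr_gt0// ltr_wpDl//; first by nn.
  by rewrite ltr_wpDr.
move=> g G d Omega P delta delta1 X k z L gG del0 del1 del10 z0 zL [t1 t2] cc.
have gz0 := drift_ge0 gG z0.
have zg0 : 0 <= z * g z by nn.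
pose a1 := K * (Cg * (delta * (1 + g z))).
pose b := delta1 * (1 + (Cg * (1 + g z)) `^ tau).
have w0 : 0 <= delta * (1 + g z) by nn.
have b0 : 0 <= b by rewrite /b; nn.
have a10 : 0 <= a1 by rewrite /a1; nn.
have wq : delta * (1 + g z) <= q by apply: le_trans t1; rewrite ler_peMr// lerDl.
have bq : b <= q by apply: le_trans t2; rewrite ler_peMr// lerDl.
have a1q : a1 <= K * (Cg * q) by rewrite /a1 !ler_wpM2l.
pose r := (1 + b) * (1 + a1) ^+ 2.
have r1 : 1 <= r.
  rewrite /r -[leLHS]mulr1; apply: ler_pM => //; first by rewrite lerDl.
  by rewrite -[leLHS](expr1n _ 2) lerXn2r ?nnegrE ?addr_ge0// lerDl.
have r0 : 0 < r by exact: lt_le_trans r1.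
have rD : r <= D.
  apply: ler_pM; [by nn|by nn|by rewrite lerD2l|].
  by rewrite lerXn2r ?nnegrE ?addr_ge0 ?lerD2l//; nn.
have lamr : lam <= r^-1.
  by rewrite /lam ge_min lef_pV2 ?posrE// rD.
have ri1 : r^-1 <= 1 by rewrite invf_le1.
have := @tail_test R c1 c2 c3 m d0 d1 tau c2_gt0 c3_ge1 m_ge0 d1_gt0 tau_gt0
  A a B A1 a0 g G gG (low _ _ gG) (up _ _ gG) delta r^-1 lam z L del0 del1
  (ltW lam0) lamr ri1 z0 zL d Omega P delta1 X k cc del10.
rewrite -/K -/Cg -/a1 -/b -/C2.
have h1 : (1 + b) * (r^-1 * (1 + a1) ^+ 2) <= 1.
  by rewrite mulrCA -/r mulVf// gt_eqF.
have h2 : d0 * (lam * C2) <= 1 / 2.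
  rewrite mulrCA -ler_pdivlMr; last exact: mulr_gt0.
  by rewrite /lam ge_min lexx orbT.
move=> /(_ h1 h2) main.
have bE : bounded_rv (fun w => g (X w) * expR (lam * (G (clamp z L (X w)) - G z)) *
     (z + delta < X w)%R%:R).
  have mg := drift_measurable gG; have mG := primitive_measurable gG.
  have mX := core_measurable cc.
  have mcl : measurable_fun setT (fun w => expR (lam * (G (clamp z L (X w)) - G z))).
    by mfun; apply: (mfun_comp mG); apply: mfun_clamp.
  apply: bounded_rvM; last by brv.
  apply: bounded_rvM; first by apply: (core_bounded cc mg) => x; exact: core_drift_le.
  split=> //; exists (expR (lam * G L)) => w.
  rewrite ger0_norm ?expR_ge0// ler_expR ler_wpM2l ?(ltW lam0)//.
  have /andP[c1' c2'] := clamp_itv (X w) zL.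
  have := primitive_homo gG (le_trans z0 c1') c2'.
  have := primitive_ge0 gG z; lra.
have -> : C1 * expR S * expR (- G z) = expR (S - G z) * C1.
  by rewrite (expRD S) -mulrA mulrC.
have E0 : 0 < expR (r^-1 * G z) by exact: expR_gt0.
rewrite -(ler_pM2l E0) -expectZ//.
apply: le_trans (_ : C1 <= _); last first.
  rewrite mulrA -expRD ler_peMl//; first by rewrite /C1; nn.
  rewrite -expR0 ler_expR.
  have G0 := primitive_ge0 gG z; have Gz := primitive_le gG z0.
  have : (1 - r^-1) * G z <= (r - 1) * (z * g z).
    apply: ler_pM => //; [by rewrite subr_ge0| |by rewrite mulrC].
    have -> : 1 - r^-1 = (r - 1) * r^-1 by rewrite mulrBl mulfV ?gt_eqF// mul1r.
    by rewrite ler_piMr// subr_ge0.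
  suff : (r - 1) * (z * g z) <= S by lra.
  have -> : (r - 1) * (z * g z) = (b * (z * g z)) * (1 + a1) ^+ 2
     + K * Cg * (delta * (1 + g z) * (z * g z)) * (2 + a1) by rewrite /r /a1; ring.
  have u1 : b * (z * g z) <= q.
    by apply: le_trans t2; rewrite ler_wpM2l// lerDr.
  have u2 : delta * (1 + g z) * (z * g z) <= q.
    by apply: le_trans t1; rewrite ler_wpM2l// lerDr.
  apply: lerD; apply: ler_pM.
  - by nn.
  - by nn.
  - exact: u1.
  - by rewrite lerXn2r ?nnegrE ?addr_ge0 ?lerD2l//; nn.
  - by nn.
  - by nn.
  - by rewrite ler_wpM2l//; nn.
  - by rewrite lerD2l.
apply: le_trans main.
rewrite le_eqVlt; apply/orP; left; apply/eqP; apply: eq_Rintegral => w _.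
have [|zx] := ltP (z + delta) (X w); last by rewrite !mulr0.
move=> zx; rewrite !mulr1 mulrCA -expRD /tail_exponent [clamp 0 z _]clamp_r//.
by apply: ltW; apply: lt_trans zx; rewrite ltrDl.
Qed.

End TailMoments.

(** * Weighted moments *)

Section WeightMoments.
Variables (R : realType) (c1 c2 c3 m d0 d1 tau : R).
Hypotheses (c1_gt0 : 0 < c1) (c2_gt0 : 0 < c2) (c3_ge1 : 1 <= c3)
  (m_ge0 : 0 <= m) (d0_ge1 : 1 <= d0) (d1_gt0 : 0 < d1) (tau_gt0 : 0 < tau).

Notation drift := (drift c1 c2 c3 m).
Notation core_coupling := (core_coupling d0 d1 tau).

Let Cg := 1 + c2 * (m + 1).
Let Cg_ge1 : 1 <= Cg.
Proof. by rewrite lerDl mulr_ge0 ?addr_ge0// ltW. Qed.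

Notation tame := (tame c2 m tau).

Section BoundedFunctions.
Context d (Omega : measurableType d) (P : probability Omega R).
Variables (g G : R -> R) (delta delta1 : R) (X k : Omega -> R).
Hypotheses (gG : drift g G) (delta_gt0 : 0 < delta)
  (cc : core_coupling P g delta delta1 X k).

Lemma weight_le (s : R) w : 0 <= s ->
  (1 + `|g (X w)|) `^ s <= (1 + d1 / delta) `^ s.
Proof.
move=> s0; apply: powR_le; [by []|by nn|].
by rewrite lerD2l; apply: core_drift_le (core_drift cc w).
Qed.

Lemma weight_bounded (s : R) : 0 <= s ->
  bounded_rv (fun w => (1 + `|g (X w)|) `^ s).
Proof.
move=> s0; split.
  have mg := drift_measurable gG; have mX := core_measurable cc.
  by mfun; apply: mfun_comp.
exists ((1 + d1 / delta) `^ s) => w; rewrite ger0_norm ?powR_ge0//.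
exact: weight_le.
Qed.

Lemma exp_clamp_bounded (a b : R) : 0 <= a -> a <= b ->
  bounded_rv (fun w => expR (G (clamp a b (X w)))).
Proof.
move=> a0 ab; split.
  have mG := primitive_measurable gG; have mX := core_measurable cc.
  by mfun; apply: (mfun_comp mG); apply: mfun_clamp.
exists (expR (G b)) => w; rewrite ger0_norm ?expR_ge0// ler_expR.
by have /andP[h1 h2] := clamp_itv (X w) ab; rewrite (primitive_homo gG)// (le_trans a0).
Qed.

End BoundedFunctions.

(** Beyond [A] the power [(1 + g x) `^ s] is at most [(1 + g y) `^ s] times an
    exponential of arbitrarily small rate, while [G x - G y] grows at least
    linearly; so the exponential factor in [tail_exponential] dominates. That
    lemma is used at the level [z - delta], where its indicator becomes that of
    [z < X], and its truncation level [L] is sent to infinity. *)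
Lemma tail_moment (q s : R) : 0 < q -> 0 <= s -> exists2 C : R, 0 < C &
  forall g G d (Omega : measurableType d) (P : probability Omega R)
    (delta delta1 : R) (X k : Omega -> R) (z : R), drift g G ->
  0 < delta -> delta <= 1 -> 0 < delta1 -> 0 <= z ->
  tame q g delta delta1 z -> core_coupling P g delta delta1 X k ->
  \int[P]_w ((1 + `|g (X w)|) `^ (s + 1) * (z < X w)%R%:R)
    <= C * (expR (- G z) * (1 + g z) `^ s).
Proof.
move=> q0 s0.
have [A [a [A1 a0 low]]] := drift_lower c2 c3 m c1_gt0.
have A0 : 0 <= A by exact: le_trans A1.
have [B B0 up] := drift_bounded c1 c3 c2_gt0 m_ge0 (A + 1).
have [lam [C0 [lam0 C00 main]]] := tail_exponential c1_gt0 c2_gt0 c3_ge1 m_ge0 d0_ge1 d1_gt0 tau_gt0 q0.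
have s10 : 0 <= s + 1 by nn.
pose kap := lam * a / (s + 1).
have kap0 : 0 < kap by rewrite /kap divr_gt0 ?mulr_gt0// ltr_wpDl.
have [C3 C30 gr] := drift_growth c1 c2_gt0 c3_ge1 m_ge0 kap0.
pose D := (1 + 1 / a) * C3 `^ s * expR (lam * (a * A)).
have D0 : 0 < D by rewrite /D !mulr_gt0 ?expR_gt0 ?powR_gt0// ltr_wpDr//; nn.
pose U1 := D * C0 * expR q.
pose U2 := (B `^ (s + 1) + D * C0) * expR (B * (A + 1)).
have U10 : 0 < U1.
  by rewrite /U1; apply: mulr_gt0; [exact: mulr_gt0|exact: expR_gt0].
have U20 : 0 <= U2 by rewrite /U2; nn.
exists (U1 + U2); first by lra.
move=> g G d Omega P delta delta1 X k z gG del0 del1 del10 z0 tz cc.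
have mX := core_measurable cc.
have bw := weight_bounded gG del0 cc s10.
have gr0 y : 0 <= y -> 0 <= g y by exact: drift_ge0 gG y.
(* beyond A the weight is dominated by the exponential one *)
have point (y x : R) : 0 <= y -> y <= x -> A <= x ->
    (1 + g x) `^ (s + 1) <=
    D * (1 + g y) `^ s * (g x * expR (lam * (G x - G y))).
  move=> y0 yx Ax; have x0 := le_trans y0 yx.
  have gx0 := gr0 _ x0; have gy0 := gr0 _ y0; have gxa := low _ _ gG _ Ax.
  have Glow : a * (x - y) - a * A <= G x - G y.
    have [yA|/ltW Ay] := leP y A.
      have /andP[h _] := primitive_convex gG Ax.
      have hA := low _ _ gG _ (lexx A).
      have hh := primitive_homo gG y0 yA.
      have : a * (x - A) <= g A * (x - A) by rewrite ler_wpM2r ?subr_ge0.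
      have : 0 <= a * y by nn.
      lra.
    have /andP[h _] := primitive_convex gG yx.
    have hA := low _ _ gG _ Ay.
    have : a * (x - y) <= g y * (x - y) by rewrite ler_wpM2r ?subr_ge0.
    have : 0 <= a * A by nn.
    lra.
  rewrite powR_add1; [|by nn|by []].
  have e1 : 1 + g x <= (1 + 1 / a) * g x.
    rewrite mulrDl mul1r addrC lerD2l mul1r mulrC ler_pdivlMr// mul1r.
    exact: gxa.
  have e2 : (1 + g x) `^ s <= C3 `^ s * (1 + g y) `^ s * expR (kap * (x - y) * s).
    rewrite expRM -!powRM ?expR_ge0 ?mulr_ge0 ?(ltW C30) ?addr_ge0//.
    by apply: powR_le; [by []|by nn|rewrite -mulrA; apply: (gr _ _ gG)].
  have e3 : expR (kap * (x - y) * s) <=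
      expR (lam * (a * A)) * expR (lam * (G x - G y)).
    rewrite -expRD ler_expR -mulrDr.
    apply: (@le_trans _ _ (lam * (a * (x - y)))); last by rewrite ler_wpM2l ?(ltW lam0)//; lra.
    have -> : kap * (x - y) * s = lam * (a * (x - y)) * (s / (s + 1)).
      by rewrite /kap; field; rewrite gt_eqF// ltr_wpDl.
    rewrite ler_piMr//; first by rewrite !mulr_ge0 ?subr_ge0// ltW.
    by rewrite ler_pdivrMr ?ltr_wpDl// mul1r lerDl.
  apply: le_trans (ler_pM _ (powR_ge0 _ _) e1 e2) _; first by nn.
  have -> : D * (1 + g y) `^ s * (g x * expR (lam * (G x - G y))) =
    (1 + 1 / a) * g x * (C3 `^ s * (1 + g y) `^ s *
      (expR (lam * (a * A)) * expR (lam * (G x - G y)))) by rewrite /D; ring.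
  by rewrite !ler_wpM2l//; nn.
have inner (y : R) : 0 <= y -> tame q g delta delta1 y ->
    \int[P]_w ((1 + `|g (X w)|) `^ (s + 1) * (Num.max (y + delta) A < X w)%R%:R)
    <= D * (1 + g y) `^ s * (C0 * expR (- G y)).
  move=> y0 ty; have gy0 := gr0 _ y0.
  apply/ler_addgt0Pr => e e0.
  pose N := (1 + d1 / delta) `^ (s + 1).
  have N0 : 0 < N by rewrite powR_gt0// ltr_wpDr//; nn.
  have eN : 0 < e / N by exact: divr_gt0.
  have [L yL PL] := prob_tail_small P y mX eN.
  have bL : bounded_rv (fun w => (L < X w)%R%:R : R) by brv.
  pose Z w := g (X w) * expR (lam * (G (clamp y L (X w)) - G y)) * (y + delta < X w)%R%:R.
  have bZ : bounded_rv Z.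
    have mg := drift_measurable gG; have mG := primitive_measurable gG.
    apply: bounded_rvM; last by brv.
    apply: bounded_rvM; first by apply: (core_bounded cc mg) => x; exact: core_drift_le.
    split; first by mfun; apply: (mfun_comp mG); apply: mfun_clamp.
    exists (expR (lam * G L)) => w.
    rewrite ger0_norm ?expR_ge0// ler_expR ler_wpM2l ?(ltW lam0)//.
    have /andP[c1' c2'] := clamp_itv (X w) yL.
    have := primitive_homo gG (le_trans y0 c1') c2'.
    have := primitive_ge0 gG y; lra.
  apply: (@le_trans _ _ (\int[P]_w (D * (1 + g y) `^ s * Z w + N * (L < X w)%R%:R))).
    apply: expect_le; [by brv|by brv|] => w; set x := X w.
    have DZ : 0 <= D * (1 + g y) `^ s by nn.
    have NL : 0 <= N * (L < x)%R%:R by nn.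
    have [xm|mx] := leP x (Num.max (y + delta) A).
      rewrite mulr0 addr_ge0// mulr_ge0// /Z -/x.
      have [xy|yx] := leP x (y + delta); first by rewrite mulr0.
      by rewrite mulr1 mulr_ge0 ?expR_ge0// gr0//; lra.
    move: mx; rewrite gt_max => /andP[yx Ax].
    have yx' : y <= x by lra.
    have x0 := le_trans y0 yx'.
    rewrite mulr1 /Z -/x yx mulr1.
    have [xL|Lx] := leP x L.
      rewrite mulr0 addr0 clamp_id ?yx'// (ger0_norm (gr0 _ x0)).
      by apply: point => //; exact: ltW.
    rewrite mulr1; apply: le_trans (weight_le del0 cc w s10) _.
    by rewrite lerDr mulr_ge0// mulr_ge0 ?expR_ge0// gr0.
  rewrite expectD; [|by brv|by brv].
  rewrite !expectZ//; apply: lerD.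
    rewrite ler_wpM2l//; first by nn.
    exact: (main _ _ _ _ _ _ _ _ _ _ _ gG del0 del1 del10 y0 yL ty cc).
  by rewrite expect_lt// mulrC -ler_pdivlMr.
have gz0 := gr0 _ z0.
have E0 : 0 <= expR (- G z) * (1 + g z) `^ s by nn.
have [zA|Az] := ltP z (A + 1).
  apply: (@le_trans _ _ (U2 * (expR (- G z) * (1 + g z) `^ s))); last first.
    by rewrite ler_wpM2r// lerDr ltW.
  have t0 := tame_le c2_gt0 m_ge0 tau_gt0 gG del0 del10 (lexx 0) z0 tz.
  have := inner 0 (lexx 0) t0.
  rewrite (drift0 gG) (drift_primitive0 gG) addr0 powR1 oppr0 expR0 !mulr1 => in0.
  apply: (@le_trans _ _ (B `^ (s + 1) + D * C0)).
    rewrite -(expect_cst P (B `^ (s + 1))).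
    apply: le_trans (lerD (lexx _) in0).
    rewrite -expectD; [|by brv|by brv].
    apply: expect_le; [by brv|by brv|] => w; set x := X w.
    have [xz|zx] := leP x z; first by rewrite mulr0; nn.
    rewrite mulr1; have [xA|Ax] := leP x (A + 1).
      rewrite -[leLHS]addr0; apply: lerD; last by nn.
      apply: powR_le; [by nn|by nn|].
      apply: (up _ _ gG); rewrite ger0_norm//; apply: ltW; exact: le_lt_trans zx.
    have -> : (Num.max (0 + delta) A < x) by rewrite gt_max add0r; apply/andP; split; lra.
    by rewrite mulr1 lerDr powR_ge0.
  rewrite /U2 -mulrA ler_peMr//; first by nn.
  have p1 : 1 <= (1 + g z) `^ s by apply: powR_ge1 => //; rewrite lerDl.
  rewrite mulrA -expRD -[leLHS]mulr1; apply: ler_pM => //.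
  rewrite -[leLHS]expR0 ler_expR subr_ge0; apply: le_trans (primitive_le gG z0) _.
  apply: ler_pM; [by []|by []| |exact: ltW].
  have := up _ _ gG z; rewrite !ger0_norm// => /(_ (ltW zA)); lra.
have y0 : 0 <= z - delta by lra.
have yz : z - delta <= z by lra.
have := inner _ y0 (tame_le c2_gt0 m_ge0 tau_gt0 gG del0 del10 y0 yz tz).
have -> : Num.max (z - delta + delta) A = z by rewrite subrK; apply/max_idPl; lra.
move=> /le_trans; apply.
apply: (@le_trans _ _ (U1 * (expR (- G z) * (1 + g z) `^ s))); last first.
  by rewrite ler_wpM2r// lerDl.
have -> : D * (1 + g (z - delta)) `^ s * (C0 * expR (- G (z - delta))) =
  D * C0 * (expR (- G (z - delta)) * (1 + g (z - delta)) `^ s) by ring.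
rewrite /U1 -[leRHS]mulrA ler_wpM2l//; first by nn.
rewrite mulrA -expRD; apply: ler_pM; [by nn|by nn| |].
  rewrite ler_expR; have /andP[_ h] := primitive_convex gG yz.
  have -> : q - G z = - (G z - q) by ring.
  rewrite lerN2; suff : g z * (z - (z - delta)) <= q by lra.
  have [tz1 _] := tz; apply: le_trans tz1.
  have -> : z - (z - delta) = delta by ring.
  rewrite mulrC; have zg : 0 <= z * g z by nn.
  have := mulr_ge0 (mulr_ge0 (ltW del0) (_ : 0 <= 1 + g z)) zg.
  move=> /(_ (addr_ge0 ler01 gz0)); lra.
apply: powR_le; [by []|by rewrite addr_ge0// gr0|].
by rewrite lerD2l (drift_homo gG).
Qed.

(** Split at [0] and at [v]. On the negative side this is a tail moment at level
    zero of the reflected coupling, in the middle it is [expect_exp_primitive],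
    and beyond [v] the factor [expR (G v)] cancels the decay of the tail
    moment. *)
Lemma expect_weight (q s : R) : 0 < q -> 0 <= s -> exists2 C : R, 0 < C &
  forall g G d (Omega : measurableType d) (P : probability Omega R)
    (delta delta1 : R) (X k : Omega -> R) (v : R), drift g G ->
  0 < delta -> delta <= 1 -> 0 < delta1 -> delta1 <= 1 -> 0 <= v ->
  tame q g delta delta1 v -> core_coupling P g delta delta1 X k ->
  \int[P]_w ((1 + `|g (X w)|) `^ (s + 1) * expR (G (clamp 0 v (X w))))
    <= C * ((1 + v) * (1 + g v) `^ (s + 1)).
Proof.
move=> q0 s0.
have s10 : 0 <= s + 1 by nn.
pose q' := 1 + Cg `^ tau.
have q'0 : 0 < q' by rewrite /q' ltr_wpDr//; nn.
have [Cl Cl0 left] := tail_moment q'0 s0.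
have [Cs Cs0 right] := tail_moment q0 s0.
have [Cz Cz0 zero] := tail_moment q0 (lexx 0).
exists (1 + Cl + (1 + Cz) + Cs); first by lra.
move=> g G d Omega P delta delta1 X k v gG del0 del1 del10 del11 v0 tv cc.
have gv0 := drift_ge0 gG v0.
have mX := core_measurable cc.
have bw := weight_bounded gG del0 cc s10.
have be := exp_clamp_bounded gG cc (lexx 0) v0.
have hl : \int[P]_w ((1 + `|g (X w)|) `^ (s + 1) * (0 < - X w)%R%:R) <= Cl.
  have t0 : tame q' (fun x => - g (- x)) delta delta1 0.
    rewrite /tame oppr0 (drift0 gG) oppr0 mulr0 addr0 !mulr1; split.
      by apply: le_trans del1 _; rewrite /q' lerDl powR_ge0.
    by rewrite -[leRHS]mul1r; apply: ler_pM => //; [exact: ltW|nn].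
  have := left _ _ _ _ _ _ _ _ _ _ (drift_reflect gG) del0 del1 del10 (lexx 0) t0
    (core_coupling_reflect cc).
  rewrite oppr0 (drift0 gG) (drift_primitive0 gG) !oppr0 addr0 powR1 expR0 !mulr1.
  by under eq_Rintegral do rewrite opprK normrN.
have hr := right _ _ _ _ _ _ _ _ _ _ gG del0 del1 del10 v0 tv cc.
have hm : \int[P]_w (expR (G (X w)) * (0 < X w)%R%:R * (X w <= v)%R%:R) <= 1 + Cz * v.
  apply: (expect_exp_primitive gG) => //; first exact: ltW.
  move=> u u0 uv; have gu0 := drift_ge0 gG u0.
  have := zero _ _ _ _ _ _ _ _ _ _ gG del0 del1 del10 u0
    (tame_le c2_gt0 m_ge0 tau_gt0 gG del0 del10 u0 uv tv) cc.
  rewrite powRr0 mulr1 -ler_pdivrMr ?expR_gt0// -expRN opprK => h.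
  rewrite -mulrA mulrCA mulrC; apply: le_trans h.
  rewrite ler_wpM2r ?expR_ge0//.
  rewrite -expect_lt// -expectZ; last by brv.
  have b0 := weight_bounded gG del0 cc (s := 0 + 1); rewrite add0r in b0.
  rewrite add0r; apply: expect_le; [by brv| |] => [|w].
    by apply: bounded_rvM; [exact: b0|brv].
  have [|ux] := leP (X w) u; first by rewrite !mulr0.
  rewrite !mulr1 powRr1; last by nn.
  rewrite (ger0_norm (drift_ge0 gG (le_trans u0 (ltW ux)))).
  by rewrite -[leLHS]add0r lerD// (drift_homo gG)// ltW.
have p1 : 1 <= (1 + g v) `^ (s + 1) by apply: powR_ge1 => //; rewrite lerDl.
set W := (1 + g v) `^ (s + 1) in p1 *.
have bm : bounded_rv (fun w => expR (G (X w)) * (0 < X w)%R%:R * (X w <= v)%R%:R).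
  have mG := primitive_measurable gG.
  split; first by mfun; apply: mfun_comp.
  exists (expR (G v)) => w; have [x0|x0] := ltP 0 (X w); last by rewrite mulr0 mul0r normr0 expR_ge0.
  have [xz|xz] := leP (X w) v; last by rewrite mulr0 normr0 expR_ge0.
  by rewrite !mulr1 ger0_norm ?expR_ge0// ler_expR (primitive_homo gG)// ltW.
apply: (@le_trans _ _ (\int[P]_w (1 + (1 + `|g (X w)|) `^ (s + 1) * (0 < - X w)%R%:R
   + W * (expR (G (X w)) * (0 < X w)%R%:R * (X w <= v)%R%:R)
   + expR (G v) * ((1 + `|g (X w)|) `^ (s + 1) * (v < X w)%R%:R)))).
  apply: expect_le; [by brv|by brv|] => w; set x := X w.
  have ww0 : 0 <= (1 + `|g x|) `^ (s + 1) by exact: powR_ge0.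
  have [x0|x0] := ltP 0 x; last first.
    rewrite (clamp_l _ x0) (drift_primitive0 gG) expR0 mulr1.
    have -> : (v < x) = false by apply/negbTE; rewrite -leNgt (le_trans x0).
    rewrite !(mulr0, mul0r) !addr0.
    move: x0; rewrite le_eqVlt => /predU1P[->|x0].
      by rewrite (drift0 gG) normr0 addr0 powR1 lerDl mulr_ge0.
    by rewrite oppr_gt0 x0 mulr1 lerDr.
  have -> : (0 < - x) = false by rewrite oppr_gt0 ltNge (ltW x0).
  rewrite mulr0 addr0 mulr1.
  have [xv|vx] := leP x v.
    rewrite clamp_id ?(ltW x0)// !mulr0 addr0 mulr1.
    rewrite -[leLHS]add0r; apply: lerD => //; rewrite ler_wpM2r ?expR_ge0//.
    apply: powR_le; [by nn|by nn|].
    by rewrite lerD2l (ger0_norm (drift_ge0 gG (ltW x0))) (drift_homo gG).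
  rewrite clamp_r ?(ltW vx)// !mulr0 addr0 mulr1 mulrC lerDr//.
rewrite !expectD; [|by brv..]; rewrite !expectZ; [|by brv..].
rewrite expect_cst.
have W0 : 0 <= W by exact: le_trans p1.
have h3 : W * \int[P]_w (expR (G (X w)) * (0 < X w)%R%:R * (X w <= v)%R%:R)
    <= W * ((1 + Cz) * (1 + v)).
  rewrite ler_wpM2l//; apply: le_trans hm _.
  have : 0 <= Cz by exact: ltW.
  lra.
have h4 : expR (G v) * \int[P]_w ((1 + `|g (X w)|) `^ (s + 1) * (v < X w)%R%:R) <= Cs * W.
  apply: le_trans (ler_wpM2l (expR_ge0 _) hr) _.
  rewrite mulrCA [X in _ * X]mulrA -expRD subrr expR0 mul1r ler_wpM2l ?(ltW Cs0)//.
  by rewrite /W powR_add1 ?addr_ge0// ler_peMl ?powR_ge0// lerDl.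
have V : W <= (1 + v) * W by rewrite ler_peMl// lerDl.
set V' := (1 + v) * W in V *.
have Cl' := ltW Cl0; have Cs' := ltW Cs0.
have k1 : Cl <= Cl * V' by rewrite ler_peMr//; lra.
have k2 : Cs * W <= Cs * V' by rewrite ler_wpM2l.
have k3 : W * ((1 + Cz) * (1 + v)) = (1 + Cz) * V' by rewrite /V'; ring.
lra.
Qed.

End WeightMoments.

(** * Functions glued at a point *)

Section Glue.
Variable R : realType.

Definition glue (v : R) (f1 f2 : R -> R) (x : R) : R := if x <= v then f1 x else f2 x.

Lemma glue_le (v : R) (f1 f2 e1 e2 : R -> R) (M lo hi : R) :
  (forall x : R, is_derive x 1 f1 (e1 x)) ->
  (forall x : R, is_derive x 1 f2 (e2 x)) -> f1 v = f2 v -> lo <= hi ->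
  (forall y, lo < y < hi -> y < v -> e1 y <= M) ->
  (forall y, lo < y < hi -> v < y -> e2 y <= M) ->
  glue v f1 f2 hi - glue v f1 f2 lo <= M * (hi - lo).
Proof.
move=> d1 d2 fv lohi b1 b2.
have aux (f e : R -> R) (a b : R) : (forall x : R, is_derive x 1 f (e x)) -> a <= b ->
    (forall y, a < y < b -> e y <= M) -> f b - f a <= M * (b - a).
  move=> de; rewrite le_eqVlt => /predU1P[->|ab] be; first by rewrite !subrr mulr0.
  have [c cab ->] := mvt_oo de ab.
  by rewrite ler_wpM2r ?be// subr_ge0 ltW.
rewrite /glue; have [hv|vh] := leP hi v.
  rewrite (le_trans lohi hv); apply: aux d1 lohi _ => y /andP[ly yh].
  by apply: b1; [rewrite ly|exact: lt_le_trans hv].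
have [lv|vl] := leP lo v; last first.
  apply: aux d2 lohi _ => y /andP[ly yh].
  by apply: b2; [rewrite ly|exact: lt_trans ly].
have h1 : f1 v - f1 lo <= M * (v - lo).
  apply: aux d1 lv _ => y /andP[ly yv].
  by apply: b1 => //; rewrite ly (lt_trans yv).
have h2 : f2 hi - f2 v <= M * (hi - v).
  apply: aux d2 (ltW vh) _ => y /andP[vy yh].
  by apply: b2 => //; rewrite yh (le_lt_trans lv).
lra.
Qed.

Lemma glue_ge (v : R) (f1 f2 e1 e2 : R -> R) (M lo hi : R) :
  (forall x : R, is_derive x 1 f1 (e1 x)) ->
  (forall x : R, is_derive x 1 f2 (e2 x)) -> f1 v = f2 v -> lo <= hi ->
  (forall y, lo < y < hi -> y < v -> M <= e1 y) ->
  (forall y, lo < y < hi -> v < y -> M <= e2 y) ->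
  M * (hi - lo) <= glue v f1 f2 hi - glue v f1 f2 lo.
Proof.
move=> d1 d2 fv lohi b1 b2.
have := @glue_le v (fun x => - f1 x) (fun x => - f2 x) (fun x => - e1 x)
  (fun x => - e2 x) (- M) lo hi.
have hN y : glue v (fun x => - f1 x) (fun x => - f2 x) y = - glue v f1 f2 y.
  by rewrite /glue; case: ifP.
have h1 (x : R) : is_derive x 1 (fun x => - f1 x) (- e1 x) by exact: is_deriveN.
have h2 (x : R) : is_derive x 1 (fun x => - f2 x) (- e2 x) by exact: is_derive_opp.
move=> /(_ h1 h2 (congr1 _ fv) lohi).
have h3 y : lo < y < hi -> y < v -> - e1 y <= - M by move=> *; rewrite lerN2 b1.
have h4 y : lo < y < hi -> v < y -> - e2 y <= - M by move=> *; rewrite lerN2 b2.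
move=> /(_ h3 h4); rewrite !hN; lra.
Qed.

End Glue.

(** * The tail of the limiting law *)

Section UpperTail.
Variables (R : realType) (c1 c2 c3 m : R).
Hypotheses (c1_gt0 : 0 < c1) (c2_gt0 : 0 < c2) (c3_ge1 : 1 <= c3)
  (m_ge0 : 0 <= m).
Notation drift := (drift c1 c2 c3 m).

(** The limits at both infinities are stated along arbitrarily distant points,
    which is enough for a monotone function and easy to reflect. *)
Record upper_tail (G S : R -> R) : Prop := UpperTail {
  upper_tail_derive : forall x : R, is_derive x 1 S (- (c1 * expR (- G x)));
  upper_tail_ge0 : forall x, 0 <= S x;
  upper_tail_le1 : forall x, S x <= 1;
  upper_tail_y : forall L0 e : R, 0 < e -> exists2 L, L0 <= L & S L <= e;
  upper_tail_Ny : forall L0 e : R, 0 < e -> exists2 L, L <= L0 & 1 - e <= S L }.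

Lemma upper_tail_reflect G S : upper_tail G S ->
  upper_tail (fun x => G (- x)) (fun x => 1 - S (- x)).
Proof.
case=> dS S0 S1 Sy SNy; split.
- move=> x.
  have dN : is_derive x (1 : R) (fun y : R => - y) (- 1 : R) by exact: is_deriveN.
  apply: is_derive_addc; apply: is_deriveN.
  have := is_derive_compR (dS (- x)) dN.
  by rewrite mulrN1 opprK.
- by move=> x; rewrite subr_ge0.
- by move=> x; rewrite gerBl.
- move=> L0 e e0; have [L LL h] := SNy (- L0) e e0.
  by exists (- L); [lra|rewrite opprK; lra].
- move=> L0 e e0; have [L LL h] := Sy (- L0) e e0.
  by exists (- L); [lra|rewrite opprK; lra].
Qed.

(** With [p = c1 * expR (- G)], the function [p - g x * S] has derivative
    [(g x - g) * p <= 0] beyond [x] and a nonnegative limit at infinity. *)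
Lemma mills g G S x : drift g G -> upper_tail G S ->
  g x * S x <= c1 * expR (- G x).
Proof.
move=> gG tS; pose p y := c1 * expR (- G y).
have dG := drift_primitive gG.
have dp (y : R) : is_derive y 1 p (- (g y * p y)).
  have := is_derive_scale c1 (is_derive_exp (is_derive_opp (dG y))).
  by move=> /is_derive_eq; apply; rewrite /p; ring.
have p0 y : 0 < p y by rewrite mulr_gt0// expR_gt0.
pose psi y := p y + - (g x * S y).
have dpsi (y : R) : is_derive y 1 psi (- (g y * p y) + - (g x * - p y)).
  apply: (is_derive_add (dp y)).
  exact/is_derive_opp/is_derive_scale/(upper_tail_derive tS).
rewrite -subr_ge0 leNgt; apply/negP => neg.
have [gx0|gx0] := leP (g x) 0.
  have := upper_tail_ge0 tS x; have := p0 x; rewrite /p in neg *; nra.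
pose e := - (p x - g x * S x) / (2 * g x).
have e0 : 0 < e by rewrite divr_gt0 ?mulr_gt0// oppr_gt0.
have [L xL SL] := upper_tail_y tS x e0.
have [c /andP[xc cL] eq] := mvt dpsi xL.
have : psi L - psi x <= 0.
  rewrite eq mulr_le0_ge0 ?subr_ge0//.
  have := drift_homo gG xc; have := p0 c; nra.
have : g x * S L <= g x * e by rewrite ler_pM2l.
have -> : g x * e = - (p x - g x * S x) / 2.
  by rewrite /e; field; rewrite gt_eqF.
have := p0 L; rewrite /psi /p in neg *; lra.
Qed.

Lemma upper_tail_homo G S x y : upper_tail G S -> x <= y -> S y <= S x.
Proof.
move=> tS xy; have [c _ e] := mvt (upper_tail_derive tS) xy.
rewrite -subr_le0 e mulr_le0_ge0 ?subr_ge0// oppr_le0.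
by rewrite mulr_ge0 ?expR_ge0// ltW.
Qed.

Lemma primitive_le_norm g G x : drift g G -> G x <= `|g x| * `|x|.
Proof.
move=> gG; have [x0|/ltW x0] := leP 0 x.
  have gx0 := drift_ge0 gG x0; rewrite (ger0_norm gx0) (ger0_norm x0).
  exact: (primitive_le gG x0).
have := primitive_convex gG x0.
rewrite (drift_primitive0 gG) (drift0 gG) mul0r => /andP[h _].
by rewrite (ler0_norm x0) (ler0_norm (drift_le0 gG x0)) mulrNN; lra.
Qed.

Lemma upper_tail_le : exists2 C : R, 0 < C & forall g G S (x : R), drift g G ->
  upper_tail G S -> - 1 <= x -> S x <= C * expR (- G x).
Proof.
have [A [a [A1 a0 low]]] := drift_lower c2 c3 m c1_gt0.
have [B B0 up] := drift_bounded c1 c3 c2_gt0 m_ge0 A.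
have A0 : 0 <= A by exact: le_trans A1.
exists (c1 / a + expR (B * A)); first by rewrite addr_gt0 ?divr_gt0 ?expR_gt0.
move=> g G S x gG tS x1.
have E0 := expR_ge0 (- G x).
have [xA|/ltW Ax] := leP x A.
  apply: (@le_trans _ _ (expR (B * A) * expR (- G x))); last first.
    by rewrite ler_wpM2r// lerDr divr_ge0 ?ltW.
  apply: le_trans (upper_tail_le1 tS x) _.
  rewrite -expRD -[leLHS]expR0 ler_expR subr_ge0.
  apply: le_trans (primitive_le_norm x gG) _.
  have xn : `|x| <= A by rewrite ler_norml; apply/andP; split; lra.
  by apply: ler_pM => //; have := up _ _ gG x xn; lra.
apply: (@le_trans _ _ (c1 / a * expR (- G x))); last first.
  by rewrite ler_wpM2r// lerDl expR_ge0.
rewrite mulrAC ler_pdivlMr//; apply: le_trans (mills x gG tS).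
by rewrite mulrC ler_wpM2r ?(upper_tail_ge0 tS)// (low _ _ gG).
Qed.

(** Keep only the mass of the interval of length [1 / (1 + g x)] to the right of
    [x], over which [G] grows by a bounded amount. *)
Lemma upper_tail_ge : exists2 C : R, 0 < C & forall g G S (x : R), drift g G ->
  upper_tail G S -> 0 <= x -> expR (- G x) <= C * ((1 + g x) * S x).
Proof.
pose Cg := 1 + c2 * (m + 1).
exists (expR Cg / c1); first by rewrite divr_gt0 ?expR_gt0.
move=> g G S x gG tS x0; have gx0 := drift_ge0 gG x0.
have d0 : 0 < 1 + g x by rewrite ltr_wpDr.
pose eta := (1 + g x)^-1.
have eta0 : 0 < eta by rewrite invr_gt0.
have eta1 : eta <= 1 by rewrite invf_le1// lerDl.
have xe : x <= x + eta by rewrite lerDl ltW.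
have [c /andP[xc ce] eq] := mvt (upper_tail_derive tS) xe.
have Sx : c1 * expR (- G c) * eta <= S x.
  have := upper_tail_ge0 tS (x + eta); have : x + eta - x = eta by ring.
  move=> h; rewrite h in eq; lra.
have Gc : G c <= G x + Cg.
  have h1 := primitive_homo gG (le_trans x0 xc) ce.
  have /andP[_ h2] := primitive_convex gG xe.
  have h3 : `|x + eta - x| <= 1 by rewrite (addrC x) addrK ger0_norm// ltW.
  have := drift_shift c2_gt0 m_ge0 gG h3.
  rewrite (ger0_norm gx0) ger0_norm ?(drift_ge0 gG) ?(le_trans x0)// -/Cg => h4.
  have h5 : x + eta - x = eta by ring.
  rewrite h5 in h2.
  have h6 : g (x + eta) * eta <= Cg * (1 + g x) * eta by rewrite ler_wpM2r ?(ltW eta0)//; lra.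
  have h7 : Cg * (1 + g x) * eta = Cg by rewrite mulfK// gt_eqF.
  lra.
have h : c1 * expR (- G x - Cg) <= (1 + g x) * S x.
  apply: (@le_trans _ _ ((1 + g x) * (c1 * expR (- G c) * eta))); last first.
    by rewrite ler_wpM2l// ltW.
  rewrite /eta [leRHS]mulrC mulfVK ?gt_eqF// ler_pM2l// ler_expR; lra.
rewrite mulrAC ler_pdivlMr//.
have -> : expR (- G x) * c1 = expR Cg * (c1 * expR (- G x - Cg)).
  by rewrite mulrCA -expRD mulrC; congr (_ * expR _); ring.
by rewrite ler_wpM2l ?expR_ge0.
Qed.

End UpperTail.

(** * Mills ratios and the solution of the Stein equation *)

Section SteinSolution.
Variables (R : realType) (c1 c2 c3 m : R).
Hypotheses (c1_gt0 : 0 < c1) (c2_gt0 : 0 < c2) (c3_ge1 : 1 <= c3)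
  (m_ge0 : 0 <= m).
Notation drift := (drift c1 c2 c3 m).
Notation upper_tail := (upper_tail c1).

(** The ratios [(1 - S) / p] and [S / p] of the two tails to the density
    [p = c1 * expR (- G)]. *)
Definition mills_lower (G S : R -> R) (x : R) : R :=
  c1^-1 * ((1 - S x) * expR (G x)).
Definition mills_upper (G S : R -> R) (x : R) : R := c1^-1 * (S x * expR (G x)).

(** The bounded solution of [f' = g * f + S v - 1_(v < x)]: the integrating factor
    is [p], and the two pieces agree at [v]. *)
Definition stein_solution (G S : R -> R) (v : R) : R -> R :=
  glue v (fun x => S v * mills_lower G S x)
    (fun x => (1 - S v) * mills_upper G S x).

(** A common majorant, up to constants, of [S v], of [1_(v < x)] and of [g * f] for
    the solution [f] at level [v]. The exponent is truncated at [v] because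
    beyond it [S v * expR (G v)] already compensates the indicator. *)
Definition stein_weight (g G S : R -> R) (v x : R) : R :=
  S v * ((1 + `|g x|) * expR (G (clamp 0 (Num.max v 0) x))).

Section OneTail.
Variables g G S : R -> R.
Hypotheses (gG : drift g G) (tS : upper_tail G S).

Let c1E (x : R) : c1^-1 * (c1 * expR (- G x) * expR (G x)) = 1.
Proof. by rewrite -mulrA -expRD addNr expR0 mulr1 mulVf// gt_eqF. Qed.

Lemma mills_lower_derive (x : R) : is_derive x 1 (mills_lower G S)
  (1 + g x * mills_lower G S x).
Proof.
have dS := upper_tail_derive tS x; have dG := drift_primitive gG x.
have := is_derive_scale c1^-1
  (is_derive_mul (is_derive_addc 1 (is_derive_opp dS)) (is_derive_exp dG)).
rewrite opprK mulrDr c1E => /is_derive_eq; apply.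
by rewrite /mills_lower; ring.
Qed.

Lemma mills_upper_derive (x : R) : is_derive x 1 (mills_upper G S)
  (- 1 + g x * mills_upper G S x).
Proof.
have dS := upper_tail_derive tS x; have dG := drift_primitive gG x.
have := is_derive_scale c1^-1 (is_derive_mul dS (is_derive_exp dG)).
rewrite mulrDr mulNr mulrN c1E => /is_derive_eq; apply.
by rewrite /mills_upper; ring.
Qed.

Lemma mills_lower_ge0 x : 0 <= mills_lower G S x.
Proof. by rewrite /mills_lower; have := upper_tail_le1 tS x => ?; nn. Qed.

Lemma mills_upper_ge0 x : 0 <= mills_upper G S x.
Proof. by rewrite /mills_upper; have := upper_tail_ge0 tS x => ?; nn. Qed.

Lemma mills_upper_le1 x : g x * mills_upper G S x <= 1.
Proof.
rewrite -(c1E x) /mills_upper mulrCA ler_pM2l ?invr_gt0//.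
by rewrite mulrA ler_pM2r ?expR_gt0//; exact: mills x gG tS.
Qed.

Lemma mills_lower_geN1 x : - 1 <= g x * mills_lower G S x.
Proof.
have := mills c1_gt0 (- x) (drift_reflect gG) (upper_tail_reflect tS).
rewrite opprK => /(ler_wpM2r (expR_ge0 (G x))).
have ci : 0 <= c1^-1 by rewrite invr_ge0 ltW.
move=> /(ler_wpM2l ci); rewrite c1E.
have -> : c1^-1 * (- g x * (1 - S x) * expR (G x)) = - (g x * mills_lower G S x).
  by rewrite /mills_lower; ring.
lra.
Qed.

End OneTail.

(** On the negative half-line the lower ratio is the upper ratio of the reflected
    law. *)
Lemma mills_bounds : exists2 C : R, 1 <= C & forall g G S, drift g G ->
  upper_tail G S ->
  [/\ forall x : R, - 1 <= x -> mills_upper G S x <= C,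
      forall x : R, - 1 <= x -> `|g x * mills_upper G S x| <= C &
      forall x : R, mills_lower G S x <= C * expR (G (Num.max x 0))].
Proof.
have [C0 C00 le0] := upper_tail_le c3 c1_gt0 c2_gt0 m_ge0.
have ci0 : 0 < c1^-1 by rewrite invr_gt0.
pose Cu := c1^-1 * C0.
have Cu0 : 0 < Cu by exact: mulr_gt0.
have mCu : 0 <= m * Cu by nn.
exists (1 + Cu + m * Cu + c1^-1) => [|g G S gG tS]; first by lra.
have up (x : R) : - 1 <= x -> mills_upper G S x <= Cu.
  move=> x1; rewrite /mills_upper /Cu ler_pM2l//.
  have := ler_wpM2r (expR_ge0 (G x)) (le0 _ _ _ x gG tS x1).
  by rewrite -mulrA -expRD addNr expR0 mulr1.
split=> [x x1|x x1|x].
- by apply: le_trans (up x x1) _; lra.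
- have u0 := mills_upper_ge0 tS x.
  have [x0|/ltW x0] := leP 0 x.
    have p0 : 0 <= g x * mills_upper G S x.
      by apply: mulr_ge0 => //; exact: drift_ge0 gG _ x0.
    rewrite (ger0_norm p0).
    by have := mills_upper_le1 gG tS x; lra.
  rewrite normrM (ger0_norm u0) (@le_trans _ _ (m * Cu))//; last by lra.
  apply: ler_pM => //; last exact: up.
  apply: (drift_norm_le1 gG); rewrite ler_norml; apply/andP; split; lra.
- have E1 : 1 <= expR (G (Num.max x 0)) by rewrite -[leLHS]expR0 ler_expR (primitive_ge0 gG).
  have [x0|/ltW x0] := leP 0 x.
    rewrite /mills_lower mulrA ler_wpM2r ?expR_ge0//.
    apply: (@le_trans _ _ (c1^-1 * 1)); last by rewrite mulr1; lra.
    by rewrite ler_wpM2l ?(ltW ci0)// gerBl (upper_tail_ge0 tS).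
  rewrite (drift_primitive0 gG) expR0 mulr1.
  apply: (@le_trans _ _ Cu); last by lra.
  rewrite /mills_lower /Cu ler_pM2l//.
  have x1 : - 1 <= - x by lra.
  have := le0 _ _ _ (- x) (drift_reflect gG) (upper_tail_reflect tS) x1.
  rewrite opprK => /(ler_wpM2r (expR_ge0 (G x))).
  by rewrite -mulrA -expRD addNr expR0 mulr1.
Qed.

Section Weight.
Variables g G S : R -> R.
Hypotheses (gG : drift g G) (tS : upper_tail G S).

Lemma stein_weight_ge x v : S v <= stein_weight g G S v x.
Proof.
rewrite /stein_weight ler_peMr ?(upper_tail_ge0 tS)//.
rewrite -[leLHS]mulr1; apply: ler_pM => //; first by rewrite lerDl.
by rewrite -[leLHS]expR0 ler_expR (primitive_ge0 gG).
Qed.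

Lemma stein_weight_ge0 x v : 0 <= stein_weight g G S v x.
Proof. exact: le_trans (upper_tail_ge0 tS v) (stein_weight_ge x v). Qed.

End Weight.

(** At [w = max v 0] the density bound [upper_tail_ge] says that
    [S w * (1 + g w) * expR (G w)] is bounded below. *)
Lemma stein_weight_far : exists2 C : R, 0 < C & forall g G S (v x : R), drift g G ->
  upper_tail G S -> v <= x -> 1 <= C * stein_weight g G S v x.
Proof.
have [C C0 hC] := upper_tail_ge c3 c1_gt0 c2_gt0 m_ge0.
exists C => // g G S v x gG tS vx; rewrite /stein_weight.
set w := Num.max v 0.
have w0 : 0 <= w by rewrite le_max lexx orbT.
have vw : v <= w by rewrite le_max lexx.
have -> : clamp 0 w x = w.
  rewrite /w; have [v0|/ltW v0] := leP v 0.
    by have /andP[h1 h2] := clamp_itv x (lexx 0); apply: le_anti; rewrite h1 h2.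
  by rewrite clamp_r.
have h := hC _ _ _ _ gG tS w0.
have gw : 1 + g w <= 1 + `|g x|.
  rewrite lerD2l /w; have [v0|/ltW v0] := leP v 0; first by rewrite (drift0 gG).
  by apply: le_trans (ler_norm _); exact: drift_homo gG _ _ vx.
have Sw : S w <= S v by exact: upper_tail_homo c1_gt0 _ _ _ _ tS vw.
have S0 := upper_tail_ge0 tS w; have gw0 := drift_ge0 gG w0.
have := ler_wpM2r (expR_ge0 (G w)) h.
rewrite -expRD addNr expR0 => /le_trans; apply.
rewrite -!mulrA ler_pM2l// !mulrA ler_wpM2r ?expR_ge0// mulrC.
by apply: ler_pM => //; nn.
Qed.

(** The assumption [delta * |g x| <= d1] bounds the change of [G] over a step of
    length [delta]. *)
Lemma stein_weight_shift (d1 : R) : 0 < d1 ->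
  exists2 C : R, 0 < C & forall g G S v (delta x y : R), drift g G ->
  upper_tail G S -> 0 < delta -> delta <= 1 -> delta * `|g x| <= d1 ->
  `|y - x| <= delta ->
  1 + `|g y| <= C * (1 + `|g x|) /\
  stein_weight g G S v y <= C * stein_weight g G S v x.
Proof.
move=> d10; pose Cg := 1 + c2 * (m + 1).
have Cg1 : 1 <= Cg by rewrite lerDl mulr_ge0 ?addr_ge0// ltW.
have Cg0 : 0 < Cg by exact: lt_le_trans Cg1.
pose E := expR (Cg * (1 + d1)).
have E1 : 1 <= E by rewrite -[leLHS]expR0 ler_expR; nn.
exists (Cg * E) => [|g G S v delta x y gG tS del0 del1 dx yx].
  by rewrite mulr_gt0 ?expR_gt0.
have yx1 := le_trans yx del1.
have h := drift_shift c2_gt0 m_ge0 gG yx1; rewrite -/Cg in h.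
split.
  apply: le_trans h _; rewrite ler_wpM2r ?addr_ge0//.
  by rewrite ler_peMr// ltW.
rewrite /stein_weight [leRHS]mulrCA ler_wpM2l ?(upper_tail_ge0 tS)//.
set w := Num.max v 0.
have w0 : 0 <= w by rewrite le_max lexx orbT.
have -> : Cg * E * ((1 + `|g x|) * expR (G (clamp 0 w x))) =
  Cg * (1 + `|g x|) * (E * expR (G (clamp 0 w x))) by ring.
apply: ler_pM; [by nn|by nn|exact: h|].
rewrite -expRD ler_expR -lerBlDr.
have Q0 : 0 <= Cg * (1 + d1) by nn.
have [le|/ltW le] := leP y x.
  have := clamp_homo w0 le; have /andP[k0 _] := clamp_itv y w0.
  by move=> /(primitive_homo gG k0); lra.
have cl := clamp_homo w0 le.
have /andP[_ +] := primitive_convex gG cl; move=> /le_trans; apply.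
have dd := clamp_sub w0 le.
have gcl : g (clamp 0 w y) * (clamp 0 w y - clamp 0 w x) <= `|g y| * (y - x).
  have [y0|y0] := leP y 0.
    have x0 := le_trans le y0.
    by rewrite !clamp_l// subrr mulr0 mulr_ge0// subr_ge0.
  apply: ler_pM.
  - by rewrite (drift_ge0 gG)//; case/andP: (clamp_itv y w0).
  - by rewrite subr_ge0.
  - apply: le_trans (ler_norm _).
    apply: (drift_homo gG); rewrite /clamp.
    by case: (leP y 0) => ?; [lra|case: (leP w y)].
  - exact: dd.
apply: le_trans gcl _.
rewrite ger0_norm ?subr_ge0// in yx.
apply: (@le_trans _ _ (Cg * (1 + `|g x|) * delta)).
  by apply: ler_pM => //; rewrite ?subr_ge0//; lra.
rewrite -mulrA ler_wpM2l ?(ltW Cg0)//; lra.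
Qed.

End SteinSolution.

(** * Size and increments of the solution *)

Section SteinBounds.
Variables (R : realType) (c1 c2 c3 m d1 : R).
Hypotheses (c1_gt0 : 0 < c1) (c2_gt0 : 0 < c2) (c3_ge1 : 1 <= c3)
  (m_ge0 : 0 <= m) (d1_gt0 : 0 < d1).
Notation drift := (drift c1 c2 c3 m).
Notation upper_tail := (upper_tail c1).
Notation mills_lower := (mills_lower c1).
Notation mills_upper := (mills_upper c1).
Notation stein_solution := (stein_solution c1).

Let c3_ge0 : 0 <= c3. Proof. exact: le_trans c3_ge1. Qed.

Lemma clamp_max (v x : R) : x <= v -> clamp 0 (Num.max v 0) x = Num.max x 0.
Proof.
move=> xv; have [x0|x0] := leP x 0; first by rewrite clamp_l.
by rewrite clamp_id// (ltW x0) le_max xv.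
Qed.

(** The last two quantities are the derivatives of [f * g] on either side of [v],
    for the solution [f] at level [v]. To the left the weight contains the same
    exponential as the lower Mills ratio; to the right the solution is bounded and
    the weight is of order at least one. *)
Lemma stein_bounds : exists2 C : R, 0 < C & forall g G S (v x : R),
  drift g G -> upper_tail G S -> - 1 <= v ->
  let w := stein_weight g G S v x in
  [/\ `|stein_solution G S v x * g x| <= C * w,
      x <= v -> `|S v * (g^`()%classic x * mills_lower G S x +
         g x * (1 + g x * mills_lower G S x))| <= C * ((1 + `|g x|) * w) &
      v <= x -> `|(1 - S v) * (g^`()%classic x * mills_upper G S x +
         g x * (- 1 + g x * mills_upper G S x))| <= C * ((1 + `|g x|) * w)].
Proof.
have [Cm Cm1 hm] := mills_bounds c3 c1_gt0 c2_gt0 m_ge0.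
have [Cf Cf0 hf] := stein_weight_far c3 c1_gt0 c2_gt0 m_ge0.
have Cm0 : 0 <= Cm by exact: le_trans Cm1.
pose D := Cm * (c3 + 2).
have D0 : 0 <= D by rewrite /D; nn.
have D1 : Cm <= D by rewrite /D ler_peMr//; have := c3_ge1; lra.
exists (1 + D * (1 + Cf)) => [|g G S v x gG tS v1 w].
  by rewrite ltr_pwDl// mulr_ge0//; nn.
have [mu mgu ml] := hm _ _ _ gG tS.
have ml0 := mills_lower_ge0 c1_gt0 tS x.
have mu0 := mills_upper_ge0 c1_gt0 tS x.
have S0 := upper_tail_ge0 tS v; have S1 := upper_tail_le1 tS v.
have w0 : 0 <= w by exact: stein_weight_ge0 gG tS x v.
have t1 : 1 <= 1 + `|g x| by rewrite lerDl.
set t := 1 + `|g x| in t1 *.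
have t0 : 0 <= t by exact: le_trans t1.
have gt : `|g x| <= t by rewrite /t lerDr.
have gd : `|g^`()%classic x| <= c3 * t by exact: drift_derive_le c3_ge1 _ _ gG x.
have up (a : R) : 0 <= a -> D * a <= (1 + D * (1 + Cf)) * a.
  by move=> a0; rewrite ler_wpM2r//; have := mulr_ge0 D0 (ltW Cf0); lra.
have upf (a : R) : 0 <= a -> D * (Cf * a) <= (1 + D * (1 + Cf)) * a.
  by move=> a0; rewrite mulrA ler_wpM2r//; lra.
have left : x <= v -> exists2 e, 1 <= e & w = S v * (t * e) /\ mills_lower G S x <= Cm * e.
  move=> xv; exists (expR (G (Num.max x 0))).
    by rewrite -[leLHS]expR0 ler_expR (primitive_ge0 gG).
  by split; [rewrite /w /stein_weight clamp_max|exact: ml].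
split.
- rewrite /stein_solution /glue; have [xv|/ltW vx] := leP x v.
    have [e e1 [we mle]] := left xv; have e0 : 0 <= e by exact: le_trans e1.
    apply: le_trans (up _ w0); rewrite normrM ger0_norm; last by nn.
    rewrite we.
    apply: (@le_trans _ _ (S v * (Cm * e) * t)).
      by apply: ler_pM => //; [nn|rewrite ler_wpM2l].
    have -> : S v * (Cm * e) * t = Cm * (S v * (t * e)) by ring.
    by rewrite ler_wpM2r//; nn.
  apply: le_trans (upf _ w0).
  apply: (@le_trans _ _ (1 * Cm)); last first.
    rewrite mul1r -[leLHS]mulr1; apply: ler_pM => //; exact: hf.
  rewrite -mulrA normrM; apply: ler_pM => //.
    by rewrite ger0_norm ?subr_ge0// gerBl.
  rewrite mulrC; apply: mgu; exact: le_trans vx.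
- move=> xv; have [e e1 [we mle]] := left xv; have e0 : 0 <= e by exact: le_trans e1.
  apply: le_trans (up _ _); last by nn.
  rewrite we normrM (ger0_norm S0).
  have -> : D * (t * (S v * (t * e))) = S v * (D * (t * (t * e))) by ring.
  rewrite ler_wpM2l//; apply: le_trans (ler_normD _ _) _.
  have -> : D * (t * (t * e)) = Cm * c3 * (t * (t * e)) + Cm * 2 * (t * (t * e)).
    by rewrite /D; ring.
  have te : t <= t * (t * e).
    rewrite ler_peMr//; rewrite -[leLHS]mulr1; exact: ler_pM.
  apply: lerD.
    rewrite normrM (ger0_norm ml0).
    apply: (@le_trans _ _ (c3 * t * (Cm * e))); first by apply: ler_pM.
    have -> : c3 * t * (Cm * e) = Cm * c3 * (t * e) by ring.
    rewrite ler_wpM2l//; first by nn.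
    by rewrite ler_peMl//; nn.
  rewrite normrM; apply: (@le_trans _ _ (t * (1 + t * (Cm * e)))).
    apply: ler_pM => //; apply: le_trans (ler_normD _ _) _.
    by rewrite normr1 lerD2l normrM (ger0_norm ml0); apply: ler_pM.
  have tte0 : 0 <= t * (t * e) by nn.
  have : t * (t * e) <= Cm * (t * (t * e)) by rewrite ler_peMl.
  have -> : t * (1 + t * (Cm * e)) = t + Cm * (t * (t * e)) by ring.
  lra.
- move=> vx; have x1 := le_trans v1 vx.
  apply: le_trans (upf _ _); last by nn.
  apply: (@le_trans _ _ (1 * (D * t))); last first.
    rewrite mul1r ler_wpM2l//.
    by rewrite mulrCA -[leLHS]mulr1 ler_wpM2l//; exact: hf.
  rewrite normrM; apply: ler_pM => //.
    by rewrite ger0_norm ?subr_ge0// gerBl.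
  apply: le_trans (ler_normD _ _) _.
  have -> : D * t = Cm * c3 * t + Cm * 2 * t by rewrite /D; ring.
  apply: lerD; rewrite normrM.
    rewrite (ger0_norm mu0) mulrC -mulrA; apply: ler_pM => //; exact: mu.
  rewrite mulrC; apply: ler_pM => //; apply: le_trans (ler_normD _ _) _.
  rewrite normrN1; have := mgu x x1; have := Cm1; lra.
Qed.

Lemma stein_product_dist : exists2 C : R, 0 < C & forall g G S (v delta x y : R),
  drift g G -> upper_tail G S -> - 1 <= v -> 0 < delta -> delta <= 1 ->
  delta * `|g x| <= d1 -> `|y - x| <= delta ->
  `|stein_solution G S v y * g y - stein_solution G S v x * g x| <=
    C * (delta * ((1 + `|g x|) * stein_weight g G S v x)).
Proof.
have [C C0 hC] := stein_bounds.
have [Cs Cs0 hs] := stein_weight_shift c1 c3 c2_gt0 m_ge0 d1_gt0.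
exists (C * (Cs * Cs)); first by rewrite !mulr_gt0.
move=> g G S v delta x y gG tS v1 del0 del1 dx yx.
set w := stein_weight g G S v.
pose M := C * (Cs * Cs) * ((1 + `|g x|) * w x).
have w0 z : 0 <= w z by exact: stein_weight_ge0 gG tS z v.
have M0 : 0 <= M by rewrite /M; nn.
have ptw z : `|z - x| <= delta -> C * ((1 + `|g z|) * w z) <= M.
  move=> zx; have [h1 h2] := hs _ _ _ v _ _ _ gG tS del0 del1 dx zx.
  rewrite /M -mulrA ler_wpM2l ?(ltW C0)//.
  have -> : Cs * Cs * ((1 + `|g x|) * w x) = Cs * (1 + `|g x|) * (Cs * w x) by ring.
  by apply: ler_pM => //; nn.
pose f1 z := S v * (g z * mills_lower G S z).
pose f2 z := (1 - S v) * (g z * mills_upper G S z).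
have fE z : stein_solution G S v z * g z = glue v f1 f2 z.
  by rewrite /stein_solution /glue /f1 /f2; case: ifP => _; ring.
have dg := drift_is_derive gG.
have df1 (z : R) : is_derive z 1 f1 (S v * (g^`()%classic z * mills_lower G S z +
    g z * (1 + g z * mills_lower G S z))).
  apply: is_derive_scale; apply: (is_derive_mul (dg z)).
  exact: (mills_lower_derive c1_gt0 gG tS).
have df2 (z : R) : is_derive z 1 f2 ((1 - S v) * (g^`()%classic z * mills_upper G S z +
    g z * (- 1 + g z * mills_upper G S z))).
  apply: is_derive_scale; apply: (is_derive_mul (dg z)).
  exact: (mills_upper_derive c1_gt0 gG tS).
have f12 : f1 v = f2 v by rewrite /f1 /f2 /mills_lower /mills_upper; ring.
have main lo hi : lo <= hi -> (forall z, lo < z < hi -> `|z - x| <= delta) ->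
    `|glue v f1 f2 hi - glue v f1 f2 lo| <= M * (hi - lo).
  move=> lohi near.
  rewrite ler_norml -mulNr; apply/andP; split.
    apply: (glue_ge df1 df2 f12 lohi) => z zz vz.
      have [_ h _] := hC _ _ _ v z gG tS v1; have := h (ltW vz).
      by move=> /le_trans /(_ (ptw _ (near z zz))); rewrite ler_norml => /andP[].
    have [_ _ h] := hC _ _ _ v z gG tS v1; have := h (ltW vz).
    by move=> /le_trans /(_ (ptw _ (near z zz))); rewrite ler_norml => /andP[].
  apply: (glue_le df1 df2 f12 lohi) => z zz vz.
    have [_ h _] := hC _ _ _ v z gG tS v1; have := h (ltW vz).
    by move=> /le_trans /(_ (ptw _ (near z zz))); rewrite ler_norml => /andP[].
  have [_ _ h] := hC _ _ _ v z gG tS v1; have := h (ltW vz).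
  by move=> /le_trans /(_ (ptw _ (near z zz))); rewrite ler_norml => /andP[].
rewrite !fE.
have -> : C * (Cs * Cs) * (delta * ((1 + `|g x|) * w x)) = M * delta.
  by rewrite /M; ring.
have [xy|/ltW yx'] := leP x y.
  apply: le_trans (main _ _ xy _) _.
    move=> z /andP[xz zy]; rewrite ger0_norm ?subr_ge0 ?(ltW xz)//.
    by rewrite ger0_norm ?subr_ge0// in yx; lra.
  rewrite ler_wpM2l//; exact: le_trans (ler_norm _) yx.
rewrite distrC; rewrite distrC in yx; apply: le_trans (main _ _ yx' _) _.
  move=> z /andP[xz zy]; rewrite distrC ger0_norm ?subr_ge0 ?(ltW zy)//.
  by rewrite ger0_norm ?subr_ge0// in yx; lra.
rewrite ler_wpM2l//; exact: le_trans (ler_norm _) yx.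
Qed.

End SteinBounds.

(** * Stein's identity applied to the solution *)

Section SteinInequalities.
Variables (R : realType) (c1 c2 c3 m d0 d1 tau : R).
Hypotheses (c1_gt0 : 0 < c1) (c2_gt0 : 0 < c2) (c3_ge1 : 1 <= c3)
  (m_ge0 : 0 <= m) (d0_ge1 : 1 <= d0) (d1_gt0 : 0 < d1) (tau_gt0 : 0 < tau).
Notation drift := (drift c1 c2 c3 m).
Notation upper_tail := (upper_tail c1).
Notation core_coupling := (core_coupling d0 d1 tau).
Notation mills_lower := (mills_lower c1).
Notation mills_upper := (mills_upper c1).
Notation stein_solution := (stein_solution c1).

(** Makes the solution an admissible test function; its constant depends on the
    drift. *)
Lemma stein_solution_lipschitz g G S (v : R) : drift g G -> upper_tail G S ->
  - 1 <= v -> exists2 L : R, 0 <= L &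
  forall x y : R, `|stein_solution G S v x - stein_solution G S v y| <= L * `|x - y|.
Proof.
move=> gG tS v1.
have [Cm Cm1 hm] := mills_bounds c3 c1_gt0 c2_gt0 m_ge0.
have Cm0 : 0 <= Cm by exact: le_trans Cm1.
have [_ mgu ml] := hm _ _ _ gG tS.
have S0 := upper_tail_ge0 tS v; have S1 := upper_tail_le1 tS v.
pose vp := Num.max v 0.
have vp0 : 0 <= vp by rewrite /vp le_max lexx orbT.
have gvp0 := drift_ge0 gG vp0.
have gv0 : 0 <= g vp * (Cm * expR (G vp)) by nn.
pose L := 1 + g vp * (Cm * expR (G vp)) + Cm.
have L0 : 0 <= L by rewrite /L; nn.
exists L => //.
have e1 (z : R) : is_derive z 1 (fun x => S v * mills_lower G S x)
    (S v * (1 + g z * mills_lower G S z)).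
  by apply: is_derive_scale; exact: (mills_lower_derive c1_gt0 gG tS).
have e2 (z : R) : is_derive z 1 (fun x => (1 - S v) * mills_upper G S x)
    ((1 - S v) * (- 1 + g z * mills_upper G S z)).
  by apply: is_derive_scale; exact: (mills_upper_derive c1_gt0 gG tS).
have e12 : S v * mills_lower G S v = (1 - S v) * mills_upper G S v.
  by rewrite /mills_lower /mills_upper; ring.
have b1 (z : R) : z < v -> `|S v * (1 + g z * mills_lower G S z)| <= L.
  move=> zv; have hN := mills_lower_geN1 c1_gt0 gG tS z.
  have ml0 := mills_lower_ge0 c1_gt0 tS z.
  rewrite normrM (ger0_norm S0) -[leRHS]mul1r; apply: ler_pM => //.
  rewrite ger0_norm; last by lra.
  rewrite /L -addrA lerD2l -[leLHS]addr0; apply: lerD => //.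
  have [z0|/ltW z0] := leP z 0.
    by apply: le_trans gv0; rewrite mulr_le0_ge0// (drift_le0 gG).
  have zvp : z <= vp by rewrite /vp le_max (ltW zv).
  apply: ler_pM; rewrite ?(drift_ge0 gG) ?(drift_homo gG)//.
  apply: le_trans (ml z) _; rewrite ler_wpM2l// ler_expR.
  have -> : Num.max z 0 = z by apply/max_idPl.
  exact: primitive_homo gG _ _ z0 zvp.
have b2 (z : R) : v < z -> `|(1 - S v) * (- 1 + g z * mills_upper G S z)| <= L.
  move=> vz; rewrite normrM -[leRHS]mul1r; apply: ler_pM => //.
    by rewrite ger0_norm ?subr_ge0// gerBl.
  apply: le_trans (ler_normD _ _) _; rewrite normrN1.
  have := mgu z (le_trans v1 (ltW vz)); rewrite /L; lra.
move=> x y; wlog xy : x y / x <= y.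
  by have [xy|/ltW yx] := leP x y; [exact|rewrite distrC (distrC x); exact].
rewrite distrC (distrC x) (ger0_norm (_ : 0 <= y - x)) ?subr_ge0//.
rewrite ler_norml -mulNr; apply/andP; split.
  apply: (glue_ge e1 e2 e12 xy) => z _ zv.
    by have := b1 z zv; rewrite ler_norml => /andP[].
  by have := b2 z zv; rewrite ler_norml => /andP[].
apply: (glue_le e1 e2 e12 xy) => z _ zv.
  by have := b1 z zv; rewrite ler_norml => /andP[].
by have := b2 z zv; rewrite ler_norml => /andP[].
Qed.

(** The derivative of the solution is [f * g + S v - 1_(v < .)], and [f * g] is
    almost constant over the step. Moving the jump from [v] to [v - delta] or to
    [v + delta] makes the indicator one-sided on the whole step, at the price of a
    shift of the level. *)
Lemma stein_slope g G S (v delta c x lo hi : R) :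
  drift g G -> upper_tail G S ->
  (forall z : R, `|z - x| <= delta ->
     `|stein_solution G S v z * g z - stein_solution G S v x * g x| <= c) ->
  lo <= x <= hi -> hi - lo <= delta ->
  (stein_solution G S v x * g x + S v - (v - delta < x)%R%:R - c) * (hi - lo)
    <= stein_solution G S v hi - stein_solution G S v lo /\
  stein_solution G S v hi - stein_solution G S v lo
    <= (stein_solution G S v x * g x + S v - (v + delta < x)%R%:R + c) * (hi - lo).
Proof.
move=> gG tS near /andP[lox xhi] hl; have lohi := le_trans lox xhi.
pose h x := stein_solution G S v x * g x; rewrite -/(h x).
have e1 (z : R) : is_derive z 1 (fun x => S v * mills_lower G S x)
    (S v * (1 + g z * mills_lower G S z)).
  by apply: is_derive_scale; exact: (mills_lower_derive c1_gt0 gG tS).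
have e2 (z : R) : is_derive z 1 (fun x => (1 - S v) * mills_upper G S x)
    ((1 - S v) * (- 1 + g z * mills_upper G S z)).
  by apply: is_derive_scale; exact: (mills_upper_derive c1_gt0 gG tS).
have e12 : S v * mills_lower G S v = (1 - S v) * mills_upper G S v.
  by rewrite /mills_lower /mills_upper; ring.
have hE1 (z : R) : z < v -> S v * (1 + g z * mills_lower G S z) = h z + S v.
  by move=> zv; rewrite /h /stein_solution /glue (ltW zv); ring.
have hE2 (z : R) : v < z -> (1 - S v) * (- 1 + g z * mills_upper G S z) = h z + S v - 1.
  by move=> vz; rewrite /h /stein_solution /glue leNgt vz /=; ring.
have nr (z : R) : lo < z < hi -> h x - c <= h z <= h x + c.
  move=> /andP[lz zh]; have zx : `|z - x| <= delta.
    by rewrite ler_norml; apply/andP; split; lra.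
  have := near z zx; rewrite ler_norml -/(h z) -/(h x) => /andP[n1 n2].
  by apply/andP; split; lra.
split.
  apply: (glue_ge e1 e2 e12 lohi) => z zz zv; have /andP[n1 n2] := nr z zz.
    rewrite hE1//.
    have : 0 <= (v - delta < x)%R%:R :> R by [].
    lra.
  have -> : (v - delta < x) = true by case/andP: zz => z1 z2; lra.
  rewrite hE2// mulr1n; lra.
apply: (glue_le e1 e2 e12 lohi) => z zz zv; have /andP[n1 n2] := nr z zz.
  have -> : (v + delta < x) = false.
    by apply/negbTE; rewrite -leNgt; case/andP: zz => z1 z2; lra.
  rewrite hE1// mulr0n; lra.
rewrite hE2//.
have : (v + delta < x)%R%:R <= 1 :> R by rewrite lern1 leq_b1.
lra.
Qed.

(** Once the jump is moved by at most [delta], it may lie where the weight is not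
    yet known to be large; [stein_weight_shift] covers that gap. *)
Lemma stein_residual : exists2 B : R, 0 < B &
  forall g G S (v delta s x : R), drift g G -> upper_tail G S -> - 1 <= v ->
  0 < delta -> delta <= 1 -> delta * `|g x| <= d1 -> - delta <= s ->
  `|stein_solution G S v x * g x + S v - (v + s < x)%R%:R|
    <= B * stein_weight g G S v x.
Proof.
have [Cb Cb0 hb] := stein_bounds c1_gt0 c2_gt0 c3_ge1 m_ge0.
have [Cf Cf0 hf] := stein_weight_far c3 c1_gt0 c2_gt0 m_ge0.
have [Cs Cs0 hs] := stein_weight_shift c1 c3 c2_gt0 m_ge0 d1_gt0.
have CfCs : 0 < Cf * Cs by exact: mulr_gt0.
exists (Cb + 1 + (Cf + Cf * Cs)); first by lra.
move=> g G S v delta s x gG tS v1 del0 del1 dx sd.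
have [hw _ _] := hb _ _ _ v x gG tS v1.
have sw := stein_weight_ge gG tS x v.
have w0 := stein_weight_ge0 gG tS x v.
have S0 := upper_tail_ge0 tS v.
set w := stein_weight g G S v x in hw sw w0 *.
have ind : (v + s < x)%R%:R <= (Cf + Cf * Cs) * w.
  have [vx|vx] := ltP (v + s) x; last by rewrite mulr_ge0// addr_ge0 ?ltW.
  have [vx'|/ltW xv] := leP v x.
    apply: le_trans (hf _ _ _ _ _ gG tS vx') _; rewrite ler_wpM2r//.
    by rewrite lerDl ltW.
  have vx1 : `|v - x| <= delta by rewrite ger0_norm ?subr_ge0//; lra.
  have [_ h2] := hs _ _ _ v _ _ _ gG tS del0 del1 dx vx1.
  apply: le_trans (hf _ _ _ _ _ gG tS (lexx v)) _.
  apply: (@le_trans _ _ (Cf * (Cs * w))); first by rewrite ler_wpM2l ?(ltW Cf0).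
  by rewrite mulrA ler_wpM2r// lerDr ltW.
apply: le_trans (ler_normB _ _) _; rewrite [leRHS]mulrDl; apply: lerD.
  apply: le_trans (ler_normD _ _) _; rewrite mulrDl mul1r; apply: lerD => //.
  by rewrite ger0_norm.
by rewrite ger0_norm.
Qed.

Lemma sqr_slope (f : R -> R) (u x y : R) :
  (x <= y -> f y - f x <= u * (y - x)) -> (y <= x -> f x - f y <= u * (x - y)) ->
  (f y - f x) * (y - x) <= u * (y - x) ^+ 2.
Proof.
move=> h1 h2; rewrite expr2 mulrA; have [xy|/ltW yx] := leP x y.
  by rewrite ler_wpM2r ?subr_ge0//; exact: h1.
have -> : (f y - f x) * (y - x) = (f x - f y) * (x - y) by ring.
have -> : u * (y - x) * (y - x) = u * (x - y) * (x - y) by ring.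
by rewrite ler_wpM2r ?subr_ge0//; exact: h2.
Qed.

(** If the slopes of the solution [f] were [f' (X)] and if [k] were one, Stein's
    identity would say [P (v < X) = S v]. The first replacement costs
    [delta * (1 + |g|)] times the weight and moves [v] by [delta], the second one
    costs [|k - 1|] times the weight. *)
Lemma stein_inequalities : exists2 C : R, 0 < C &
  forall g G S d (Omega : measurableType d) (P : probability Omega R)
    (delta delta1 : R) (X k : Omega -> R) (v : R),
  drift g G -> upper_tail G S -> - 1 <= v -> 0 < delta -> delta <= 1 ->
  0 < delta1 -> core_coupling P g delta delta1 X k ->
  let Q := \int[P]_w (delta * ((1 + `|g (X w)|) * stein_weight g G S v (X w)) +
    delta1 * ((1 + `|g (X w)|) `^ tau * stein_weight g G S v (X w))) in
  fine (P [set w | v + delta < X w]) <= S v + C * Q /\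
  S v - C * Q <= fine (P [set w | v - delta < X w]).
Proof.
have arith_up (h s i k p e f c : R) : k * p <= f -> f + e <= c ->
    (k - 1) * (h + s - i) <= e -> i + k * (h + s - i + p) <= h + (s + c) by lra.
have arith_dn (h s i k p e f c : R) : k * p <= f -> f + e <= c ->
    - e <= (k - 1) * (h + s - i) ->
    k * (- (h + s - i) + p) + (- 1) * i <= - h + (- s + c) by lra.
have arith_mul (a b p q : R) : 0 <= a * q -> 0 <= b * p ->
    a * p + b * q <= (a + b) * (p + q) by lra.
have arith_opp (a b c t : R) : - c * t <= a - b -> - a - - b <= c * t by lra.
have [Cb Cb0 hb] := stein_bounds c1_gt0 c2_gt0 c3_ge1 m_ge0.
have [Cd Cd0 hd] := stein_product_dist c1_gt0 c2_gt0 c3_ge1 m_ge0 d1_gt0.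
have [B B0 hB] := stein_residual.
have d00 : 0 <= d0 by exact: le_trans d0_ge1.
pose C := d0 * Cd + 2 * B.
exists C; first by rewrite /C ltr_wpDl ?mulr_gt0//; nn.
move=> g G S d Omega P delta delta1 X k v gG tS v1 del0 del1 del10 cc Q.
have [Lc Lc0 lipf] := stein_solution_lipschitz gG tS v1.
pose w := stein_weight g G S v.
pose h x := stein_solution G S v x * g x.
pose Psi x := delta * ((1 + `|g x|) * w x).
pose Phi x := delta1 * ((1 + `|g x|) `^ tau * w x).
have w0 z : 0 <= w z by exact: stein_weight_ge0 gG tS z v.
have Psi0 x : 0 <= Psi x by rewrite /Psi; nn.
have Phi0 x : 0 <= Phi x by rewrite /Phi; nn.
have CPsi0 x : 0 <= Cd * Psi x by apply: mulr_ge0; [exact: ltW|exact: Psi0].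
have S0 := upper_tail_ge0 tS v; have S1 := upper_tail_le1 tS v.
pose vp := Num.max v 0.
have vp0 : 0 <= vp by rewrite /vp le_max lexx orbT.
have dd0 : 0 <= d1 / delta by rewrite divr_ge0 ?ltW.
pose Wm := (1 + d1 / delta) * expR (G vp).
have Wm0 : 0 <= Wm by rewrite /Wm; nn.
have wW x : delta * `|g x| <= d1 -> w x <= Wm.
  move=> /(core_drift_le del0) gx; rewrite /w /stein_weight -/vp -[leRHS]mul1r.
  apply: ler_pM; [by []|by nn|by []|].
  apply: ler_pM; [by nn|by nn|by rewrite lerD2l|].
  have /andP[k0 k1] := clamp_itv x vp0.
  by rewrite ler_expR (primitive_homo gG).
have mg := drift_measurable gG; have mG := primitive_measurable gG.
have mX := core_measurable cc.
have mw : measurable_fun setT w.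
  rewrite /w /stein_weight; mfun; apply: (mfun_comp mG).
  by apply: mfun_clamp; [exact: vp0|exact: measurable_id].
have mf : measurable_fun setT (stein_solution G S v) by exact: lipschitz_measurable lipf.
have mh : measurable_fun setT h by rewrite /h; mfun.
have hw x : `|h x| <= Cb * w x by have [] := hb _ _ _ v x gG tS v1.
have bdd (phi : R -> R) (N : R) : measurable_fun setT phi ->
  (forall x, delta * `|g x| <= d1 -> `|phi x| <= N) ->
  bounded_rv (fun w => phi (X w)) by exact: core_bounded cc _ _.
have bw : bounded_rv (fun t => w (X t)).
  by apply: (bdd w Wm) => // x dx; rewrite ger0_norm// wW.
have bg1 : bounded_rv (fun t => 1 + `|g (X t)|).
  apply: (bdd (fun x => 1 + `|g x|) (1 + d1 / delta)); first by mfun.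
  move=> x /(core_drift_le del0) gx; rewrite ger0_norm; last by nn.
  by rewrite lerD2l.
have bg2 : bounded_rv (fun t => (1 + `|g (X t)|) `^ tau).
  apply: (bdd (fun x => (1 + `|g x|) `^ tau) ((1 + d1 / delta) `^ tau)); first by mfun.
  move=> x /(core_drift_le del0) gx; rewrite ger0_norm ?powR_ge0//.
  by apply: powR_le; [exact: ltW|nn|rewrite lerD2l].
have bPsi : bounded_rv (fun t => Psi (X t)) by rewrite /Psi; brv.
have bPhi : bounded_rv (fun t => Phi (X t)) by rewrite /Phi; brv.
have fg x : delta * `|g x| <= d1 -> `|h x| <= Cb * Wm.
  move=> dx; apply: le_trans (hw x) _.
  by rewrite ler_wpM2l ?(ltW Cb0)// wW.
have bh : bounded_rv (fun t => h (X t)) by exact: bdd fg.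
have bk := core_bounded_k cc.
have rest (x s : R) : delta * `|g x| <= d1 -> - delta <= s ->
    `|h x + S v - (v + s < x)%R%:R| <= B * w x.
  by move=> dx sd; exact: hB gG tS v1 del0 del1 dx sd.
have kk t : `|k t - 1| <= 2 * (delta1 * (1 + `|g (X t)|) `^ tau).
  apply: le_trans (core_k1 cc t) _; rewrite mulrCA ler_wpM2l ?(ltW del10)//.
  have p1 : `|g (X t)| `^ tau <= (1 + `|g (X t)|) `^ tau.
    by apply: powR_le; [exact: ltW|by []|rewrite lerDr].
  have p2 : 1 <= (1 + `|g (X t)|) `^ tau.
    by apply: powR_ge1; [rewrite lerDl|exact: ltW].
  by rewrite mulr_natl mulr2n; exact: lerD.
have QE : Q = \int[P]_t (Psi (X t) + Phi (X t)) by [].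
have resid t (s : R) : - delta <= s ->
    `|(k t - 1) * (h (X t) + S v - (v + s < X t)%R%:R)| <= 2 * B * Phi (X t).
  move=> sd; rewrite normrM.
  have -> : 2 * B * Phi (X t) = 2 * (delta1 * (1 + `|g (X t)|) `^ tau) * (B * w (X t)).
    by rewrite /Phi; ring.
  by apply: ler_pM => //; apply: rest => //; exact: core_drift cc t.
have kPsi t : k t * (Cd * Psi (X t)) <= d0 * Cd * Psi (X t).
  rewrite -mulrA; apply: ler_wpM2r; first exact: CPsi0.
  by case/andP: (core_k cc t).
pose up x := h x + S v - (v + delta < x)%R%:R + Cd * Psi x.
pose dn x := - (h x + S v - (v - delta < x)%R%:R) + Cd * Psi x.
have mPsi : measurable_fun setT Psi by rewrite /Psi; mfun.
have mup : measurable_fun setT up by rewrite /up; mfun; exact: measurable_id.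
have mdn : measurable_fun setT dn by rewrite /dn; mfun; exact: measurable_id.
pose N := B * Wm + Cd * ((1 + d1) * Wm).
have ub (x r : R) : delta * `|g x| <= d1 -> `|r| <= B * w x ->
    `|r + Cd * Psi x| <= N.
  move=> dx rB; apply: le_trans (ler_normD _ _) _; apply: lerD.
    by apply: le_trans rB _; rewrite ler_wpM2l ?(ltW B0)// wW.
  rewrite (ger0_norm (CPsi0 x)) ler_wpM2l ?(ltW Cd0)//.
  rewrite /Psi mulrA; apply: ler_pM; [by nn|by []| |exact: wW].
  by rewrite mulrDr mulr1 lerD.
pose M := Lc + Cb * Wm + N.
have n1 : 0 <= Cb * Wm by nn.
have n2 : 0 <= N by rewrite /N; nn.
have LM : Lc <= M by rewrite /M -addrA lerDl addr_ge0.
have hM : Cb * Wm <= M by rewrite /M addrAC lerDr addr_ge0.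
have NM : N <= M by rewrite /M lerDr addr_ge0.
have lipM (x y : R) : `|stein_solution G S v x - stein_solution G S v y| <= M * `|x - y|.
  by apply: le_trans (lipf x y) _; rewrite ler_wpM2r.
have ddl : - delta <= delta by apply: le_trans (ltW del0); rewrite oppr_le0 ltW.
have slope (x lo hi : R) : delta * `|g x| <= d1 -> lo <= x <= hi -> hi - lo <= delta ->
    - dn x * (hi - lo) <= stein_solution G S v hi - stein_solution G S v lo /\
    stein_solution G S v hi - stein_solution G S v lo <= up x * (hi - lo).
  move=> dx lxh hl.
  have near (z : R) : `|z - x| <= delta -> `|h z - h x| <= Cd * Psi x.
    by move=> zx; exact: (hd _ _ _ _ _ _ _ gG tS v1 del0 del1 dx zx).
  have [s1 s2] := stein_slope gG tS near lxh hl.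
  by split; [rewrite /dn opprD opprK|].
have iup : \int[P]_t (h (X t)) <= \int[P]_t (k t * up (X t)).
  apply: (core_stein cc (f := stein_solution G S v) (u := up) (M := M)) => //.
  - move=> x dx; split; first exact: le_trans (fg x dx) hM.
    by apply: le_trans NM; apply: ub => //; exact: rest.
  - move=> x y dx yx; apply: sqr_slope => le.
      have [|//|_ //] := slope x x y dx; first by rewrite lexx.
      exact: le_trans (ler_norm _) yx.
    rewrite distrC in yx.
    have [|//|_ //] := slope x y x dx; first by rewrite lexx le.
    exact: le_trans (ler_norm _) yx.
have idn : \int[P]_t (- h (X t)) <= \int[P]_t (k t * dn (X t)).
  have := core_stein cc (f := fun x => - stein_solution G S v x) (u := dn) (M := M).
  under eq_Rintegral do rewrite mulNr.
  apply => //.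
  - by move=> x y; rewrite -opprD normrN.
  - move=> x dx; rewrite mulNr normrN; split; first exact: le_trans (fg x dx) hM.
    by apply: le_trans NM; apply: ub => //; rewrite normrN; exact: rest.
  - move=> x y dx yx; apply: (@sqr_slope (fun x => - stein_solution G S v x)) => le.
      have [||+ _] := slope x x y dx; first by rewrite lexx.
        exact: le_trans (ler_norm _) yx.
      exact: arith_opp.
    rewrite distrC in yx.
    have [||+ _] := slope x y x dx; first by rewrite lexx le.
      exact: le_trans (ler_norm _) yx.
    exact: arith_opp.
have b_up : bounded_rv (fun t => up (X t)) by rewrite /up; brv.
have b_dn : bounded_rv (fun t => dn (X t)) by rewrite /dn; brv.
have CB t : d0 * Cd * Psi (X t) + 2 * B * Phi (X t) <= C * (Psi (X t) + Phi (X t)).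
  have a1 : 0 <= d0 * Cd * Phi (X t).
    by apply: mulr_ge0 => //; apply: mulr_ge0 => //; exact: ltW.
  have a2 : 0 <= 2 * B * Psi (X t).
    by apply: mulr_ge0 => //; apply: mulr_ge0 => //; exact: ltW.
  exact: arith_mul a1 a2.
rewrite QE; split.
  have main : \int[P]_t ((v + delta < X t)%R%:R + k t * up (X t)) <=
      \int[P]_t (h (X t) + (S v + C * (Psi (X t) + Phi (X t)))).
    apply: expect_le; [by brv|by brv|] => t.
    have := resid t delta ddl; rewrite ler_norml => /andP[_].
    exact: arith_up (kPsi t) (CB t).
  move: main; rewrite !expectD; [|by brv..]; rewrite expectZ; last by brv.
  rewrite !expectD; [|by brv..]; rewrite expect_cst expect_lt//.
  by move: iup; lra.
have main : \int[P]_t (k t * dn (X t) + (- 1) * (v - delta < X t)%R%:R) <=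
    \int[P]_t (- h (X t) + (- S v + C * (Psi (X t) + Phi (X t)))).
  apply: expect_le; [by brv|by brv|] => t.
  have := resid t (- delta) (lexx _); rewrite ler_norml => /andP[+ _].
  exact: arith_dn (kPsi t) (CB t).
have bi : bounded_rv (fun t => (v - delta < X t)%R%:R : R).
  by apply: bounded_rv_lt => //; exact: mfun_cst.
have bPP := bounded_rvD bPsi bPhi.
move: main; rewrite expectD; [|by brv|by brv].
rewrite expectD; [|by brv|by brv]; rewrite expectD; [|by brv|by brv].
rewrite (expectZ P _ bi) (expectZ P _ bPP) expect_cst expect_lt//.
by move: idn; lra.
Qed.

End SteinInequalities.

(** * Comparison of the two tails *)

Section Comparison.
Variables (R : realType) (c1 c2 c3 m d0 d1 tau : R).
Hypotheses (c1_gt0 : 0 < c1) (c2_gt0 : 0 < c2) (c3_ge1 : 1 <= c3)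
  (m_ge0 : 0 <= m) (d0_ge1 : 1 <= d0) (d1_gt0 : 0 < d1) (tau_gt0 : 0 < tau).
Notation drift := (drift c1 c2 c3 m).
Notation upper_tail := (upper_tail c1).
Notation core_coupling := (core_coupling d0 d1 tau).
Notation tame := (tame c2 m tau).

(** The error terms of [stein_inequalities] are weighted moments, evaluated by
    [expect_weight] with exponents one and [tau]; the factor [S v] of the weight
    makes the error relative. *)
Lemma tail_comparison (q : R) : 0 < q -> exists2 C : R, 0 < C &
  forall g G S d (Omega : measurableType d) (P : probability Omega R)
    (delta delta1 : R) (X k : Omega -> R) (v : R),
  drift g G -> upper_tail G S -> - 1 <= v -> 0 < delta -> delta <= 1 ->
  0 < delta1 -> delta1 <= 1 -> tame q g delta delta1 (Num.max v 0) ->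
  core_coupling P g delta delta1 X k ->
  let y := Num.max v 0 in
  let Q := delta * ((1 + y) * (1 + g y) `^ (1 + 1)) +
    delta1 * ((1 + y) * (1 + g y) `^ (tau + 1)) in
  fine (P [set w | v + delta < X w]) <= S v * (1 + C * Q) /\
  S v * (1 - C * Q) <= fine (P [set w | v - delta < X w]).
Proof.
move=> q0.
have [C C0 hC] := stein_inequalities c1_gt0 c2_gt0 c3_ge1 m_ge0 d0_ge1 d1_gt0 tau_gt0.
have [Ca Ca0 ha] := expect_weight c1_gt0 c2_gt0 c3_ge1 m_ge0 d0_ge1 d1_gt0 tau_gt0 q0 ler01.
have [Cb Cb0 hb] := expect_weight c1_gt0 c2_gt0 c3_ge1 m_ge0 d0_ge1 d1_gt0 tau_gt0 q0 (ltW tau_gt0).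
exists (C * (Ca + Cb)); first by rewrite mulr_gt0// addr_gt0.
move=> g G S d Omega P delta delta1 X k v gG tS v1 del0 del1 del10 del11 ty cc y Q.
have y0 : 0 <= y by rewrite /y le_max lexx orbT.
have gy0 := drift_ge0 gG y0.
have S0 := upper_tail_ge0 tS v.
have [up lo] := hC _ _ _ _ _ P _ _ _ _ _ gG tS v1 del0 del1 del10 cc.
set Q' := \int[P]_w _ in up lo.
have bw s : 0 <= s -> bounded_rv (fun w => (1 + `|g (X w)|) `^ (s + 1) * expR (G (clamp 0 y (X w)))).
  move=> s0; apply: bounded_rvM.
    by apply: (weight_bounded gG del0 cc); nn.
  exact: (exp_clamp_bounded gG cc (lexx 0) y0).
have QQ : Q' <= S v * ((Ca + Cb) * Q).
  have -> : Q' = \int[P]_w (delta * S v * ((1 + `|g (X w)|) `^ (1 + 1) * expR (G (clamp 0 y (X w)))) +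
     delta1 * S v * ((1 + `|g (X w)|) `^ (tau + 1) * expR (G (clamp 0 y (X w))))).
    apply: eq_Rintegral => w _; rewrite /stein_weight -/y.
    have t0 : 0 <= 1 + `|g (X w)| by nn.
    rewrite (powR_add1 t0 ler01) (powR_add1 t0 (ltW tau_gt0)) (powRr1 t0); ring.
  have b1 := bw 1 ler01; have bt := bw tau (ltW tau_gt0).
  rewrite expectD; [|by brv|by brv]; rewrite !expectZ//.
  have h1 := ha _ _ _ _ P _ _ _ _ _ gG del0 del1 del10 del11 y0 ty cc.
  have h2 := hb _ _ _ _ P _ _ _ _ _ gG del0 del1 del10 del11 y0 ty cc.
  have e1 : 0 <= delta * S v by nn.
  have e2 : 0 <= delta1 * S v by nn.
  apply: le_trans (lerD (ler_wpM2l e1 h1) (ler_wpM2l e2 h2)) _.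
  rewrite /Q; set u1 := (1 + y) * _; set u2 := (1 + y) * _.
  have u10 : 0 <= u1 by rewrite /u1; nn.
  have u20 : 0 <= u2 by rewrite /u2; nn.
  have n1 : 0 <= delta * S v * (Cb * u1) by nn.
  have n2 : 0 <= delta1 * S v * (Ca * u2) by nn.
  lra.
have CQ := ler_wpM2l (ltW C0) QQ.
split; [apply: le_trans up _|apply: le_trans lo]; lra.
Qed.

(** Relates the error at the shifted level [y] to the one at [z]. Near the origin
    both sides are of constant size; elsewhere [1 + g y] is at most a multiple of
    [g z]. *)
Lemma polynomial_bound (s : R) : 0 <= s -> exists2 C : R, 0 < C &
  forall g G (y z : R), drift g G -> 0 <= y -> y <= z + 1 -> 0 <= z ->
  (1 + y) * (1 + g y) `^ (s + 1) <= C * (1 + z * g z `^ (s + 1)).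
Proof.
move=> s0; have s10 : 0 <= s + 1 by nn.
have [A [a [A1 a0 low]]] := drift_lower c2 c3 m c1_gt0.
have A0 : 0 <= A by exact: le_trans A1.
have [B B0 up] := drift_bounded c1 c3 c2_gt0 m_ge0 (A + 1).
pose Cg := 1 + c2 * (m + 1).
have Cg0 : 0 <= Cg by rewrite /Cg; nn.
pose E := Cg * (1 / a + 1).
have E0 : 0 <= E by rewrite /E; nn.
exists (1 + (A + 2) * B `^ (s + 1) + 3 * E `^ (s + 1)).
  by rewrite -addrA ltr_pwDl//; nn.
move=> g G y z gG y0 yz z0.
have gz0 := drift_ge0 gG z0; have gy0 := drift_ge0 gG y0.
have zg0 : 0 <= z * g z `^ (s + 1) by nn.
have k1 : 0 <= (A + 2) * B `^ (s + 1) by nn.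
have k2 : 0 <= 3 * E `^ (s + 1) by nn.
have [zA|/ltW Az] := leP z A.
  have yA : y <= A + 1 by lra.
  apply: (@le_trans _ _ ((A + 2) * B `^ (s + 1))).
    apply: ler_pM; [by nn|by nn|lra|apply: powR_le; [by []|by nn|]].
    have := up _ _ gG y; rewrite !ger0_norm//; exact.
  rewrite -[leLHS]mulr1; apply: ler_pM => //; lra.
have gza := low _ _ gG _ Az; have gzp : 0 < g z by exact: lt_le_trans gza.
have one : 1 <= 1 / a * g z by rewrite mul1r mulrC ler_pdivlMr// mul1r.
have z10 : 0 <= z + 1 by nn.
have gE : 1 + g y <= E * g z.
  have yz1 : `|z + 1 - z| <= 1 by rewrite (addrC z) addrK normr1.
  have := drift_shift c2_gt0 m_ge0 gG yz1.
  rewrite (ger0_norm gz0) (ger0_norm (drift_ge0 gG z10)) -/Cg => h.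
  have h2 : 1 + g y <= 1 + g (z + 1) by rewrite lerD2l; exact: drift_homo gG _ _ yz.
  apply: le_trans h2 _; apply: le_trans h _.
  rewrite /E -mulrA ler_wpM2l// mulrDl mul1r; lra.
apply: (@le_trans _ _ (3 * z * (E `^ (s + 1) * g z `^ (s + 1)))).
  apply: ler_pM; [by nn|by nn| |].
    have := le_trans A1 Az; lra.
  rewrite -(powRM _ E0 gz0); apply: powR_le => //; by nn.
have -> : 3 * z * (E `^ (s + 1) * g z `^ (s + 1)) =
  3 * E `^ (s + 1) * (z * g z `^ (s + 1)) by ring.
apply: ler_pM => //; lra.
Qed.

(** Between [z - delta] and [z + delta] the density is at most a constant times its
    value at [z], which is itself at most a multiple of [(1 + g z) * S z]. *)
Lemma upper_tail_shift (q : R) : 0 < q -> exists2 C : R, 0 < C &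
  forall g G S (delta z : R), drift g G -> upper_tail G S -> 0 < delta ->
  0 <= z -> delta * g z <= q ->
  S (z - delta) <= S z * (1 + C * (delta * (1 + g z))) /\
  S z * (1 - C * (delta * (1 + g z))) <= S (z + delta).
Proof.
move=> q0; have [C C0 hC] := upper_tail_ge c3 c1_gt0 c2_gt0 m_ge0.
exists (c1 * expR q * C); first by rewrite !mulr_gt0 ?expR_gt0.
move=> g G S delta z gG tS del0 z0 dz.
have h := hC _ _ _ z gG tS z0.
have main (x y : R) : x <= y -> y - x = delta -> z - delta <= x -> z <= y ->
    S x - S y <= S z * (c1 * expR q * C * (delta * (1 + g z))).
  move=> xy yx zx zy.
  have [c /andP[xc cy] e] := mvt (upper_tail_derive tS) xy.
  have Gc : G z - q <= G c.
    have [zc|/ltW cz] := leP z c.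
      by have := primitive_homo gG z0 zc; lra.
    have /andP[_] := primitive_convex gG cz.
    have : g z * (z - c) <= g z * delta by rewrite ler_wpM2l ?(drift_ge0 gG)//; lra.
    lra.
  have -> : S x - S y = c1 * expR (- G c) * delta.
    by rewrite -yx -opprB e; ring.
  have e1 : expR (- G c) <= expR q * (C * ((1 + g z) * S z)).
    apply: (@le_trans _ _ (expR q * expR (- G z))).
      by rewrite -expRD ler_expR; lra.
    by rewrite ler_wpM2l ?expR_ge0.
  have := ler_wpM2r (ltW del0) (ler_wpM2l (ltW c1_gt0) e1); lra.
split.
  have := main (z - delta) z; rewrite -subr_ge0 subKr.
  by move=> /(_ (ltW del0) erefl (lexx _) (lexx _)); lra.
have zzd : z <= z + delta by lra.
have zd : z + delta - z = delta by ring.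
have zdz : z - delta <= z by lra.
by have := main z (z + delta) zzd zd zdz zzd; lra.
Qed.

(** Far from the origin [z * g z ^+ 2] and [z * g z `^ (tau + 1)] are large, so a
    step that exceeds one is only compatible with a bounded [z]. *)
Lemma steps_le1 : exists2 Z : R, 0 <= Z &
  forall g G (delta delta1 z : R), drift g G -> 0 < delta -> 0 < delta1 ->
  0 <= z -> delta * (z * g z ^+ 2) + delta1 * (z * g z `^ (tau + 1)) <= 1 ->
  (z <= Z /\ 1 <= delta + delta1) \/ (delta <= 1 /\ delta1 <= 1).
Proof.
have [A [a [A1 a0 low]]] := drift_lower c2 c3 m c1_gt0.
have A0 : 0 <= A by exact: le_trans A1.
have at0 : 0 < a `^ (tau + 1) by exact: powR_gt0.
have a20 : 0 < a ^+ 2 by exact: exprn_gt0.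
have ia : 0 <= 1 / a ^+ 2 by nn.
have ib : 0 <= 1 / a `^ (tau + 1) by nn.
exists (A + 1 / a ^+ 2 + 1 / a `^ (tau + 1)); first by nn.
move=> g G delta delta1 z gG del0 del10 z0.
have gz0 := drift_ge0 gG z0.
set F1 := z * g z ^+ 2; set F2 := z * g z `^ (tau + 1) => sm.
have F10 : 0 <= F1 by rewrite /F1; nn.
have F20 : 0 <= F2 by rewrite /F2; nn.
have w1 : 0 <= delta * F1 by nn.
have w2 : 0 <= delta1 * F2 by nn.
have [del1|del1] := leP delta 1; last first.
  left; split; last by lra.
  have [zA|/ltW Az] := leP z A; first by lra.
  have gza := low _ _ gG _ Az.
  have : F1 <= delta * F1 by rewrite ler_peMl// ltW.
  have : z * a ^+ 2 <= F1.
    by rewrite /F1 ler_wpM2l// lerXn2r ?nnegrE// ltW.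
  rewrite -ler_pdivlMr// => h hF.
  have : F1 / a ^+ 2 <= 1 / a ^+ 2 by rewrite ler_pM2r ?invr_gt0//; lra.
  lra.
have [del11|del11] := leP delta1 1; first by right.
left; split; last by lra.
have [zA|/ltW Az] := leP z A; first by lra.
have gza := low _ _ gG _ Az.
have : F2 <= delta1 * F2 by rewrite ler_peMl// ltW.
have : z * a `^ (tau + 1) <= F2.
  by rewrite /F2 ler_wpM2l//; apply: powR_le; [by nn|exact: ltW|].
rewrite -ler_pdivlMr// => h hF.
have : F2 / a `^ (tau + 1) <= 1 / a `^ (tau + 1).
  by rewrite ler_pM2r ?invr_gt0//; lra.
lra.
Qed.

(** If a step exceeds one, [z] is bounded and so is [1 / S z]. Otherwise compare
    the tails at the levels [z - delta] and [z + delta], which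
    [stein_inequalities] shifts back to [z], and return to [S z] by
    [upper_tail_shift]. *)
Lemma core_moderate_deviation : exists2 C : R, 0 < C &
  forall g G S d (Omega : measurableType d) (P : probability Omega R)
    (delta delta1 : R) (X k : Omega -> R) (z : R),
  drift g G -> upper_tail G S -> 0 < delta -> 0 < delta1 ->
  core_coupling P g delta delta1 X k -> 0 <= z ->
  delta * (z * g z ^+ 2) + delta1 * (z * g z `^ (tau + 1)) <= 1 ->
  0 < S z /\
  `|fine (P [set w | z < X w]) / S z - 1| <=
    C * (delta * (1 + z * g z ^+ 2) + delta1 * (1 + z * g z `^ (tau + 1))).
Proof.
have levels (z delta : R) : 0 <= z -> 0 < delta -> delta <= 1 ->
    [/\ - 1 <= z + delta, z + delta <= z + 1, - 1 <= z - delta & z - delta <= z + 1].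
  by move=> z0 del0 del1; split; lra.
have prod_ge (k l n M : R) : 0 <= k * l -> 0 <= n -> k + l + n <= M ->
    1 - M <= (1 - l) * (1 - k) by lra.
have prod_le (k l n M : R) : k * l <= n -> k + l + n <= M ->
    (1 + l) * (1 + k) <= 1 + M by lra.
have [q q0 hq] := tame_small c3 c1_gt0 c2_gt0 m_ge0 tau_gt0.
have [Cc Cc0 hc] := tail_comparison q0.
have [Ca Ca0 ha] := polynomial_bound ler01.
have [Cb Cb0 hb] := polynomial_bound (ltW tau_gt0).
have [Cs Cs0 hs] := upper_tail_shift q0.
have [Cl Cl0 hl] := upper_tail_ge c3 c1_gt0 c2_gt0 m_ge0.
have [Z Z0 hZ] := steps_le1.
have [B B0 up] := drift_bounded c1 c3 c2_gt0 m_ge0 Z.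
pose K := Cc * (Ca + Cb).
pose L := Cs * Ca.
have K0 : 0 < K by rewrite /K mulr_gt0// addr_gt0.
have L0 : 0 < L by rewrite /L mulr_gt0.
pose D := Cl * (B * expR (B * Z)).
have D0 : 0 < D by rewrite /D !mulr_gt0// expR_gt0.
exists (K + L + 3 * K * L + (D + 1)).
  by have := mulr_gt0 K0 L0; lra.
move=> g G S d Omega P delta delta1 X k z gG tS del0 del10 cc z0 sm.
have gz0 := drift_ge0 gG z0.
have S0 : 0 < S z.
  have := hl _ _ _ z gG tS z0; have := expR_gt0 (- G z).
  move=> e1 e2; have := lt_le_trans e1 e2; rewrite pmulr_rgt0// pmulr_rgt0//.
  by rewrite ltr_pwDl.
split=> //.
set p := fine _.
have p01 : 0 <= p <= 1.
  rewrite /p; apply/andP; split; first exact: fine_ge0.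
  have mX := core_measurable cc.
  rewrite -expect_lt// -[leRHS](expect_cst P); apply: expect_le => [||w].
  - by apply: bounded_rv_lt => //; exact: mfun_cst.
  - exact: bounded_rv_cst.
  - by case: (_ < _).
set F1 := z * g z ^+ 2 in sm *; set F2 := z * g z `^ (tau + 1) in sm *.
have F10 : 0 <= F1 by rewrite /F1; nn.
have F20 : 0 <= F2 by rewrite /F2; nn.
set E := delta * (1 + F1) + delta1 * (1 + F2).
have w1 : 0 <= delta * F1 by nn.
have w2 : 0 <= delta1 * F2 by nn.
have E0 : 0 <= E by rewrite /E; nn.
suff : S z * (1 - (K + L + 3 * K * L + (D + 1)) * E) <= p
    <= S z * (1 + (K + L + 3 * K * L + (D + 1)) * E).
  move=> /andP[h1 h2]; rewrite ler_norml lerBrDr lerBlDr.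
  rewrite ler_pdivlMr// ler_pdivrMr//; apply/andP; split; lra.
have KL0 : 0 <= K * L by nn.
have [[zZ dd]|[del1 del11]] := hZ _ _ _ _ _ gG del0 del10 z0 sm.
- have E1 : 1 <= E by rewrite /E; lra.
  have SD : 1 <= S z * D.
    have h := hl _ _ _ z gG tS z0.
    have gB : 1 + g z <= B.
      by have := up _ _ gG z; rewrite !ger0_norm//; exact.
    have GB : G z <= B * Z.
      apply: le_trans (primitive_le gG z0) _; apply: ler_pM => //; lra.
    have := ler_wpM2r (expR_ge0 (G z)) h; rewrite -expRD addNr expR0 => /le_trans; apply.
    rewrite /D; have -> : S z * (Cl * (B * expR (B * Z))) = Cl * (B * S z) * expR (B * Z) by ring.
    apply: ler_pM; [by nn|by nn| |by rewrite ler_expR].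
    by rewrite ler_wpM2l ?(ltW Cl0)// ler_wpM2r// ltW.
  have /andP[p0 p1] := p01.
  set M := K + L + 3 * K * L + (D + 1).
  have M1 : D + 1 <= M * E.
    apply: (@le_trans _ _ M); first by rewrite /M; lra.
    by rewrite ler_peMr// /M; lra.
  have SM := ler_wpM2l (ltW S0) M1.
  apply/andP; split; lra.
have tz1 := hq _ _ _ _ _ gG del0 del1 del10 del11 z0 sm.
have z10 : 0 <= z + 1 by nn.
have tz : tame q g delta delta1 z.
  by apply: (tame_le c2_gt0 m_ge0 tau_gt0 gG del0 del10 z0 _ tz1); rewrite lerDl.
have dgq : delta * g z <= q.
  have [h1 _] := tz; apply: le_trans h1.
  have zg : 0 <= z * g z by nn.
  have := mulr_ge0 (mulr_ge0 (ltW del0) (addr_ge0 ler01 gz0)) zg.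
  have := del0; lra.
have dgE : Cs * (delta * (1 + g z)) <= L * E.
  rewrite /L -mulrA ler_wpM2l ?(ltW Cs0)//.
  have zz1 : z <= z + 1 by rewrite lerDl.
  have := ha _ _ z z gG z0 zz1 z0.
  have -> : g z `^ (1 + 1) = g z ^+ 2 by rewrite -(powR_mulrn 2 gz0); congr (_ `^ _); ring.
  rewrite -/F1 => h.
  have t1 : 1 <= 1 + g z by rewrite lerDl.
  have h2 : 1 + g z <= (1 + z) * (1 + g z) `^ (1 + 1).
    have tt : 0 <= 1 + g z by nn.
    rewrite powR_add1// powRr1// -[leLHS]mul1r; apply: ler_pM => //; first by rewrite lerDl.
    by rewrite ler_peMr.
  have h3 := ler_wpM2l (ltW del0) (le_trans h2 h).
  have : 0 <= Ca * (delta1 * (1 + F2)) by nn.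
  rewrite /E; lra.
have QE (v : R) : v <= z + 1 -> let y := Num.max v 0 in
    Cc * (delta * ((1 + y) * (1 + g y) `^ (1 + 1)) +
      delta1 * ((1 + y) * (1 + g y) `^ (tau + 1))) <= K * E.
  move=> vz /=; set y := Num.max v 0; rewrite /K -mulrA ler_wpM2l ?(ltW Cc0)//.
  have y0 : 0 <= y by rewrite /y le_max lexx orbT.
  have yz : y <= z + 1 by rewrite /y ge_max vz.
  have h1 := ler_wpM2l (ltW del0) (ha _ _ y z gG y0 yz z0).
  have h2 := ler_wpM2l (ltW del10) (hb _ _ y z gG y0 yz z0).
  have e2 : g z `^ (1 + 1) = g z ^+ 2 by rewrite -(powR_mulrn 2 gz0); congr (_ `^ _); ring.
  rewrite e2 -/F1 in h1; rewrite -/F2 in h2.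
  have n1 : 0 <= Cb * (delta * (1 + F1)) by nn.
  have n2 : 0 <= Ca * (delta1 * (1 + F2)) by nn.
  rewrite /E; lra.
have tv (v : R) : v <= z + 1 -> tame q g delta delta1 (Num.max v 0).
  move=> vz; apply: (tame_le c2_gt0 m_ge0 tau_gt0 gG del0 del10 _ _ tz1).
    by rewrite le_max lexx orbT.
  by rewrite ge_max vz.
have E3 : E <= 3 by rewrite /E; lra.
have [s1 s2] := hs _ _ _ _ _ gG tS del0 z0 dgq.
have S00 := ltW S0.
set M := K + L + 3 * K * L + (D + 1).
have ME : K * E + L * E + 3 * K * L * E <= M * E.
  by rewrite -!mulrDl ler_wpM2r// /M lerDl addr_ge0// ltW.
have KE0 : 0 <= K * E by nn.
have LE0 : 0 <= L * E by nn.
have n0 : 0 <= 3 * K * L * E by nn.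
have [v1 vz v1' vz'] := levels _ _ z0 del0 del1.
apply/andP; split.
  have [_ lo] := hc _ _ _ _ _ P _ _ _ _ _ gG tS v1 del0 del1 del10 del11 (tv _ vz) cc.
  have q1 := QE _ vz; rewrite /= addrK -/p in lo q1 *.
  set u := Cc * _ in lo q1.
  have [u1|/ltW u1] := leP (K * E) 1; last first.
    have /andP[p0 _] := p01; apply: le_trans p0.
    rewrite mulr_ge0_le0// subr_le0; apply: le_trans u1 _; apply: le_trans ME.
    by rewrite -addrA lerDl addr_ge0.
  have Sv0 := upper_tail_ge0 tS (z + delta).
  apply: le_trans lo.
  apply: (@le_trans _ _ (S (z + delta) * (1 - K * E))); last first.
    by rewrite ler_wpM2l// lerD2l lerN2.
  apply: (@le_trans _ _ (S z * (1 - L * E) * (1 - K * E))); last first.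
    rewrite ler_wpM2r ?subr_ge0//; apply: le_trans s2.
    by rewrite ler_wpM2l// lerD2l lerN2.
  rewrite -mulrA ler_wpM2l//; apply: prod_ge n0 ME.
  exact: mulr_ge0.
have [hi _] := hc _ _ _ _ _ P _ _ _ _ _ gG tS v1' del0 del1 del10 del11 (tv _ vz') cc.
have q1 := QE _ vz'; rewrite /= subrK -/p in hi q1 *.
set u := Cc * _ in hi q1.
apply: le_trans hi _.
apply: (@le_trans _ _ (S (z - delta) * (1 + K * E))).
  by rewrite ler_wpM2l ?(upper_tail_ge0 tS)// lerD2l.
apply: (@le_trans _ _ (S z * (1 + L * E) * (1 + K * E))).
  rewrite ler_wpM2r ?addr_ge0//; apply: le_trans s1 _.
  by rewrite ler_wpM2l// lerD2l.
rewrite -mulrA ler_wpM2l//; apply: prod_le ME.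
have -> : K * E * (L * E) = K * L * E * E by ring.
have -> : 3 * K * L * E = K * L * E * 3 by ring.
by rewrite ler_wpM2l//; nn.
Qed.

End Comparison.

(** * Density and primitive of the limiting law *)

Section Primitive.
Variable R : realType.
Notation mu := (@lebesgue_measure R).

Lemma continuous_integrable (f : R -> R) (a b : R) : continuous f ->
  mu.-integrable `[a, b] (EFin \o f).
Proof.
move=> cf; apply: continuous_compact_integrable; first exact: segment_compact.
exact: continuous_subspaceT.
Qed.

Lemma Rintegral_chasles (f : R -> R) (a b c : R) : continuous f ->
  a <= b -> b <= c ->
  \int[mu]_(t in `[a, c]) f t = \int[mu]_(t in `[a, b]) f t + \int[mu]_(t in `[b, c]) f t.
Proof.
move=> cf ab bc.
have := @Rintegral_itvB R f (BLeft a) (BRight c) b (continuous_integrable a c cf).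
rewrite !bnd_simp => /(_ ab bc); rewrite Rintegral_itv_obnd_cbnd.
  by move=> <-; rewrite addrC subrK.
apply: integrableS (continuous_integrable a c cf) => //.
by apply: subset_itvr; rewrite bnd_simp.
Qed.

Lemma is_derive_of_increments (f F : R -> R) : continuous f ->
  (forall a x : R, a <= x -> F x - F a = \int[mu]_(t in `[a, x]) f t) ->
  forall x : R, is_derive x 1 F (f x).
Proof.
move=> cf dF x; pose a := x - 1.
have ax : a < x by rewrite /a; lra.
have xu : x < x + 1 by lra.
have [d1 d2] := continuous_FTC1_closed xu (continuous_integrable a (x + 1) cf) ax (cf x).
pose H y := F a + \int[mu]_(t in `[a, y]) f t.
have dH : is_derive x (1 : R) H (f x).
  apply: is_derive_addc; rewrite -d2 derive1E; exact: derivableP.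
apply: (near_eq_is_derive _ dH).
near=> y; rewrite /H -dF; first by ring.
by apply: ltW; near: y; exact: lt_nbhsr.
Unshelve. all: end_near. Qed.

Lemma integral_from0_increments (g : R -> R) : continuous g ->
  forall a x : R, a <= x ->
  integral_from0 g x - integral_from0 g a = \int[mu]_(t in `[a, x]) g t.
Proof.
move=> cg a x ax; rewrite /integral_from0.
have [x0|x0] := leP 0 x; have [a0|a0] := leP 0 a.
- rewrite (Rintegral_chasles cg a0 ax); ring.
- rewrite (Rintegral_chasles cg (ltW a0) x0); ring.
- by have := le_lt_trans ax x0; rewrite ltNge a0.
- rewrite (Rintegral_chasles cg ax (ltW x0)); ring.
Qed.

Lemma integral_from0_derive (g : R -> R) : continuous g ->
  forall x : R, is_derive x 1 (integral_from0 g) (g x).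
Proof.
by move=> cg; apply: is_derive_of_increments => //; exact: integral_from0_increments.
Qed.

Lemma integral_from00 (g : R -> R) : integral_from0 g 0 = 0.
Proof. by rewrite /integral_from0 lexx set_itv1 Rintegral_set1. Qed.

End Primitive.

Section UpperTailOfDensity.
Context (R : realType) d (T : measurableType d) (Q : probability T R).
Variables (Y : {RV Q >-> R}) (c1 : R) (G : R -> R).
Hypotheses (cG : continuous G)
  (Y_density : has_density Y (fun y => c1 * expR (- G y))).
Let S x := fine (Q [set w | x < Y w]).

Let SE x : S x = fine (ccdf Y x).
Proof.
rewrite /S /ccdf /distribution /pushforward; congr (fine (Q _)).
by apply/seteqP; split => w /=; rewrite in_itv/= andbT.
Qed.

Lemma density_upper_tail : upper_tail c1 G S.
Proof.
have mR (A : set R) : measurable A -> distribution Q Y A \is a fin_num.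
  by move=> mA; exact: fin_num_measure.
split.
- have cp : continuous (fun y => c1 * expR (- G y)).
    move=> y; apply: cvgM; first exact: cvg_cst.
    apply: (@continuous_comp _ _ _ (fun x => - G x) expR); first by apply: cvgN; exact: cG.
    exact: continuous_expR.
  suff dN (x : R) : is_derive x 1 (fun y => - S y) (c1 * expR (- G x)).
    move=> x; have := is_derive_opp (dN x).
    by rewrite (_ : (fun y => - - S y) = S)//; apply/funext => y; rewrite opprK.
  move: x; apply: (is_derive_of_increments cp) => a x ax.
  rewrite opprK addrC !SE /ccdf.
  have -> : distribution Q Y `]a, +oo[%classic =
      (distribution Q Y `]a, x]%classic + distribution Q Y `]x, +oo[%classic)%E.
    rewrite -measureU//; last first.
      apply/seteqP; split => // y [/=]; rewrite !in_itv/= andbT => /andP[_ yx].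
      by rewrite ltNge yx.
    by rewrite -itv_bndbnd_setU// bnd_simp.
  rewrite fineD; [|exact: mR|exact: mR].
  rewrite addrK (Y_density (measurable_itv _)) /Rintegral integral_itv_obnd_cbnd//.
  by apply/measurable_EFinP/measurable_funTS; exact: continuous_measurable_fun.
- by move=> x; exact: fine_ge0.
- move=> x; rewrite SE -lee_fin fineK ?mR//.
  rewrite -(probability_setT (distribution Q Y)).
  by apply: le_measure => //; rewrite inE.
- move=> L0 e e0.
  by have [L LL h] := prob_tail_small Q L0 (@measurable_funPT _ _ _ _ Y) e0; exists L.
- move=> L0 e e0.
  have /fine_cvgP[_ /cvgrPdist_le /(_ e e0) h] := cvg_ccdfNy1 Y.
  near (ninfty_nbhs R) => L; exists L.
    by near: L; apply: nbhs_ninfty_le; exact: num_real.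
  have : `|1 - fine (ccdf Y L)| <= e by near: L.
  by rewrite -SE => /(le_trans (ler_norm _)); rewrite lerBlDr -lerBlDl.
Unshelve. all: end_near. Qed.

End UpperTailOfDensity.

(** Between [0] and [y] the density is at least its value at [y], and its integral
    there is at most one. *)
Lemma upper_tail_mass (R : realType) (c1 : R) (g G S : R -> R) :
  0 < c1 -> (forall x : R, is_derive x 1 G (g x)) ->
  (forall x y : R, x <= y -> g x <= g y) -> g 0 = 0 -> upper_tail c1 G S ->
  forall y : R, c1 * `|y| * expR (- G y) <= 1.
Proof.
move=> c10 dG gh g0 tS y.
have dS := upper_tail_derive tS.
have S0 := upper_tail_ge0 tS; have S1 := upper_tail_le1 tS.
have [y0|/ltW y0] := leP 0 y.
  have [c /andP[c0 cy] e] := mvt dS y0.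
  have [b /andP[cb by_] e'] := mvt dG cy.
  have gb : 0 <= g b by rewrite -g0 gh// (le_trans c0).
  have Gcy : expR (- G y) <= expR (- G c).
    by rewrite ler_expR lerN2 -subr_ge0 e' mulr_ge0 ?subr_ge0.
  have := ler_wpM2l (mulr_ge0 (ltW c10) y0) Gcy.
  have := S0 y; have := S1 0; rewrite ger0_norm//; lra.
have [c /andP[yc c0] e] := mvt dS y0.
have [b /andP[yb bc] e'] := mvt dG yc.
have gb : g b <= 0 by rewrite -g0 gh// (le_trans bc).
have Gcy : expR (- G y) <= expR (- G c).
  by rewrite ler_expR lerN2 -subr_le0 e' mulr_le0_ge0 ?subr_ge0.
have Ny0 : 0 <= - y by rewrite oppr_ge0.
have := ler_wpM2l (mulr_ge0 (ltW c10) Ny0) Gcy.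
by have := S0 0; have := S1 y; rewrite ler0_norm//; lra.
Qed.

(** * Expectations up to null sets *)

Section Expectation.
Context d (Omega : measurableType d) (R : realType) (P : probability Omega R).
Implicit Types X Y V : Omega -> R.

Lemma expect_ae_eq X Y : measurable_fun setT X -> measurable_fun setT Y ->
  {ae P, forall w, X w = Y w} -> \int[P]_w X w = \int[P]_w Y w.
Proof.
move=> mX mY XY; congr fine; apply: ae_eq_integral => //.
- exact/measurable_EFinP.
- exact/measurable_EFinP.
- by apply: filterS XY => w XYw _ /=; rewrite XYw.
Qed.

Lemma expect_ae_le X Y : P.-integrable setT (EFin \o X) ->
  P.-integrable setT (EFin \o Y) ->
  {ae P, forall w, X w <= Y w} -> \int[P]_w X w <= \int[P]_w Y w.
Proof.
move=> iX iY XY; rewrite -subr_ge0 -RintegralB//.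
have mX := measurable_int _ iX; have mY := measurable_int _ iY.
have {}mX : measurable_fun setT X by exact/measurable_EFinP.
have {}mY : measurable_fun setT Y by exact/measurable_EFinP.
rewrite (@expect_ae_eq _ (fun w => Num.max (Y w - X w) 0)).
- by apply: Rintegral_ge0 => w _; rewrite le_max lexx orbT.
- by apply: mfunD' => //; exact: mfunN'.
- by mfun.
- apply: filterS XY => w XYw; symmetry; apply/max_idPl.
  by rewrite subr_ge0.
Qed.

Lemma integrable_mul_bounded V X (M : R) : P.-integrable setT (EFin \o V) ->
  measurable_fun setT X -> (forall w, `|X w| <= M) ->
  P.-integrable setT (EFin \o (fun w => V w * X w)).
Proof.
move=> iV mX XM.
have mV : measurable_fun setT V.
  by move: (measurable_int _ iV) => /measurable_EFinP.
have iMV : P.-integrable setT (EFin \o (fun w => M * V w)) by exact: (integrableZl measurableT M iV).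
apply: le_integrable iMV => //.
  by apply/measurable_EFinP; exact: mfunM'.
move=> w _ /=; rewrite lee_fin !normrM mulrC ler_wpM2r//.
exact: le_trans (XM w) (ler_norm M).
Qed.

Lemma Rintegral_bool V (b : Omega -> bool) :
  \int[P]_(w in [set w | b w]) V w = \int[P]_w (V w * (b w)%:R).
Proof.
rewrite Rintegral_mkcond; apply: eq_Rintegral => w _.
rewrite patchE; case: ifPn => [|]; rewrite ?inE ?notin_setE /= => bw.
  by rewrite bw mulr1.
by case: (b w) bw => // _; rewrite mulr0.
Qed.

End Expectation.

(** * Conditional expectations *)

Section Levels.
Variable R : realType.

(** The sum is the integer part of [y]. *)
Lemma sum_levels (y : R) (N : nat) : 0 <= y -> y <= N%:R ->
  y - 1 <= \sum_(j < N) (j.+1%:R <= y)%R%:R <= y.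
Proof.
move=> y0 yN.
have up n : \sum_(j < n) (j.+1%:R <= y)%R%:R <= y.
  have [] : \sum_(j < n) (j.+1%:R <= y)%R%:R <= y /\
      \sum_(j < n) (j.+1%:R <= y)%R%:R <= n%:R :> R; last by [].
  elim: n => [|n [ih1 ih2]]; first by rewrite big_ord0.
  rewrite big_ord_recr /=; have n1 : n.+1%:R = n%:R + 1 :> R by rewrite -natr1.
  by case: (leP n.+1%:R y) => h; rewrite ?mulr1n ?mulr0n; split; lra.
rewrite up andbT.
have [//|] : y - 1 <= \sum_(j < N) (j.+1%:R <= y)%R%:R \/
    N%:R <= \sum_(j < N) (j.+1%:R <= y)%R%:R :> R; last by lra.
elim: N {yN} => [|n ih]; first by right; rewrite big_ord0.
rewrite big_ord_recr /=; have n1 : n.+1%:R = n%:R + 1 :> R by rewrite -natr1.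
case: (leP n.+1%:R y) => h; rewrite ?mulr1n ?mulr0n.
  by right; case: ih; lra.
by left; case: ih; lra.
Qed.

End Levels.

Section ConditionalExpectation.
Context d (Omega : measurableType d) (R : realType) (P : probability Omega R).
Variable W : {RV P >-> R}.

(** The function [n * phi] differs by at most one from the number of integers
    [j + 1 <= n * phi], a sum of indicators against which [V] integrates to zero.
    Hence [n] times the modulus of the integral is at most the mean of [|V|]. *)
Lemma orthogonal_levels (V : Omega -> R) (phi : R -> R) (M : R) :
  P.-integrable setT (EFin \o V) ->
  (forall b : R -> bool, measurable_fun setT b ->
     \int[P]_w (V w * (b (W w))%:R) = 0) ->
  measurable_fun setT phi -> (forall x, 0 <= phi x <= M) ->
  \int[P]_w (V w * phi (W w)) = 0.
Proof.
move=> iV orth mphi phiM.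
have mW : measurable_fun setT W by [].
have iVb (b : R -> bool) : measurable_fun setT b ->
    P.-integrable setT (EFin \o (fun w => V w * (b (W w))%:R)).
  move=> mb; apply: (@integrable_mul_bounded _ _ _ _ _ _ 1) => //.
    by apply: mfun_bool; exact: measurableT_comp mb mW.
  by move=> w; case: (b _); rewrite ?normr0 ?normr1.
pose Phi n N x : R := \sum_(j < N) (j.+1%:R <= n%:R * phi x)%R%:R.
have mlev n (j : nat) : measurable_fun setT (fun x => j.+1%:R <= n%:R * phi x).
  apply: measurable_fun_ler; first exact: mfun_cst.
  by apply: mfunM' => //; exact: mfun_cst.
have mPhi n N : measurable_fun setT (Phi n N).
  by apply: measurable_sum => j; apply: mfun_bool; exact: mlev.
have PhiN n N x : `|Phi n N x| <= N%:R.
  apply: le_trans (ler_norm_sum _ _ _) _.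
  have -> : N%:R = \sum_(j < N) 1 :> R by rewrite sumr_const card_ord.
  by apply: ler_sum => j _; case: (j.+1%:R <= _); rewrite ?normr0 ?normr1.
have iVPhi n N : P.-integrable setT (EFin \o (fun w => V w * Phi n N (W w))).
  apply: (@integrable_mul_bounded _ _ _ _ _ _ N%:R) => // w.
  by apply: mfun_comp.
have VPhi n N : \int[P]_w (V w * Phi n N (W w)) = 0.
  elim: N => [|N ih].
    under eq_Rintegral do rewrite /Phi big_ord0 mulr0.
    by rewrite Rintegral_cst// mul0r.
  under eq_Rintegral do rewrite /Phi big_ord_recr /= mulrDr.
  rewrite RintegralD//; first by rewrite [X in X + _]ih add0r (orth (fun x => N.+1%:R <= n%:R * phi x)).
    exact: iVPhi.
  exact: (iVb (fun x => N.+1%:R <= n%:R * phi x)).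
have M0 : 0 <= M by have /andP[h1 h2] := phiM 0; exact: le_trans h2.
have iVphi : P.-integrable setT (EFin \o (fun w => V w * phi (W w))).
  apply: (@integrable_mul_bounded _ _ _ _ _ _ M) => //; first exact: mfun_comp.
  by move=> w; have /andP[h1 h2] := phiM (W w); rewrite ger0_norm.
have iVn : P.-integrable setT (EFin \o (fun w => `|V w|)).
  by have := integrable_abse iV.
set I := \int[P]_w _; set A := \int[P]_w `|V w|.
suff small n : n.+1%:R * `|I| <= A.
  apply/eqP; rewrite -normr_le0 leNgt; apply/negP => I0.
  have AI : 0 <= A / `|I| by rewrite divr_ge0// Rintegral_ge0.
  have := archi_boundP AI; set n := Num.bound _; rewrite ltr_pdivrMr// => An.
  have := small n; rewrite leNgt => /negP; apply; apply: lt_trans An _.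
  by rewrite ltr_pM2r// ltr_nat.
have nM0 : 0 <= n.+1%:R * M by rewrite mulr_ge0.
pose N := Num.bound (n.+1%:R * M).
have NM : n.+1%:R * M <= N%:R by apply: ltW; exact: archi_boundP.
pose r x := n.+1%:R * phi x - Phi n.+1 N x.
have r1 x : `|r x| <= 1.
  have /andP[h1 h2] := phiM x.
  have y0 : 0 <= n.+1%:R * phi x by rewrite mulr_ge0.
  have yN : n.+1%:R * phi x <= N%:R by apply: le_trans NM; rewrite ler_wpM2l.
  have := sum_levels y0 yN; rewrite -/(Phi n.+1 N x) /r => /andP[l1 l2].
  by rewrite ler_norml; apply/andP; split; lra.
have iVr : P.-integrable setT (EFin \o (fun w => V w * r (W w))).
  apply: (@integrable_mul_bounded _ _ _ _ _ _ 1) => //.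
  apply: mfun_comp => //; apply: mfunD'; first by mfun.
  by apply: mfunN'; exact: mPhi.
have -> : n.+1%:R * `|I| = `|\int[P]_w (V w * r (W w))|.
  rewrite -[n.+1%:R in LHS]ger0_norm// -normrM; congr `| _ |.
  rewrite /I -RintegralZl// -[LHS]subr0 -[X in _ - X](VPhi n.+1 N) -RintegralB//.
    by apply: eq_Rintegral => w _; rewrite /r; ring.
  exact: (integrableZl measurableT n.+1%:R iVphi).
apply: le_trans (le_normr_Rintegral _ iVr) _ => //.
apply: le_Rintegral => //; first exact: (integrable_abse iVr).
by move=> w _; rewrite normrM ler_piMr.
Qed.

Lemma orthogonal_bounded (V : Omega -> R) (phi : R -> R) (M : R) :
  P.-integrable setT (EFin \o V) ->
  (forall b : R -> bool, measurable_fun setT b ->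
     \int[P]_w (V w * (b (W w))%:R) = 0) ->
  measurable_fun setT phi -> (forall x, `|phi x| <= M) ->
  \int[P]_w (V w * phi (W w)) = 0.
Proof.
move=> iV orth mphi phiM.
have iVphi : P.-integrable setT (EFin \o (fun w => V w * phi (W w))).
  by apply: (@integrable_mul_bounded _ _ _ _ _ _ M) => //; exact: mfun_comp.
have iVM : P.-integrable setT (EFin \o (fun w => V w * M)).
  exact: (integrableZr measurableT M iV).
have V0 : \int[P]_w (V w * M) = 0.
  rewrite RintegralZr//; have := orth xpredT (measurable_cst _).
  by under eq_Rintegral do rewrite mulr1; move=> ->; rewrite mul0r.
have := @orthogonal_levels V (fun x => phi x + M) (M + M) iV orth.
under eq_Rintegral do rewrite mulrDr.
rewrite RintegralD// V0 addr0; apply; first by mfun.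
move=> x; have := phiM x; rewrite ler_norml => /andP[h1 h2].
by apply/andP; split; lra.
Qed.

Lemma cond_expectation_mul (Z E : Omega -> R) (phi : R -> R) (M : R) :
  is_cond_expectation Z W E -> measurable_fun setT phi ->
  (forall x, `|phi x| <= M) ->
  \int[P]_w (Z w * phi (W w)) = \int[P]_w (E w * phi (W w)).
Proof.
move=> [iZ iE _ ZE] mphi phiM.
have mphiW : measurable_fun setT (fun w => phi (W w)) by exact: mfun_comp.
apply/eqP; rewrite -subr_eq0 -RintegralB//; try exact: (integrable_mul_bounded _ mphiW).
apply/eqP; under eq_Rintegral do rewrite -mulrBl.
apply: (@orthogonal_bounded (fun w => Z w - E w) phi M) => //.
  exact: (integrableB measurableT iZ iE).
move=> b mb.
have mB : measurable [set x | b x].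
  have -> : [set x | b x] = setT `&` b @^-1` [set true] by rewrite setTI.
  exact: mb.
pose A := W @^-1` [set x | b x].
have mA : measurable A by rewrite -[A]setTI; exact: (measurable_funPT W).
have gA : g_sigma_algebra_preimage W A.
  by exists [set x | b x] => //; rewrite setTI.
rewrite -(Rintegral_bool P (fun w => Z w - E w) (fun w => b (W w))) -/A.
have sA : A `<=` setT by [].
rewrite RintegralB//; try exact: integrableS sA _.
by rewrite /Rintegral (ZE _ gA) subrr.
Qed.

(** The event [E < 0] belongs to the sigma-algebra of [W], so [E] integrates over it
    to a nonnegative number. *)
Lemma cond_expectation_ge0 (Z E : Omega -> R) : is_cond_expectation Z W E ->
  {ae P, forall w, 0 <= Z w} -> {ae P, forall w, 0 <= E w}.
Proof.
move=> [iZ iE mE ZE] Z0.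
pose A := [set w | E w < 0].
have gA : g_sigma_algebra_preimage W A.
  have AE : E @^-1` `]-oo, 0[ = A by apply/seteqP; split => w /=; rewrite in_itv.
  by have := mE measurableT _ (measurable_itv `]-oo, 0[); rewrite setTI AE.
have mA : measurable A.
  have [B mB <-] := gA; exact: (measurable_funPT W).
have mZ : measurable_fun setT Z by move: (measurable_int _ iZ) => /measurable_EFinP.
have mE' : measurable_fun setT E by move: (measurable_int _ iE) => /measurable_EFinP.
have sA : A `<=` setT by [].
have mb : measurable_fun setT (fun w => (E w < 0)%R%:R : R).
  by apply: mfun_lt => //; exact: mfun_cst.
have b1 w : `|(E w < 0)%R%:R : R| <= 1 by case: (_ < _); rewrite ?normr0 ?normr1.
have iZb := integrable_mul_bounded iZ mb b1.
have iEb := integrable_mul_bounded iE mb b1.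
have neg w : E w * (E w < 0)%R%:R <= 0.
  by case: (ltP (E w) 0) => h; rewrite ?mulr1 ?mulr0// ltW.
have abs0 : \int[P]_w `|E w * (E w < 0)%R%:R| = 0.
  have -> : \int[P]_w `|E w * (E w < 0)%R%:R| = - \int[P]_w (E w * (E w < 0)%R%:R).
    rewrite -mulN1r -RintegralZl//; apply: eq_Rintegral => w _.
    by rewrite (ler0_norm (neg w)) mulN1r.
  apply/eqP; rewrite eq_le; apply/andP; split; last first.
    rewrite -mulN1r -RintegralZl//; apply: Rintegral_ge0 => w _.
    by rewrite mulN1r oppr_ge0.
  rewrite oppr_le0 -(Rintegral_bool P E) /Rintegral (ZE _ gA).
  rewrite -/(Rintegral P A Z) Rintegral_bool -[leLHS](expect_cst P 0).
  apply: expect_ae_le => //.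
    exact: bounded_rv_integrable (bounded_rv_cst _ _).
  by apply: filterS Z0 => w Zw; rewrite mulr_ge0.
have ae0 : ae_eq P setT (EFin \o (fun w => E w * (E w < 0)%R%:R)) (cst 0%E).
  apply/ae_eq_integral_abs => //; first exact: measurable_int iEb.
  rewrite -[LHS]fineK; first by rewrite -[fine _]/(\int[P]_w `|E w * (E w < 0)%R%:R|) abs0.
  exact: (integrable_fin_num measurableT (integrable_abse iEb)).
apply: filterS ae0 => w /(_ I) [/eqP]; rewrite mulf_eq0.
by case: (ltP (E w) 0) => // h; rewrite oner_eq0 orbF (lt_eqF h).
Qed.

End ConditionalExpectation.

(** * From a Stein coupling to its conditioned form *)

Lemma lipschitz_absolutely_continuous (R : realType) (f : R -> R) (M : R) :
  (forall x y : R, `|f x - f y| <= M * `|x - y|) -> absolutely_continuous f.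
Proof.
move=> fM e e0; have M1 : 0 < `|M| + 1 by rewrite ltr_wpDl.
exists (e / (`|M| + 1)); first by rewrite divr_gt0.
move=> n a b ab _; rewrite ltr_pdivlMr// => small; apply: le_lt_trans small.
rewrite mulr_suml; apply: ler_sum => i _; apply: le_trans (fM _ _) _.
rewrite ger0_norm ?subr_ge0// mulrC ler_wpM2l ?subr_ge0//.
by apply: le_trans (ler_norm M) _; rewrite lerDl.
Qed.

Section Reduction.
Context (R : realType) d (Omega : measurableType d) (P : probability Omega R).
Variables (W W' T : {RV P >-> R}) (delta : R).
Hypothesis delta_gt0 : 0 < delta.

(** The kernel at [t = 0] shows that [T >= 0] where [W' >= W]. At [t < 0] it shows
    that [T <= 0] where [W' - W <= t], and countably many such [t] exhaust the event
    [W' < W]. *)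
Lemma K_hat1_ge0 :
  (forall t : R, `|t| <= delta -> {ae P, forall w, 0 <= K_hat W W' T t w}) ->
  {ae P, forall w, 0 <= K_hat1 W W' T w}.
Proof.
move=> K0.
have Kpos := K0 0; rewrite normr0 in Kpos.
have Kneg : {ae P, forall w, forall n : nat, 0 <= K_hat W W' T (- (delta / n.+1%:R)) w}.
  apply/ae_foralln => n; apply: K0.
  rewrite normrN ger0_norm; last by rewrite divr_ge0 ?ltW.
  by rewrite ler_pdivrMr// ler_peMr// ?ler1n// ltW.
apply: filterS2 (Kpos (ltW delta_gt0)) Kneg => w; rewrite /K_hat /K_hat1.
set D := W' w - W w; rewrite lexx ltxx andbF /= subr0 => h0 hn.
have [D0|D0] := leP 0 D.
  by move: h0; rewrite D0 mulr1 => T0; rewrite mulr_ge0.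
have dD : 0 <= delta / - D by rewrite divr_ge0 ?ltW// oppr_gt0.
have := archi_boundP dD; set n := Num.bound _ => nD.
have := hn n; have tn : 0 < delta / n.+1%:R by rewrite divr_gt0.
have -> : (0 <= - (delta / n.+1%:R) <= D) = false by rewrite oppr_ge0 leNgt tn.
have -> : (D <= - (delta / n.+1%:R) < 0) = true.
  rewrite oppr_lt0 tn andbT lerNr ler_pdivrMr//.
  have ND : 0 < - D by rewrite oppr_gt0.
  rewrite mulrC -ler_pdivrMr//; apply: le_trans (ltW nD) _.
  by rewrite ler_nat.
rewrite mulr0n mulr1n sub0r mulrN1 oppr_ge0 => T0.
by rewrite mulr_le0// ltW.
Qed.

Variables (d0 d1 tau delta1 : R) (g : R -> R) (EK : Omega -> R).
Hypotheses (d0_ge1 : 1 <= d0) (d1_gt0 : 0 < d1) (delta1_gt0 : 0 < delta1)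
  (mg : measurable_fun setT g) (g0 : g 0 = 0).

(** Multiplying the slope condition by [T (W' - W) >= 0] gives
    [T (f W' - f W) <= T (W' - W) * u W] almost surely; taking expectations, the
    coupling identity rewrites the left-hand side, and conditioning on [W] the
    right-hand side. *)
Lemma core_coupling_of_stein :
  Stein_coupling g W W' T ->
  {ae P, forall w, `|W' w - W w| <= delta} ->
  (forall t : R, `|t| <= delta -> {ae P, forall w, 0 <= K_hat W W' T t w}) ->
  is_cond_expectation (K_hat1 W W' T) W EK ->
  {ae P, forall w, `|EK w - 1| <= delta1 * (`|g (W w)| `^ tau + 1)} ->
  {ae P, forall w, EK w <= d0} ->
  {ae P, forall w, delta * `|g (W w)| <= d1} ->
  exists X k : Omega -> R, core_coupling d0 d1 tau P g delta delta1 X k /\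
    forall z, fine (P [set w | z < X w]) = fine (P [set w | z < W w]).
Proof.
move=> coupling close K0 cond near1 EKd gd.
have K10 := K_hat1_ge0 K0.
have EK0 := cond_expectation_ge0 cond K10.
have [iK iEK _ _] := cond.
have mEK : measurable_fun setT EK by move: (measurable_int _ iEK) => /measurable_EFinP.
have mK : measurable_fun setT (K_hat1 W W' T).
  by move: (measurable_int _ iK) => /measurable_EFinP.
have mW : measurable_fun setT W by [].
have mW' : measurable_fun setT W' by [].
have mT : measurable_fun setT T by [].
pose good w := [/\ 0 <= EK w <= d0,
  `|EK w - 1| <= delta1 * (`|g (W w)| `^ tau + 1) & delta * `|g (W w)| <= d1].
have [N [mN PN goodN]] : {ae P, forall w, good w}.
  apply: filterS3 gd (filterI EK0 EKd) near1 => w h1 [h2 h3] h4.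
  by split => //; rewrite h2.
have mNc : measurable (~` N) by exact: measurableC.
have inN w : w \in ~` N -> good w.
  rewrite inE => Nw; apply: contrapT => ng; apply: Nw; exact: goodN.
have aeN : {ae P, forall w, w \in ~` N}.
  by exists N; split => // w /=; apply: contra_notP => Nw; rewrite inE.
pose X w := if w \in ~` N then W w else 0.
pose k w := if w \in ~` N then EK w else 1.
have mind : measurable_fun setT (fun w => w \in ~` N).
  apply: (measurable_fun_bool true); rewrite setTI.
  have -> : (fun w => w \in ~` N) @^-1` [set true] = ~` N; last by [].
  by apply/seteqP; split => w h; [exact: set_mem h|exact: mem_set].
have mX : measurable_fun setT X.
  by apply: measurable_fun_ifT => //; exact: measurable_cst.
have mk : measurable_fun setT k.
  by apply: measurable_fun_ifT => //; exact: measurable_cst.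
have aeX : {ae P, forall w, X w = W w} by apply: filterS aeN => w; rewrite /X => ->.
have aek : {ae P, forall w, k w = EK w} by apply: filterS aeN => w; rewrite /k => ->.
have Xd w : delta * `|g (X w)| <= d1.
  rewrite /X; case: ifPn => [/inN[]//|_]; by rewrite g0 normr0 mulr0 ltW.
exists X, k; split; last first.
  move=> z; rewrite -!(expect_lt P)//; apply: expect_ae_eq.
  - by apply: mfun_lt => //; exact: mfun_cst.
  - by apply: mfun_lt => //; exact: mfun_cst.
  - by apply: filterS aeX => w ->.
split => //.
- move=> w; rewrite /k; case: ifPn => [/inN[]//|_].
  by rewrite ler01 d0_ge1.
- move=> w; rewrite /k /X; case: ifPn => [/inN[]//|_].
  by rewrite subrr normr0 mulr_ge0 ?ltW// addr_gt0 ?ltr01// ltr_wpDl.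
move=> f u M lipf mu bd slope.
have M0 : 0 <= M.
  have [] := bd 0; first by rewrite g0 normr0 mulr0 ltW.
  by move=> h _; exact: le_trans h.
have mf : measurable_fun setT f by exact: lipschitz_measurable lipf.
(* u is only bounded where delta * |g| <= d1, a set to which W almost surely belongs *)
pose uD x := u x * (delta * `|g x| <= d1)%R%:R.
have muD : measurable_fun setT uD by rewrite /uD; mfun.
have uDM x : `|uD x| <= M.
  rewrite /uD; case: (leP (_ * _) d1) => h; rewrite ?mulr1 ?mulr0 ?normr0//.
  by case: (bd x h).
have mfgW : measurable_fun setT (fun w => f (W w) * g (W w)).
  by apply: (mfun_comp (h := fun x => f x * g x)) => //; mfun.
have mfgX : measurable_fun setT (fun w => f (X w) * g (X w)).
  by apply: (mfun_comp (h := fun x => f x * g x)) => //; mfun.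
have ifgX : P.-integrable setT (EFin \o (fun w => f (X w) * g (X w))).
  apply: bounded_rv_integrable; split=> //; exists M => w.
  by case: (bd (X w) (Xd w)).
have ifg : P.-integrable setT (EFin \o (fun w => f (W w) * g (W w))).
  apply/integrableP; split; first exact/measurable_EFinP.
  have /integrableP[_] := ifgX; rewrite (ae_eq_integral (fun w => `|(f (W w) * g (W w))%:E|%E))//.
  - by apply/measurable_EFinP; exact: mfun_norm.
  - by apply/measurable_EFinP; exact: mfun_norm.
  - by apply: filterS aeX => w Xw _ /=; rewrite Xw.
have iT : P.-integrable setT (EFin \o (fun w => T w * f (W' w) - T w * f (W w))).
  have mTf : measurable_fun setT (fun w => T w * f (W' w) - T w * f (W w)).
    by apply: mfunD'; [|apply: mfunN']; apply: mfunM' => //; exact: mfun_comp.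
  have iMK : P.-integrable setT (EFin \o (fun w => M * K_hat1 W W' T w)).
    exact: (integrableZl measurableT M iK).
  apply: le_integrable iMK => //; first exact/measurable_EFinP.
  move=> w _ /=; rewrite lee_fin -mulrBr !normrM (ger0_norm M0) mulrCA.
  by rewrite ler_wpM2l.
have eq : \int[P]_w (T w * f (W' w) - T w * f (W w)) = \int[P]_w (f (W w) * g (W w)).
  have := coupling f (lipschitz_absolutely_continuous lipf) iT ifg.
  by rewrite unlock => /(congr1 fine).
have -> : \int[P]_w (f (X w) * g (X w)) = \int[P]_w (f (W w) * g (W w)).
  by apply: expect_ae_eq => //; apply: filterS aeX => w ->.
have -> : \int[P]_w (k w * u (X w)) = \int[P]_w (EK w * uD (W w)).
  apply: expect_ae_eq.
  - by apply: mfunM' => //; exact: mfun_comp.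
  - by apply: mfunM' => //; exact: mfun_comp.
  - apply: filterS2 aeX aek => w Xw ->; have := Xd w; rewrite Xw /uD => ->.
    by rewrite mulr1.
rewrite -eq -(cond_expectation_mul cond muD uDM).
apply: expect_ae_le => //.
  by apply: integrable_mul_bounded iK _ _ => //; exact: mfun_comp.
apply: filterS3 close K10 gd => w cl; rewrite /K_hat1 /uD => K0w gdw; rewrite gdw.
rewrite mulr1 -mulrBr.
set D := W' w - W w in cl K0w *.
have [D0|D0] := eqVneq D 0.
  by have /eqP := D0; rewrite subr_eq0 => /eqP ->; rewrite D0 subrr !mulr0 mul0r.
have D2 : 0 < D ^+ 2 by rewrite exprn_even_gt0.
rewrite -(ler_pM2r D2); have := ler_wpM2l K0w (slope _ _ gdw cl).
rewrite -/D; lra.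
Qed.

End Reduction.

(** * The moderate deviation estimate *)

Lemma normalizing_gt0 (R : realType) (c1 : R) (G : R -> R) :
  (\int[lebesgue_measure]_y (c1 * expR (- G y))%:E = 1)%E -> 0 < c1.
Proof.
move=> norm; rewrite ltNge; apply/negP => c10.
have : (\int[lebesgue_measure]_y (c1 * expR (- G y))%:E <= 0)%E.
  rewrite integralE (_ : integral _ _ (_ ^\+)%E = 0%E).
    by rewrite sub0e oppe_le0 integral_ge0.
  apply: integral0_eq => x _; rewrite funeposE; apply/max_idPr.
  by rewrite lee_fin mulr_le0_ge0 ?expR_ge0.
by rewrite norm lee_fin ler10.
Qed.

Theorem corollary2p2 (R : realType) (d0 d1 c1 c2 c3 tau1 m : R)
  (d0_ge1 : 1 <= d0) (d1_gt0 : 0 < d1) (c2_gt0 : 0 < c2) (c3_ge1 : 1 <= c3)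
  (tau1_gt0 : 0 < tau1) :
  exists C : R,
  forall (g : R -> R)
    (g_derivable : forall y : R, derivable g y 1)
    (g_nondecreasing : {homo g : x y / x <= y})
    (g0 : g 0 = 0)
    (g_sign : forall y : R, y != 0 -> 0 < y * g y)
    (g_add : forall x y : R, `|g (x + y)| <= c2 * (`|g x| + `|g y| + 1))
    (g_deriv : forall y : R, `|g^`()%classic y| <= c3 * ((1 + `|g y|) / (1 + `|y|)))
    (g_max : Num.max (g 1) `|g (-1)| = m)
    (c1_normalizing : (\int[lebesgue_measure]_y
       (c1 * expR (- integral_from0 g y))%:E = 1)%E)
    (d : measure_display) (Omega : measurableType d) (P : probability Omega R)
    (W W' T : {RV P >-> R})
    (coupling : Stein_coupling g W W' T)
    (delta delta1 : R) (delta_gt0 : 0 < delta) (delta1_gt0 : 0 < delta1)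
    (W_close : {ae P, forall w, `|W' w - W w| <= delta})
    (K_ge0 : forall t : R, `|t| <= delta -> {ae P, forall w, 0 <= K_hat W W' T t w})
    (EK : Omega -> R)
    (EK_cond : is_cond_expectation (K_hat1 W W' T) W EK)
    (EK_near1 : {ae P, forall w,
       `|EK w - 1| <= delta1 * (`|g (W w)| `^ tau1 + 1)})
    (EK_le : {ae P, forall w, EK w <= d0})
    (gW_le : {ae P, forall w, delta * `|g (W w)| <= d1})
    (d' : measure_display) (Omega' : measurableType d')
    (Q : probability Omega' R) (Y : {RV Q >-> R})
    (Y_density : has_density Y (fun y => c1 * expR (- integral_from0 g y)))
    (z : R) (z_ge0 : 0 <= z)
    (z_small :
       delta * (z * g z ^+ 2) + delta1 * (z * g z `^ (tau1 + 1)) <= 1),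
  exists2 O1 : R, `|O1| <= C &
    fine (P [set w | z < W w]) / fine (Q [set w | z < Y w])
    = 1 + O1 * (delta * (1 + z * g z ^+ 2)
                + delta1 * (1 + z * g z `^ (tau1 + 1))).

Proof.
have [c1_gt0|c1_le0] := ltP 0 c1; last first.
  exists 0 => g _ _ _ _ _ _ _ /normalizing_gt0; by rewrite ltNge c1_le0.
(* g_max excludes a negative m *)
have [m_ge0|m_lt0] := leP 0 m; last first.
  exists 0 => g _ _ _ _ _ _ gm; move: m_lt0.
  by rewrite -gm gt_max [X in _ && X]ltNge normr_ge0 andbF.
have [C C0 main] := core_moderate_deviation c1_gt0 c2_gt0 c3_ge1 m_ge0
  d0_ge1 d1_gt0 tau1_gt0.
exists C => g g_derivable g_nondecreasing g0 g_sign g_add g_deriv g_max _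
  d Omega P W W' T coupling delta delta1 delta_gt0 delta1_gt0 W_close K_ge0
  EK EK_cond EK_near1 EK_le gW_le d' Omega' Q Y Y_density z z_ge0 z_small.
have cg : continuous g.
  by move=> x; apply/differentiable_continuous/derivable1_diffP.
pose G := integral_from0 g.
have dG : forall x : R, is_derive x 1 G (g x) by exact: integral_from0_derive.
have cG : continuous G := is_derive_continuous dG.
have tS := density_upper_tail cG Y_density.
have g_homo (x y : R) : x <= y -> g x <= g y by exact: g_nondecreasing.
have gG : drift c1 c2 c3 m g G.
  split => //.
  - exact: integral_from00.
  - by rewrite -g_max le_max lexx.
  - by rewrite -g_max le_max -normrN ler_norm orbT.
  - exact: upper_tail_mass dG g_homo g0 tS.
have [X [k [cc XW]]] := core_coupling_of_stein delta_gt0 d0_ge1 d1_gt0 delta1_gt0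
  (drift_measurable gG) g0 coupling W_close K_ge0 EK_cond EK_near1 EK_le gW_le.
have [_] := main _ _ _ _ _ P _ _ _ _ _ gG tS delta_gt0 delta1_gt0 cc z_ge0 z_small.
rewrite XW; set r := _ / _; set E := delta * _ + _ => rE.
have E0 : 0 < E.
  have gz0 := drift_ge0 gG z_ge0.
  by rewrite /E addr_gt0// mulr_gt0// ltr_pwDl// mulr_ge0 ?sqr_ge0 ?powR_ge0.
exists ((r - 1) / E).
  by rewrite normrM normfV (ger0_norm (ltW E0)) ler_pdivrMr.
by rewrite divfK ?gt_eqF// addrC subrK.
Qed.
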